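(* Let $d\in\{1,2\}$ and $s\ge1$. Let $(\zeta_0,\psi_0)$ be such that $(\zeta_0,\mathfrak{P}\psi_0)\in H^s(\mathbb{R}^d)$. For $\epsilon>0$, let $(\zeta,\psi)$ be the unique solution, with $(\zeta,\mathfrak{P}\psi)\in C(\mathbb{R},H^s(\mathbb{R}^d))\cap C^1(\mathbb{R},H^{s-1}(\mathbb{R}^d))$, of the linear system $$\epsilon\partial_t\zeta-\frac1\mu\mathcal{G}_0\psi=0,\qquad\epsilon\partial_t\psi+\zeta=0,\qquad(\zeta,\psi)_{|t=0}=(\zeta_0,\psi_0).$$ Then, for all $t\in\mathbb{R}$, the solution $(\zeta,\psi)(t)$ converges weakly to zero, and does not converge strongly, in $L^2(\mathbb{R}^d)$, as $\epsilon\to0$.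
   Context: Here $\mu>0$ and $\gamma>0$ are fixed parameters. $f(D)$ denotes the Fourier multiplier with symbol $f(\xi)$. $|D^\gamma|$ has symbol $|\xi^\gamma|$, where $\xi^\gamma=\xi$ if $d=1$ and $\xi^\gamma=(\xi_1,\gamma\xi_2)$ if $d=2$. $\mathfrak{P}=\dfrac{|D^\gamma|}{(1+\sqrt\mu|D^\gamma|)^{1/2}}$, and $\mathcal{G}_0=\sqrt\mu|D^\gamma|\tanh(\sqrt\mu|D^\gamma|)$ is the Dirichlet–Neumann operator for flat surface and flat bottom. The system is the linearization around the rest state of the water-waves equations in the rescaled time $t'=\epsilon t$ (rigid lid scaling).
   Formalization: Convergence is stated for (ζ,𝔓ψ)(t) instead of (ζ,ψ)(t), since ψ(t) need not lie in, or stay bounded in, L²; t=0 is excluded (the solution is then the fixed data); and the failure of strong convergence is claimed only for (ζ₀,𝔓ψ₀)≠(0,0). *)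

(* Defs.v *)
From HB Require Import structures.
From mathcomp Require Import all_boot all_order all_algebra.
From mathcomp Require Import all_classical all_reals all_analysis.
From mathcomp Require Import complex.

Set Implicit Arguments.
Unset Strict Implicit.
Unset Printing Implicit Defensive.

Import Order.TTheory GRing.Theory Num.Theory.
Import numFieldNormedType.Exports.

Local Open Scope classical_set_scope.
Local Open Scope ring_scope.
Local Open Scope complex_scope.

Inductive space_dim := Dim1 | Dim2.

Definition Rd_display (R : realType) (d : space_dim) : measure_display :=
  match d with
  | Dim1 => (R.-ocitv.-measurable).-sigma
  | Dim2 => ((R.-ocitv.-measurable).-sigma, (R.-ocitv.-measurable).-sigma).-prod
  end%mdisp.

(* R^1 is R itself and R^2 is R * R, with their Borel sigma-algebras. *)
Definition Rd (R : realType) (d : space_dim) : measurableType (Rd_display R d) :=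
  match d with
  | Dim1 => measurableTypeR R
  | Dim2 => (measurableTypeR R * measurableTypeR R)%type
  end.

Definition leb (R : realType) (d : space_dim) : {measure set (Rd R d) -> \bar R} :=
  match d with
  | Dim1 => @lebesgue_measure R
  | Dim2 => (@lebesgue_measure R \x @lebesgue_measure R)%E
  end.
Arguments leb {R d}.

Definition dotp (R : realType) (d : space_dim) : Rd R d -> Rd R d -> R :=
  match d with
  | Dim1 => fun x y => (x : R) * y
  | Dim2 => fun x y => (x.1 : R) * y.1 + (x.2 : R) * y.2
  end.

Definition enorm (R : realType) (d : space_dim) (x : Rd R d) : R :=
  Num.sqrt (dotp x x).

Definition aniso (R : realType) (gamma : R) (d : space_dim) : Rd R d -> Rd R d :=
  match d with
  | Dim1 => fun xi => xi
  | Dim2 => fun xi => (xi.1, gamma * xi.2)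
  end.

(* Class C^n on a normed space, through iterated directional derivatives. *)
Fixpoint Cn (R : realType) (V : normedModType R) (n : nat) (f : V -> R) : Prop :=
  match n with
  | 0 => continuous f
  | n'.+1 => continuous f /\
      forall v : V, (forall x, derivable f x v) /\ Cn n' (fun x => 'D_v f x)
  end.

Definition Cc_infty (R : realType) (V : normedModType R) (f : V -> R) : Prop :=
  (forall n, Cn n f) /\ compact (closure [set x | f x != 0]).

Definition real_test (R : realType) (d : space_dim) : (Rd R d -> R) -> Prop :=
  match d with
  | Dim1 => fun f => @Cc_infty R R f
  | Dim2 => fun f => @Cc_infty R (R * R)%type f
  end.

Definition test_fun (R : realType) (d : space_dim) (a : Rd R d -> R[i]) : Prop :=
  real_test (fun x => complex.Re (a x)) /\ real_test (fun x => complex.Im (a x)).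

Section ComplexIntegral.
Context {R : realType} {d : space_dim}.

Definition Cintegrable (F : Rd R d -> R[i]) : Prop :=
  leb.-integrable setT (fun x => (complex.Re (F x))%:E) /\
  leb.-integrable setT (fun x => (complex.Im (F x))%:E).

Definition Cintegral (F : Rd R d -> R[i]) : R[i] :=
  (\int[leb]_x complex.Re (F x)) +i* (\int[leb]_x complex.Im (F x)).

End ComplexIntegral.

Section Fourier.
Context {R : realType} {d : space_dim}.
Implicit Types (u g : Rd R d -> R) (a U : Rd R d -> R[i]) (m : Rd R d -> R).

Definition expi (r : R) : R[i] := cos r +i* sin r.

Definition fourier a (x : Rd R d) : R[i] :=
  Cintegral (fun xi => expi (- dotp x xi) * a xi).

(* Locally integrable functions of at most polynomial growth, in the mean:
   they act as tempered distributions by integration. *)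
Definition tempered u : Prop :=
  measurable_fun setT u /\
  exists N : nat,
    leb.-integrable setT (fun x => (u x / (1 + enorm x) ^+ N)%:E).

(* The Fourier transform of a tempered distribution T is defined by
   transposition, <T^, a> = <T, a^>; since C_c^infty is dense in the Schwartz
   space, it is enough to test against a in C_c^infty. *)
Definition pairing_hat u a : R[i] := Cintegral (fun x => (u x)%:C * fourier a x).

Definition pairing_hat_def u a : Prop :=
  Cintegrable (fun x => (u x)%:C * fourier a x).

Definition is_fourier u U : Prop :=
  forall a, test_fun a ->
    [/\ pairing_hat_def u a, Cintegrable (fun xi => U xi * a xi) &
        pairing_hat u a = Cintegral (fun xi => U xi * a xi)].

Definition fhat u : Rd R d -> R[i] :=
  xget (fun _ => 0) [set U | is_fourier u U].

(* g = m(D) u, i.e. g^ = m u^, again by transposition: <g^, a> = <u^, m a>.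
   The requirement that u (m a)^ be integrable matters for symbols that are
   not smooth at the origin, for which (m a)^ has only polynomial decay. *)
Definition is_fmult m u g : Prop :=
  forall a, test_fun a ->
    let ma := fun xi => (m xi)%:C * a xi in
    [/\ pairing_hat_def u ma, pairing_hat_def g a &
        pairing_hat u ma = pairing_hat g a].

(* m(D) u as an element of L^2; g is unique up to a null set. *)
Definition fmult_def m u : Prop :=
  exists2 g, g \in Lfun leb 2%:E & is_fmult m u g.

Definition fmult m u : Rd R d -> R :=
  xget (fun _ => 0) [set g | g \in Lfun leb 2%:E /\ is_fmult m u g].

End Fourier.

Section Sobolev.
Context {R : realType} {d : space_dim}.
Implicit Types (s : R) (f : Rd R d -> R) (u du : R -> Rd R d -> R).

Definition L2norm f : \bar R := 'N[leb]_2%:E[EFin \o f]%E.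

Definition Hs_norm s f : \bar R :=
  L2norm (fun xi => (1 + enorm xi ^+ 2) `^ (s / 2) * Normc.normc (fhat f xi)).

(* f in H^s(R^d), for s >= 0 only: elements of H^s are then L^2 functions. *)
Definition in_Hs s f : Prop :=
  [/\ f \in Lfun leb 2%:E, (exists U, is_fourier f U) & (Hs_norm s f < +oo)%E].

Definition cont_Hs s u : Prop :=
  forall t, in_Hs s (u t) /\
    Hs_norm s (fun x => u r x - u t x) @[r --> t] --> 0%E.

Definition C1_Hs s u du : Prop :=
  [/\ cont_Hs s u, cont_Hs s du &
      forall t, Hs_norm s (fun x => (u (t + h) x - u t x) / h - du t x)
                  @[h --> 0^'] --> 0%E].

End Sobolev.

Section WaterWaves.
Context {R : realType} {d : space_dim}.

Definition tanh (r : R) : R := (expR r - expR (- r)) / (expR r + expR (- r)).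

Definition frakP_symbol (mu gamma : R) (xi : Rd R d) : R :=
  enorm (aniso gamma xi)
    / Num.sqrt (1 + Num.sqrt mu * enorm (aniso gamma xi)).

Definition G0_symbol (mu gamma : R) (xi : Rd R d) : R :=
  Num.sqrt mu * enorm (aniso gamma xi)
    * tanh (Num.sqrt mu * enorm (aniso gamma xi)).

Definition frakP (mu gamma : R) : (Rd R d -> R) -> (Rd R d -> R) :=
  fmult (frakP_symbol mu gamma).

Definition G0 (mu gamma : R) : (Rd R d -> R) -> (Rd R d -> R) :=
  fmult (G0_symbol mu gamma).

Definition admissible_data (mu gamma s : R) (zeta0 psi0 : Rd R d -> R) : Prop :=
  [/\ in_Hs s zeta0, tempered psi0, fmult_def (frakP_symbol mu gamma) psi0 &
      in_Hs s (frakP mu gamma psi0)].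

Record is_solution (mu gamma eps s : R) (zeta0 psi0 : Rd R d -> R)
    (zeta psi : R -> Rd R d -> R) : Prop := IsSolution {
  sol_tempered : forall t, tempered (psi t);
  sol_frakP_def : forall t, fmult_def (frakP_symbol mu gamma) (psi t);
  sol_zeta_cont : cont_Hs s zeta;
  sol_frakP_cont : cont_Hs s (fun t => frakP mu gamma (psi t));
  sol_frakP_C1 : exists dP, C1_Hs (s - 1) (fun t => frakP mu gamma (psi t)) dP;
  sol_zeta_eq : exists2 dzeta, C1_Hs (s - 1) zeta dzeta &
    forall t, fmult_def (G0_symbol mu gamma) (psi t) /\
      {ae leb, forall x, eps * dzeta t x - mu^-1 * G0 mu gamma (psi t) x = 0};
  (* The equation eps d_t psi + zeta = 0 in the sense of tempered
     distributions; the imaginary part is obtained by replacing a by - 'i a. *)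
  sol_psi_eq : forall a, test_fun a -> forall t : R,
    let p := fun r : R => complex.Re (pairing_hat (psi r) a) in
    derivable p t 1 /\
    eps * derive1 p t + complex.Re (pairing_hat (zeta t) a) = 0;
  sol_zeta_init : {ae leb, forall x, zeta 0 x = zeta0 x};
  sol_psi_init : {ae leb, forall x, psi 0 x = psi0 x}
}.

Definition weakly_to_zero (u : R -> Rd R d -> R) : Prop :=
  forall phi : Rd R d -> R, phi \in Lfun leb 2%:E ->
    (\int[leb]_x (u eps x * phi x)) @[eps --> 0^'+] --> (0 : R).

Definition strongly_to (u : R -> Rd R d -> R) (f : Rd R d -> R) : Prop :=
  L2norm (fun x => u eps x - f x) @[eps --> 0^'+] --> 0%E.

End WaterWaves.

(* Main.v *)
Require Import Defs.
From HB Require Import structures.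
From mathcomp Require Import all_boot all_order all_algebra.
From mathcomp Require Import all_classical all_reals all_analysis.
From mathcomp Require Import measurable_realfun complex.
From mathcomp Require Import ring lra.
Set Implicit Arguments.
Unset Strict Implicit.
Unset Printing Implicit Defensive.
Import Order.TTheory GRing.Theory Num.Theory.
Import numFieldNormedType.Exports.
Local Open Scope classical_set_scope.
Local Open Scope ring_scope.

(** Write [q xi] for the square of the length of [xi^gamma], [P] and [G] for the
   symbols of [frakP] and [G0], [om] for the pulsation [sqrt (G / mu)], and [W] for
   [frakP psi]. In Fourier variables the system reads
   [eps * zeta' = (om ^ 2 / P) * W] and [eps * W' = - P * zeta]: a rotation of angle
   [(t / eps) * om (q xi)], with coefficients [om / P] and [P / om] that lie between
   positive constants. At a time [t != 0] the angle is large when [eps] is small, and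
   [om] increases with [q]; by the Riemann-Lebesgue lemma the solution, which is bounded
   in [L2], tends weakly to zero. A strong limit would then be zero as well; but the
   rotation is inverted with bounds that do not depend on [eps], so that the common
   initial data, obtained by going back from time [t] to time [0], would vanish.

   The proof is dual: the equations hold in a weak sense, and the test functions are
   moved instead of the solution. The pairing of the solution with the solution of the
   adjoint system is constant ([adjoint_flow], which rests on the product rule
   [pair_derive]); the adjoint solution is explicit, of norm comparable to that of its
   final value ([backward_bound]), and oscillates ([pair_osc_small], a consequence of
   [riemann_lebesgue]).

   Everything is done with real functions, by means of the Hartley transform, of kernel
   [cas r = cos r + sin r]. If [U] is the Fourier transform of a real function [u],
   testing with the complex function [(1 + i) b] and taking real parts shows that
   the integral of [u * hartley b] is that of [(Re U - Im U) * b] ([fourier_hartley]). The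
   tests [b] are smooth with compact support away from the hyperplane where the first
   coordinate of [xi] vanishes: the symbols are smooth there and the phase is not
   stationary, while such functions are still dense in [L2] ([dense_away]). By the
   Plancherel formula ([plancherel], proved with the Poisson kernel) their transforms
   are dense too ([hartley_dense]), so that norms and weak limits can be computed
   against them ([nrm_dual], [weakly_to_zeroP]). *)

(** * Square-integrable functions *)

Section L2.
Context {d} {X : measurableType d} {R : realType} (mu : {measure set X -> \bar R}).
Implicit Types f g h : X -> R.

Definition integr f := mu.-integrable setT (EFin \o f).

Definition L2 f := measurable_fun setT f /\ integr (fun x => f x ^+ 2).

Definition ip f g : R := \int[mu]_x (f x * g x).

Definition nrm f : R := Num.sqrt (ip f f).

Lemma integrD f g : integr f -> integr g -> integr (fun x => f x + g x).
Proof.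
move=> If Ig; rewrite /integr (_ : _ \o _ = (EFin \o f) \+ (EFin \o g))%E //.
exact: integrableD.
Qed.

Lemma integrZ (k : R) f : integr f -> integr (fun x => k * f x).
Proof.
move=> If; rewrite /integr (_ : _ \o _ = (fun x => k%:E * (EFin \o f) x))%E //.
exact: integrableZl.
Qed.

Lemma integrN f : integr f -> integr (fun x => - f x).
Proof.
move=> If; rewrite (_ : (fun x => _) = (fun x => -1 * f x)); first exact: integrZ.
by apply/funext => x; rewrite mulN1r.
Qed.

Lemma integrB f g : integr f -> integr g -> integr (fun x => f x - g x).
Proof. by move=> If /integrN; exact: integrD. Qed.

Lemma integr_meas f : integr f -> measurable_fun setT f.
Proof. by move/integrableP => [/measurable_EFinP]. Qed.

Lemma integr_le f g : measurable_fun setT f -> integr g ->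
  (forall x, `|f x| <= `|g x|) -> integr f.
Proof.
move=> mf Ig fg; apply: (le_integrable measurableT _ _ Ig) => //.
  exact/measurable_EFinP.
by move=> x _ /=; rewrite lee_fin.
Qed.

Lemma integr_bound f g (M : R) : integr f -> measurable_fun setT g ->
  (forall x, `|g x| <= M) -> integr (fun x => f x * g x).
Proof.
move=> If mg gM; have := integrZ M If => /integr_le; apply.
  by apply: measurable_funM => //; exact: integr_meas.
move=> x; rewrite !normrM mulrC ler_wpM2r//; apply: (le_trans (gM x)).
exact: ler_norm.
Qed.

Lemma intD f g : integr f -> integr g ->
  \int[mu]_x (f x + g x) = \int[mu]_x f x + \int[mu]_x g x.
Proof. by move=> If Ig; rewrite RintegralD. Qed.

Lemma intB f g : integr f -> integr g ->
  \int[mu]_x (f x - g x) = \int[mu]_x f x - \int[mu]_x g x.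
Proof. by move=> If Ig; rewrite RintegralB. Qed.

Lemma intZ (k : R) f : integr f -> \int[mu]_x (k * f x) = k * \int[mu]_x f x.
Proof. by move=> If; rewrite RintegralZl. Qed.

Lemma int_le f g : integr f -> integr g -> (forall x, f x <= g x) ->
  \int[mu]_x f x <= \int[mu]_x g x.
Proof. by move=> If Ig fg; apply: le_Rintegral. Qed.

Lemma int_EFin f : integr f -> ((\int[mu]_x f x)%:E = \int[mu]_x (f x)%:E)%E.
Proof. by move=> If; rewrite /Rintegral fineK//; exact: integrable_fin_num. Qed.

Lemma L2M f g : L2 f -> L2 g -> integr (fun x => f x * g x).
Proof.
move=> [mf If] [mg Ig]; have := integrD If Ig => /integr_le; apply.
  exact: measurable_funM.
move=> x; rewrite [leRHS]ger0_norm ?addr_ge0 ?sqr_ge0//.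
rewrite normrM -[f x ^+ 2]real_normK ?num_real// -[g x ^+ 2]real_normK ?num_real//.
have := sqr_ge0 (`|f x| - `|g x|).
have := sqr_ge0 (`|f x|); have := sqr_ge0 (`|g x|); nra.
Qed.

Lemma L2D f g : L2 f -> L2 g -> L2 (fun x => f x + g x).
Proof.
move=> Lf Lg; split; first by apply: measurable_funD; [case: Lf|case: Lg].
rewrite (_ : (fun x => _) = fun x => f x ^+ 2 + (2 * (f x * g x) + g x ^+ 2)).
  by apply: integrD; [case: Lf|apply: integrD; [apply/integrZ/L2M|case: Lg]].
by apply/funext => x; ring.
Qed.

Lemma L2Z (k : R) f : L2 f -> L2 (fun x => k * f x).
Proof.
move=> [mf If]; split; first exact: measurable_funM.
rewrite (_ : (fun x => _) = fun x => k ^+ 2 * f x ^+ 2); first exact: integrZ.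
by apply/funext => x; rewrite exprMn.
Qed.

Lemma L2N f : L2 f -> L2 (fun x => - f x).
Proof.
by move=> /(L2Z (-1)); congr L2; apply/funext => x; rewrite mulN1r.
Qed.

Lemma L2B f g : L2 f -> L2 g -> L2 (fun x => f x - g x).
Proof. by move=> Lf /L2N; exact: L2D. Qed.

Lemma L20 : L2 (fun=> 0).
Proof.
split; first exact: measurable_cst.
rewrite /integr (_ : _ \o _ = cst 0%E); first exact: integrable0.
by apply/funext => x /=; rewrite expr0n.
Qed.

Lemma L2_le f g : measurable_fun setT f -> L2 g ->
  (forall x, `|f x| <= `|g x|) -> L2 f.
Proof.
move=> mf [mg Ig] fg; split => //; apply: (integr_le _ Ig).
  exact: measurable_funX.
by move=> x; rewrite !normrX lerXn2r// nnegrE.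
Qed.

Lemma ipC f g : ip f g = ip g f.
Proof. by apply: eq_Rintegral => x _; rewrite mulrC. Qed.

Lemma ipDl f g h : L2 f -> L2 g -> L2 h ->
  ip (fun x => f x + g x) h = ip f h + ip g h.
Proof.
move=> Lf Lg Lh; rewrite /ip -intD; [|exact: L2M..].
by apply: eq_Rintegral => x _; rewrite mulrDl.
Qed.

Lemma ipZl (k : R) f g : L2 f -> L2 g -> ip (fun x => k * f x) g = k * ip f g.
Proof.
move=> Lf Lg; rewrite /ip -intZ; [|exact: L2M].
by apply: eq_Rintegral => x _; rewrite mulrA.
Qed.

Lemma ipBl f g h : L2 f -> L2 g -> L2 h ->
  ip (fun x => f x - g x) h = ip f h - ip g h.
Proof.
move=> Lf Lg Lh; rewrite /ip -intB; [|exact: L2M..].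
by apply: eq_Rintegral => x _; rewrite mulrBl.
Qed.

Lemma ipDr f g h : L2 f -> L2 g -> L2 h ->
  ip h (fun x => f x + g x) = ip h f + ip h g.
Proof. by move=> *; rewrite ipC ipDl// ipC [ip g h]ipC. Qed.

Lemma ipBr f g h : L2 f -> L2 g -> L2 h ->
  ip h (fun x => f x - g x) = ip h f - ip h g.
Proof. by move=> *; rewrite ipC ipBl// ipC [ip g h]ipC. Qed.

Lemma ipZr (k : R) f g : L2 f -> L2 g -> ip f (fun x => k * g x) = k * ip f g.
Proof. by move=> *; rewrite ipC ipZl// ipC. Qed.

Lemma ipBB f g : L2 f -> L2 g ->
  ip (fun x => f x - g x) (fun x => f x - g x) = ip f f - 2 * ip f g + ip g g.
Proof.
move=> Lf Lg; have Lfg := L2B Lf Lg.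
by rewrite ipBl// !ipBr// [ip g f]ipC; ring.
Qed.

Lemma ipff_ge0 f : 0 <= ip f f.
Proof. by apply: Rintegral_ge0 => x _; rewrite -expr2 sqr_ge0. Qed.

Lemma nrm_ge0 f : 0 <= nrm f. Proof. exact: sqrtr_ge0. Qed.

Lemma nrm2 f : nrm f ^+ 2 = ip f f.
Proof. by rewrite sqr_sqrtr// ipff_ge0. Qed.

Lemma CauchySchwarz f g : L2 f -> L2 g -> `|ip f g| <= nrm f * nrm g.
Proof.
move=> Lf Lg.
have Q (k : R) : 0 <= ip f f + 2 * k * ip f g + k ^+ 2 * ip g g.
  have := ipff_ge0 (fun x => f x + k * g x).
  have Lkg := L2Z k Lg; have Lfg := L2D Lf Lkg.
  rewrite ipDl// !ipDr// !ipZl// !ipZr// [ip g f]ipC.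
  by congr (_ <= _); ring.
rewrite -(@ler_pXn2r _ 2)// ?nnegrE ?mulr_ge0 ?nrm_ge0//.
rewrite real_normK ?num_real// exprMn !nrm2.
have [g0|g0] := eqVneq (ip g g) 0.
  rewrite g0 mulr0; have [->|fg0] := eqVneq (ip f g) 0; first by rewrite expr0n.
  have := Q (- (ip f f + 1) / (2 * ip f g)); rewrite g0 mulr0 addr0.
  rewrite (_ : _ + _ = -1); first lra.
  by field.
have g1 : 0 < ip g g by rewrite lt0r g0 ipff_ge0.
have := Q (- ip f g / ip g g).
rewrite (_ : _ + _ = (ip f f * ip g g - ip f g ^+ 2) / ip g g); last by field.
by rewrite pmulr_lge0 ?invr_gt0// subr_ge0.
Qed.

Lemma nrmD f g : L2 f -> L2 g -> nrm (fun x => f x + g x) <= nrm f + nrm g.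
Proof.
move=> Lf Lg; rewrite -(@ler_pXn2r _ 2)// ?nnegrE ?addr_ge0 ?nrm_ge0//.
rewrite nrm2 ipDl ?ipDr//; last exact: L2D.
rewrite sqrrD !nrm2 [ip g f]ipC.
have := CauchySchwarz Lf Lg; rewrite ler_norml => /andP[_]; lra.
Qed.

Lemma nrmZ (k : R) f : L2 f -> nrm (fun x => k * f x) = `|k| * nrm f.
Proof.
move=> Lf; rewrite /nrm ipZl ?ipZr//; last exact: L2Z.
by rewrite mulrA -expr2 sqrtrM ?sqr_ge0// sqrtr_sqr.
Qed.

Lemma nrmB f g : L2 f -> L2 g -> nrm (fun x => f x - g x) <= nrm f + nrm g.
Proof.
move=> Lf Lg; apply: (le_trans (nrmD Lf (L2N Lg))).
rewrite lerD2l (_ : (fun x => _) = (fun x => -1 * g x)).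
  by rewrite nrmZ// normrN1 mul1r.
by apply/funext => x; rewrite mulN1r.
Qed.

Lemma nrm_le f g : measurable_fun setT f -> L2 g ->
  (forall x, `|f x| <= `|g x|) -> nrm f <= nrm g.
Proof.
move=> mf Lg fg; have Lf := L2_le mf Lg fg.
rewrite ler_wsqrtr// int_le//; [exact: L2M..|] => x.
by rewrite -!expr2 -[f x ^+ 2]real_normK ?num_real//
  -[g x ^+ 2]real_normK ?num_real// lerXn2r// nnegrE.
Qed.

Lemma L2_Lfun f : L2 f <-> f \in Lfun mu 2%:E.
Proof.
split=> [[mf If]|Lf]; last first.
  split; last exact: Lfun2_integrable_sqr.
  by move: Lf; rewrite inE => /andP[/[!inE]].
rewrite inE; apply/andP; split; rewrite inE//=.
rewrite /finite_norm unlock /=; apply: poweR_lty.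
rewrite (_ : (fun _ => _) = fun x => (f x ^+ 2)%:E).
  exact: integrable_lty.
by apply/funext => x; rewrite /= powR_mulrn// real_normK ?num_real.
Qed.

Lemma Lnorm_nrm f : L2 f -> 'N[mu]_2%:E[EFin \o f]%E = (nrm f)%:E.
Proof.
move=> Lf; rewrite unlock /=.
rewrite (_ : (fun _ => _) = fun x => (f x * f x)%:E); last first.
  by apply/funext => x; rewrite /= powR_mulrn// real_normK ?num_real// expr2.
by rewrite -int_EFin ?poweR_EFin ?powR12_sqrt ?ipff_ge0//; exact: L2M.
Qed.

Lemma ip_ae0 f : L2 f -> ip f f = 0 -> {ae mu, forall x, f x = 0}.
Proof.
move=> Lf f0.
have mf : measurable_fun setT (fun x => (f x ^+ 2)%:E).
  by apply/measurable_EFinP; apply: measurable_funX; case: Lf.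
have f1 : (\int[mu]_x `|(f x ^+ 2)%:E| = 0)%E.
  under eq_integral do rewrite gee0_abs ?lee_fin ?sqr_ge0//.
  by rewrite -int_EFin; [congr EFin; rewrite -f0|case: Lf].
have := (ae_eq_integral_abs mu measurableT mf).1 f1.
apply: filterS => x /(_ I) /=; case => /eqP; rewrite sqrf_eq0.
exact: eqP.
Qed.

Lemma ip_ae_eq f g h :
  measurable_fun setT (fun x => f x * h x) -> measurable_fun setT (fun x => g x * h x) ->
  {ae mu, forall x, f x = g x} -> ip f h = ip g h.
Proof.
move=> mf mg fg; rewrite /ip /Rintegral; congr fine.
apply: ae_eq_integral => //; try exact/measurable_EFinP.
by apply: filterS fg => x -> _.
Qed.

End L2.
Arguments integr {d X R}.
Arguments L2 {d X R}.
Arguments ip {d X R}.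
Arguments nrm {d X R}.

(** * Smooth functions *)

Section DirectionalDerivatives.
Context {R : realType} {V : normedModType R}.
Implicit Types (f g a q : V -> R) (x v : V) (F : R -> R).

Lemma isD_ext f g x v df dg : (forall y, f y = g y) -> df = dg ->
  is_derive x v f df -> is_derive x v g dg.
Proof. by move=> /funext -> ->. Qed.

Lemma isDD f g x v df dg : is_derive x v f df -> is_derive x v g dg ->
  is_derive x v (fun y => f y + g y) (df + dg).
Proof. move=> hf hg; exact (is_deriveD hf hg). Qed.

Lemma isDM f g x v df dg : is_derive x v f df -> is_derive x v g dg ->
  is_derive x v (fun y => f y * g y) (f x * dg + g x * df).
Proof. move=> hf hg; exact (is_deriveM hf hg). Qed.

(** Directional derivatives are derivatives along a line: the chain rule for [is_derive]
   is taken from the one-variable case in this way. *)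
Lemma isDline f x v df :
  is_derive x v f df <-> is_derive (0 : R) 1 (fun h : R => f (h *: v + x)) df.
Proof.
have e : 'D_v f x = 'D_1 (fun h : R => f (h *: v + x)) 0.
  rewrite /derive; set u := (fun h => _ *: (_ - f x)); set w := (fun h => _).
  suff -> : u = w by [].
  by apply/funext => h; rewrite /u /w /= addr0 scale0r add0r [_%:A]mulr1.
split=> -[D1 D2].
  by split; [exact/(derivable1P f x v).1|rewrite -e].
by split; [exact/(derivable1P f x v).2|rewrite e].
Qed.

Lemma isD_comp F q x v dF dq : is_derive x v q dq -> is_derive (q x) 1 F dF ->
  is_derive x v (fun y => F (q y)) (dF * dq).
Proof.
move=> /isDline hq hF; apply/isDline.
apply: (@is_derive1_comp R F (fun h : R => q (h *: v + x))).
by rewrite scale0r add0r.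
Qed.

Lemma isD_near f g x v df : (\forall y \near x, f y = g y) ->
  is_derive x v f df -> is_derive x v g df.
Proof. exact: near_eq_is_derive. Qed.

Lemma isD_cst (c : R) x v : is_derive x v (fun=> c) 0.
Proof. exact: is_derive_cst. Qed.

Lemma Cn_cont n f : Cn n f -> continuous f.
Proof. by case: n => [//|n []]. Qed.

Lemma Cn_S n f : Cn n.+1 f -> Cn n f.
Proof.
elim: n f => [f []//|n IH f /= [cf H]]; split => // v.
by have [df /IH] := H v.
Qed.

(** [Cn] speaks of the operator ['D_v f]; it is easier to exhibit the derivatives. *)
Lemma Cn_intro n f (df : V -> V -> R) : continuous f ->
  (forall v x, is_derive x v f (df v x)) -> (forall v, Cn n (df v)) -> Cn n.+1 f.
Proof.
move=> cf Df Cf; split => // v; split; first by move=> x; have [] := Df v x.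
by rewrite (_ : (fun x => _) = df v)//; apply/funext => x; have [] := Df v x.
Qed.

Lemma Cn_cst (c : R) n : Cn n (fun _ : V => c).
Proof.
elim: n c => [c|n IH c]; first exact: cst_continuous.
apply: (@Cn_intro _ _ (fun _ _ => 0)) => //; first exact: cst_continuous.
Qed.

Lemma CnD n f g : Cn n f -> Cn n g -> Cn n (fun x => f x + g x).
Proof.
elim: n f g => [|n IH] f g; first by move=> cf cg x; apply: cvgD; [exact: cf|exact: cg].
move=> [cf Hf] [cg Hg].
apply: (@Cn_intro _ _ (fun v x => 'D_v f x + 'D_v g x)).
- by move=> x; apply: cvgD; [exact: cf|exact: cg].
- by move=> v x; apply: isDD; apply/derivableP; [exact: (Hf v).1|exact: (Hg v).1].
- by move=> v; apply: IH; [exact: (Hf v).2|exact: (Hg v).2].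
Qed.

Lemma CnM n f g : Cn n f -> Cn n g -> Cn n (fun x => f x * g x).
Proof.
elim: n f g => [|n IH] f g; first by move=> cf cg x; apply: cvgM; [exact: cf|exact: cg].
move=> Cf Cg; have [cf Hf] := Cf; have [cg Hg] := Cg.
apply: (@Cn_intro _ _ (fun v x => f x * 'D_v g x + g x * 'D_v f x)).
- by move=> x; apply: cvgM; [exact: cf|exact: cg].
- by move=> v x; apply: isDM; apply/derivableP; [exact: (Hf v).1|exact: (Hg v).1].
- by move=> v; apply: CnD; apply: IH;
    [exact: Cn_S|exact: (Hg v).2|exact: Cn_S|exact: (Hf v).2].
Qed.

(** Smoothness of a function of one variable on a part of the line only, by
   means of some sequence of functions that are its derivatives there: what it
   does elsewhere is arbitrary, and [/] or [Num.sqrt] are not smooth at [0]. *)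
Fixpoint Sn (O : set R) (n : nat) F : Prop :=
  match n with
  | 0 => forall y, O y -> {for y, continuous F}
  | n'.+1 => exists F', (forall y, O y -> is_derive y 1 F (F' y)) /\ Sn O n' F'
  end.

Definition supp f := closure [set x | f x != 0].

Lemma supp_far f x : ~ supp f x -> \forall y \near x, f y = 0.
Proof.
move=> nx; have oc : open (~` supp f) by apply: closed_openC; exact: closed_closure.
have /= := open_nbhs_nbhs (conj oc nx); apply: filterS => y ny.
by apply: contrapT => /eqP fy; apply: ny; exact: subset_closure.
Qed.

Lemma supp_near0 f x : (\forall y \near x, f y = 0) -> ~ supp f x.
Proof. by move=> H Sx; have [y [/= /eqP fy0 fy]] := Sx _ H. Qed.

Lemma supp_sub f g : (forall x, (\forall y \near x, g y = 0) -> \forall y \near x, f y = 0) ->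
  supp f `<=` supp g.
Proof.
by move=> H x Sx; apply: contrapT => /supp_far /H /supp_near0; apply.
Qed.

Lemma Sn_cont (O : set R) n F : Sn O n F -> forall y, O y -> {for y, continuous F}.
Proof.
case: n => [//|n [F' [DF _]] y Oy].
by apply/differentiable_continuous/derivable1_diffP; have [] := DF y Oy.
Qed.

Lemma Sn_S (O : set R) n F : Sn O n.+1 F -> Sn O n F.
Proof.
elim: n F => [F|n IH F [F' [DF SF]]]; first exact: Sn_cont.
by exists F'; split => //; exact: IH.
Qed.

(** Leibniz rule when [F] is only known on [O]: off the support of [a] the product
   vanishes in a neighbourhood. *)
Lemma isD_mult (O : set R) F F' a q x v dq da :
  (forall y, O y -> is_derive y 1 F (F' y)) -> supp a `<=` q @^-1` O ->
  is_derive x v q dq -> is_derive x v a da ->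
  is_derive x v (fun x => F (q x) * a x) (F' (q x) * (dq * a x) + F (q x) * da).
Proof.
move=> DF sa dq' da'; have [Sx|nSx] := pselect (supp a x).
  have := isDM (isD_comp dq' (DF _ (sa _ Sx))) da'.
  by apply: isD_ext => //; ring.
have ax0 := supp_far nSx.
have e : \forall y \near x, (fun=> 0) y = F (q y) * a y.
  by apply: filterS ax0 => y ->; rewrite mulr0.
have D0 : da = 0.
  by have [_ <-] := da'; rewrite (near_eq_derive v ax0); exact: derive_cst.
rewrite D0 (nbhs_singleton ax0) !mulr0 addr0.
by apply: isD_near e _; exact: isD_cst.
Qed.

Lemma supp_derive f v : supp ('D_v f) `<=` supp f.
Proof.
apply: supp_sub => x /near_join; apply: filterS => y /= fy.
by rewrite (near_eq_derive v fy); exact: derive_cst.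
Qed.

(** In the derivative of [(F \o q) * a], namely
   [(F' \o q) * (q' * a) + (F \o q) * a'], both terms are of the same form, and
   the values of [F] away from [O] are multiplied by zero. *)
Lemma Cn_comp (O : set R) n F a q : Sn O n F -> Cn n a -> Cn n q ->
  supp a `<=` q @^-1` O -> Cn n (fun x => F (q x) * a x).
Proof.
have C0 m G b : Sn O m G -> Cn m b -> Cn m q -> supp b `<=` q @^-1` O ->
    continuous (fun x => G (q x) * b x).
  move=> SG /Cn_cont cb /Cn_cont cq sb x.
  have [Sx|nSx] := pselect (supp b x).
    apply: cvgM; last exact: cb.
    by apply: continuous_comp; [exact: cq|apply: Sn_cont SG _ (sb _ Sx)].
  have bx0 := supp_far nSx; have e : \forall y \near x, (fun=> 0) y = G (q y) * b y.
    by apply: filterS bx0 => y ->; rewrite mulr0.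
  rewrite /continuous_at (nbhs_singleton bx0) mulr0.
  by apply: cvg_trans (near_eq_cvg e) _; exact: cvg_cst.
elim: n F a => [|n IH] F a SF Ca Cq sa; first exact: (C0 0).
have [F' [DF SF']] := SF; have [_ Ha] := Ca; have [_ Hq] := Cq.
apply: (@Cn_intro _ _ (fun v x => F' (q x) * ('D_v q x * a x) + F (q x) * 'D_v a x)).
- exact: (C0 n.+1).
- move=> v x; apply: (isD_mult DF sa); apply/derivableP; [exact: (Hq v).1|exact: (Ha v).1].
- move=> v; apply: CnD; apply: IH => //.
  + by apply: CnM; [exact: (Hq v).2|exact: Cn_S].
  + exact: Cn_S.
  + apply: subset_trans sa; apply: supp_sub => x; apply: filterS => y ->.
    by rewrite mulr0.
  + exact: Sn_S.
  + exact: (Ha v).2.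
  + exact: Cn_S.
  + by apply: subset_trans sa; exact: supp_derive.
Qed.

Lemma Cn_comp0 n F q : Sn setT n F -> Cn n q -> Cn n (fun x => F (q x)).
Proof.
move=> SF Cq; have := @Cn_comp setT n F (fun=> 1) q SF (Cn_cst 1 n) Cq.
rewrite (_ : (fun x => F (q x) * 1) = (fun x => F (q x))); first exact.
by apply/funext => x; rewrite mulr1.
Qed.

End DirectionalDerivatives.

Section OneVariable.
Context {R : realType}.
Implicit Types (F G : R -> R) (O : set R).

Lemma Sn_cst O n (c : R) : Sn O n (fun=> c).
Proof.
elim: n c => [c y _|n IH c]; first exact: cst_continuous.
by exists (fun=> 0); split => // y _; exact: is_derive_cst.
Qed.

Lemma Sn_id O n : Sn O n (fun x => x).
Proof.
case: n => [y _ //|n]; exists (fun=> 1); split; last exact: Sn_cst.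
by move=> y _; exact: is_derive_id.
Qed.

Lemma SnD O n F G : Sn O n F -> Sn O n G -> Sn O n (fun x => F x + G x).
Proof.
elim: n F G => [|n IH] F G; first by move=> cF cG y Oy; apply: cvgD; [exact: cF|exact: cG].
move=> [F' [DF SF]] [G' [DG SG]]; exists (fun x => F' x + G' x); split; last exact: IH.
by move=> y Oy; apply: isDD; [exact: DF|exact: DG].
Qed.

Lemma SnM O n F G : Sn O n F -> Sn O n G -> Sn O n (fun x => F x * G x).
Proof.
elim: n F G => [|n IH] F G; first by move=> cF cG y Oy; apply: cvgM; [exact: cF|exact: cG].
move=> SF SG; have [F' [DF SF']] := SF; have [G' [DG SG']] := SG.
exists (fun x => F x * G' x + G x * F' x); split.
  by move=> y Oy; apply: isDM; [exact: DF|exact: DG].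
by apply: SnD; apply: IH => //; exact: Sn_S.
Qed.

Lemma Sn_comp O O' n F G : Sn O' n F -> Sn O n G -> (forall x, O x -> O' (G x)) ->
  Sn O n (fun x => F (G x)).
Proof.
elim: n F G => [|n IH] F G.
  move=> cF cG OO y Oy; apply: continuous_comp; first exact: cG.
  by apply: cF; exact: OO.
move=> [F' [DF SF']] SG OO; have [G' [DG SG']] := SG.
exists (fun x => F' (G x) * G' x); split.
  by move=> y Oy; apply: isD_comp; [exact: DG|apply: DF; exact: OO].
by apply: SnM => //; apply: IH => //; exact: Sn_S.
Qed.

Lemma Sn_eq O n F G : open O -> (forall x, O x -> F x = G x) -> Sn O n F -> Sn O n G.
Proof.
move=> oO FG; case: n => [cF y Oy|n [F' [DF SF]]].
  have := cF y Oy; rewrite /prop_for /continuous_at FG//; apply: cvg_trans.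
  apply: near_eq_cvg; have := open_nbhs_nbhs (conj oO Oy).
  by apply: filterS => z; exact: FG.
exists F'; split => // y Oy; apply: isD_near (DF y Oy).
have := open_nbhs_nbhs (conj oO Oy).
by apply: filterS => z; exact: FG.
Qed.

Lemma Sn_derive O n F F' : open O -> Sn O n.+1 F ->
  (forall y, O y -> is_derive y 1 F (F' y)) -> Sn O n F'.
Proof.
move=> oO [F1 [DF SF]] DF'; apply: (Sn_eq oO _ SF) => y Oy.
by have [_ <-] := DF y Oy; have [_ <-] := DF' y Oy.
Qed.

Lemma Sn_expR O n : Sn O n expR.
Proof.
elim: n => [y _|n IH]; first exact: continuous_expR.
by exists expR; split=> // y _; exact: is_derive_expR.
Qed.

Lemma Sn_cos_sin O n : Sn O n cos /\ Sn O n sin.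
Proof.
elim: n => [|n [IHc IHs]]; first by split => y _; [exact: continuous_cos|exact: continuous_sin].
split; last by exists cos; split=> // y _; exact: is_derive_sin.
exists (fun x => -1 * sin x); split; last by apply: SnM => //; exact: Sn_cst.
by move=> y _; rewrite mulN1r; exact: is_derive_cos.
Qed.

Definition Rneq0 : set R := [set x | x != 0].
Definition Rgt0 : set R := [set x | 0 < x].

Lemma open_Rgt0 : open Rgt0.
Proof. exact: open_gt. Qed.

Lemma isD_inv (x : R) : x != 0 -> is_derive x 1 (fun y : R => y^-1) (-1 * (x^-1 * x^-1)).
Proof.
move=> x0; have := is_deriveV x0 (is_derive_id x 1).
by apply: isD_ext => //; rewrite /= mulN1r -invfM expr2 scaleNr [_ *: _]mulr1.
Qed.

Lemma Sn_inv n : Sn Rneq0 n (fun x => x^-1).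
Proof.
elim: n => [y Oy|n IH]; first exact: inv_continuous.
exists (fun x => -1 * (x^-1 * x^-1)); split.
  by move=> y Oy; exact: isD_inv.
by apply: SnM; [exact: Sn_cst|exact: SnM].
Qed.

Lemma Sn_invp n : Sn Rgt0 n (fun x => x^-1).
Proof.
apply: (@Sn_comp Rgt0 Rneq0 n (fun x => x^-1) (fun x => x)); first exact: Sn_inv.
  exact: Sn_id.
by move=> x /= /lt0r_neq0.
Qed.

Lemma Sn_sqrt n : Sn Rgt0 n Num.sqrt.
Proof.
elim: n => [y Oy|n IH]; first exact: sqrt_continuous.
exists (fun x => (2 * Num.sqrt x)^-1); split; first by move=> y Oy; exact: is_derive1_sqrt.
apply: (@Sn_comp _ Rgt0 n (fun x => x^-1)); first exact: Sn_invp.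
  by apply: SnM => //; exact: Sn_cst.
by move=> x Ox /=; rewrite /Rgt0 /= mulr_gt0// sqrtr_gt0.
Qed.

End OneVariable.

Section Ebump.
Context {R : realType}.

(** The derivatives of [exp (- 1 / x)] for [0 < x], extended by zero, are
   combinations of these functions. *)
Definition ebump (k : nat) (x : R) : R :=
  if 0 < x then (x^-1) ^+ k * expR (- x^-1) else 0.

Lemma ebump_ge0 k x : 0 <= ebump k x.
Proof.
by rewrite /ebump; case: ifPn => // x0; rewrite mulr_ge0 ?expR_ge0// exprn_ge0// invr_ge0 ltW.
Qed.

Lemma ebump_le0 k x : x <= 0 -> ebump k x = 0.
Proof. by rewrite /ebump leNgt; case: ifPn. Qed.

Lemma ebump0_le1 x : ebump 0 x <= 1.
Proof.
rewrite /ebump; case: ifPn => // x0.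
by rewrite expr0 mul1r -[leRHS]expR0 ler_expR oppr_le0 invr_ge0 ltW.
Qed.

(** This is [y ^+ k.+2 / (k.+2)! <= expR y] at [y = x^-1]. A quadratic bound gives a
   vanishing derivative at the origin. *)
Lemma ebump_small k x : ebump k x <= (k.+2)`!%:R * x ^+ 2.
Proof.
rewrite /ebump; case: ifPn => [x0|_]; last by rewrite mulr_ge0 ?sqr_ge0.
have y0 : 0 <= x^-1 by rewrite invr_ge0 ltW.
have := expR_ge1Dxn k.+1 y0.
have f0 : 0 < (k.+2)`!%:R :> R by rewrite ltr0n fact_gt0.
rewrite expRN => H.
have : x^-1 ^+ k.+2 / (k.+2)`!%:R <= expR x^-1 by apply: le_trans H; rewrite lerDr.
rewrite ler_pdivrMr// => H2.
rewrite ler_pdivrMr ?expR_gt0//.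
rewrite mulrAC [_ * expR _]mulrC.
apply: (@le_trans _ _ (x^-1 ^+ k.+2 * x ^+ 2)); last by rewrite ler_wpM2r ?sqr_ge0.
by rewrite -addn2 exprD -mulrA -exprMn mulVf ?gt_eqF// expr1n mulr1.
Qed.

Lemma is_derive_ebump k (x : R) :
  is_derive x 1 (ebump k) (- k%:R * ebump k.+1 x + ebump k.+2 x).
Proof.
have [x0|x0|->] := ltgtP x 0.
- rewrite !ebump_le0 ?ltW// mulr0 addr0.
  apply: (@isD_near _ _ (fun=> 0)).
  have : \forall y \near x, y < 0 by apply: open_nbhs_nbhs; split=> //; exact: open_lt.
  by apply: filterS => y y0; rewrite ebump_le0 ?ltW.
- suff : is_derive x 1 (fun y => y^-1 ^+ k * expR (-1 * y^-1))
      (- k%:R * ebump k.+1 x + ebump k.+2 x).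
    apply: isD_near; have : \forall y \near x, 0 < y by apply: open_nbhs_nbhs; split=> //; exact: open_gt.
    by apply: filterS => y y0; rewrite /ebump y0 mulN1r.
  have xn0 : x != 0 by rewrite gt_eqF.
  have dV := isD_inv xn0.
  have dX : is_derive x 1 (fun y => y^-1 ^+ k) ((k%:R * x^-1 ^+ k.-1) *: (-1 * (x^-1 * x^-1))).
    by have := is_deriveX k dV; rewrite exprfctE.
  have dE := isD_comp (isDM (isD_cst (-1) x 1) dV) (is_derive_expR _).
  have := isDM dX dE; apply: isD_ext => //.
  rewrite /ebump x0 mulr0 addr0 !mulN1r [_ *: _]mulrC.
  move: x^-1 (expR _) => y E; case: k {dX} => [|k] /=; first by ring.
  by rewrite !exprS; ring.
- rewrite !ebump_le0// mulr0 addr0.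
  suff H : (fun h : R => h^-1 *: (ebump k (h *: 1 + 0) - ebump k 0)) @ 0^' --> (0 : R).
    by apply: DeriveDef; [apply/cvg_ex; exists 0|exact: cvg_lim].
  have f0 : 0 < (k.+2)`!%:R :> R by rewrite ltr0n fact_gt0.
  apply/cvgr0Pnorm_lt => e e0; have := @dnbhs0_lt R R _ (divr_gt0 e0 f0).
  have := @nbhs_dnbhs_neq R 0; apply: filterS2 => h h0; rewrite ltr_pdivlMr// mulrC.
  apply: le_lt_trans.
  rewrite addr0 (ebump_le0 k (lexx 0)) subr0 [_ *: 1]mulr1 normrZ normfV.
  rewrite ler_pdivrMl ?normr_gt0// (ger0_norm (ebump_ge0 _ _)).
  apply: (le_trans (ebump_small k h)).
  by rewrite -[h ^+ 2]real_normK ?num_real// expr2 mulrCA.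
Qed.

Lemma Sn_ebump n k : Sn setT n (ebump k).
Proof.
elim: n k => [k y _|n IH k].
  by apply/differentiable_continuous/derivable1_diffP; have [] := is_derive_ebump k y.
exists (fun x => - k%:R * ebump k.+1 x + ebump k.+2 x); split.
  by move=> y _; exact: is_derive_ebump.
by apply: SnD => //; apply: SnM => //; exact: Sn_cst.
Qed.

Lemma ebump_cvg (u : nat -> R) : u n @[n --> \oo] --> +oo -> ebump 0 (u n) @[n --> \oo] --> (1 : R).
Proof.
move=> uy; have H : expR (- (u n)^-1) @[n --> \oo] --> (1 : R).
  have hu : - (u n)^-1 @[n --> \oo] --> (0 : R).
    rewrite -oppr0; apply: cvgN; apply/gtr0_cvgV0 => //.
    by move/cvgryPgt : uy; exact.
  by rewrite -[X in _ --> X]expR0; exact: (cvg_comp _ _ hu (@continuous_expR R 0)).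
apply: cvg_trans H; apply: near_eq_cvg; near=> n.
have un0 : 0 < u n by near: n; move/cvgryPgt : uy; exact.
by rewrite /ebump un0 expr0 mul1r.
Unshelve. all: by end_near. Qed.

End Ebump.

Section CompactSupport.
Context {R : realType} {V : normedModType R}.
Implicit Types (f g q : V -> R).

Lemma isD_lin (l : V -> R) x v : (forall (h : R) v x, l (h *: v + x) = h * l v + l x) ->
  is_derive x v l (l v).
Proof.
move=> lin.
apply/isDline; rewrite (_ : (fun h => _) = (fun h : R => h * l v + l x)); last first.
  by apply/funext => h; rewrite lin.
have := isDD (isDM (is_derive_id (0 : R) 1) (@isD_cst R R (l v) 0 1)) (@isD_cst R R (l x) 0 1).
by apply: isD_ext => //; rewrite mulr0 add0r addr0 mulr1.
Qed.

Lemma Cn_lin (l : V -> R) n : (forall (h : R) v x, l (h *: v + x) = h * l v + l x) ->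
  continuous l -> Cn n l.
Proof.
move=> lin cl; case: n => [//|n].
apply: (@Cn_intro _ _ _ _ (fun v _ => l v)) => // [v x|v]; last exact: Cn_cst.
exact: isD_lin.
Qed.

Lemma compact_suppS f g : compact (supp g) -> supp f `<=` supp g -> compact (supp f).
Proof. by move=> cg fg; apply: subclosed_compact cg fg; exact: closed_closure. Qed.

Lemma CcD f g : Cc_infty f -> Cc_infty g -> Cc_infty (fun x => f x + g x).
Proof.
move=> [Cf cf] [Cg cg]; split=> [n|]; first by apply: CnD.
apply: subclosed_compact (compactU cf cg) _; first exact: closed_closure.
rewrite -closureU; apply: closureS => x /= fg; apply: contrapT.
by move/not_orP => -[/negP/negPn/eqP f0 /negP/negPn/eqP g0]; rewrite f0 g0 addr0 eqxx in fg.
Qed.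

Lemma CcM f g : (forall n, Cn n f) -> Cc_infty g -> Cc_infty (fun x => f x * g x).
Proof.
move=> Cf [Cg cg]; split=> [n|]; first by apply: CnM.
apply: (@compact_suppS _ g) => //; apply: supp_sub => x; apply: filterS => y ->.
by rewrite mulr0.
Qed.

Lemma Cc_comp (F : R -> R) q g (c : R) : (forall n, Sn Rgt0 n F) ->
  (forall n, Cn n q) -> Cc_infty g -> 0 < c -> (forall x, g x != 0 -> c <= q x) ->
  Cc_infty (fun x => F (q x) * g x).
Proof.
move=> SF Cq [Cg cg] c0 gc; have cq := Cn_cont (Cq 0).
have sg : supp g `<=` q @^-1` Rgt0.
  move=> x Sx; apply: (lt_le_trans c0).
  have cl : closed [set x | c <= q x].
    by apply: (@preimage_closed _ _ q [set y | c <= y]) => //; exact: closed_ge.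
  exact: (cl _ (closureS gc Sx)).
split=> [n|]; first exact: (Cn_comp (SF n)).
apply: (@compact_suppS _ g) => //; apply: supp_sub => x; apply: filterS => y ->.
by rewrite mulr0.
Qed.

Lemma Cc_derive f v : Cc_infty f -> Cc_infty ('D_v f).
Proof.
move=> [Cf cf]; split=> [n|]; first by have [_ /(_ v)[_]] := Cf n.+1.
exact: compact_suppS cf (@supp_derive _ _ f v).
Qed.

Lemma Cc_bound f : Cc_infty f -> exists2 M, 0 <= M & forall x, `|f x| <= M.
Proof.
move=> [Cf cf]; have cf0 := Cn_cont (Cf 0).
have [E|/set0P E] := eqVneq (supp f) set0.
  exists 0 => // x; rewrite (_ : f x = 0) ?normr0//; apply: contrapT => /eqP fx.
  have : supp f x by exact: subset_closure.
  by rewrite E.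
have [|y _ H] := @compact_EVT_max _ _ (fun x => `|f x|) _ E cf.
  apply: continuous_subspaceT => x; apply: continuous_comp; first exact: cf0.
  exact: norm_continuous.
exists `|f y| => // x; have [->|fx] := eqVneq (f x) 0; first by rewrite normr0.
by apply: H; apply/mem_set; exact: subset_closure.
Qed.

Lemma Cc_box f : Cc_infty f -> exists2 N : R, 0 < N & forall x, f x != 0 -> `|x| <= N.
Proof.
move=> [_ /compact_bounded [N [_ H]]]; exists (`|N| + 1) => [|x fx].
  by rewrite ltr_pwDr.
apply: (H (`|N| + 1)); last exact: subset_closure.
by rewrite ltr_pwDr// ler_norm.
Qed.

End CompactSupport.

Lemma Cn_Sn (R : realType) (p : R -> R) n : Cn n p -> Sn setT n p.
Proof.
elim: n p => [p cp y _|n IH p [cp Hp]]; first exact: cp.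
exists (fun x => 'D_1 p x); split; last exact: IH (Hp 1).2.
by move=> y _; apply/derivableP; exact: (Hp 1).1.
Qed.

Section Plane.
Context {R : realType}.
Implicit Types f : R * R -> R.

Lemma Cn_fst n : Cn n (fun x : R * R => x.1).
Proof.
by apply: Cn_lin => [h v x //|x]; exact: cvg_fst.
Qed.

Lemma Cn_snd n : Cn n (fun x : R * R => x.2).
Proof.
by apply: Cn_lin => [h v x //|x]; exact: cvg_snd.
Qed.

Lemma Cc_tensor (p q : R -> R) : Cc_infty p -> Cc_infty q ->
  Cc_infty (fun x : R * R => p x.1 * q x.2).
Proof.
move=> [Cp cp] [Cq cq]; split=> [n|].
  by apply: CnM; [apply: (@Cn_comp0 R _ n p)|apply: (@Cn_comp0 R _ n q)];
    [exact: Cn_Sn|exact: Cn_fst|exact: Cn_Sn|exact: Cn_snd].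
apply: subclosed_compact (compact_setX cp cq) _; first exact: closed_closure.
have cl : closed (supp p `*` supp q).
  rewrite (_ : _ `*` _ = fst @^-1` supp p `&` snd @^-1` supp q)//.
  apply: closedI; apply: preimage_closed; try exact: closed_closure.
    by move=> y _; exact: cvg_fst.
  by move=> y _; exact: cvg_snd.
move=> x Sx; apply: cl; apply: closureS Sx => y /=.
by rewrite mulf_eq0 => /norP[p0 q0]; split; exact: subset_closure.
Qed.

(** A plane open set is a countable union of open squares with rational
   centres, hence measurable for the product of the Borel tribes. *)
Lemma open_measurable2 (U : set (R * R)) : open U ->
  measurable (U : set (measurableTypeR R * measurableTypeR R)).
Proof.
move=> oU.
pose B (p q : rat) (n : nat) : set (R * R) :=
  ball (ratr p : R) n.+1%:R^-1 `*` ball (ratr q : R) n.+1%:R^-1.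
pose C p q n := if `[< B p q n `<=` U >] then B p q n else set0.
have -> : U = \bigcup_p \bigcup_q \bigcup_n C p q n.
  apply/seteqP; split => [[x y] Uxy|z [p _ [q _ [n _]]]]; last first.
    by rewrite /C; case: asboolP => // BU /BU.
  have [e /= e0 He] := (nbhs_ballP _ _).1 (open_nbhs_nbhs (conj oU Uxy)).
  have [n _ Hn] : \forall n \near \oo, n.+1%:R^-1 < e / 2.
    exact: near_infty_natSinv_lt (PosNum (divr_gt0 e0 (ltr0Sn R 1))).
  have n0 : 0 < n.+1%:R^-1 :> R by rewrite invr_gt0.
  have rat_near (u : R) : exists p : rat, ball u n.+1%:R^-1 (ratr p : R).
    have [z [uz [p _ pz]]] := @dense_rat R (ball u n.+1%:R^-1)
      (ex_intro _ u (ballxx u n0)) (ball_open u _).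
    by exists p; rewrite pz.
  have [p Hp] := rat_near x; have [q Hq] := rat_near y.
  exists p => //; exists q => //; exists n => //; rewrite /C asboolT.
    by split; apply: ball_sym.
  have le2 : n.+1%:R^-1 + n.+1%:R^-1 <= e.
    by have /= := Hn n (leqnn _); move: (n.+1%:R^-1) => t; lra.
  move=> [u v] [/= pu qv]; apply: He; split => /=.
    exact: le_ball le2 _ (ball_triangle Hp pu).
  exact: le_ball le2 _ (ball_triangle Hq qv).
apply: bigcupT_measurable_rat => p; apply: bigcupT_measurable_rat => q.
apply: bigcupT_measurable => n; rewrite /C; case: asboolP => // _.
by apply: measurableX; apply: open_measurable; exact: ball_open.
Qed.

Lemma continuous_measurable2 (f : R * R -> R) : continuous f ->
  measurable_fun setT (f : measurableTypeR R * measurableTypeR R -> R).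
Proof.
move=> /continuousP cf; apply: (measurability _ (RGenOpens.measurableE R)).
move=> _ [_ [a [b ->] <-]]; rewrite setTI; apply: open_measurable2.
exact/cf/interval_open.
Qed.

End Plane.

(** * Test functions *)

Section Tests.
Context {R : realType} {d : space_dim}.
Implicit Types (a b q : Rd R d -> R) (N c : R).

Definition x1 (x : Rd R d) : R :=
  match d as d0 return Rd R d0 -> R with Dim1 => fun x => x | Dim2 => fun x => x.1 end x.

Definition smooth q : Prop :=
  match d as d0 return (Rd R d0 -> R) -> Prop with
  | Dim1 => fun f => forall n, @Cn R R n f
  | Dim2 => fun f => forall n, @Cn R (R * R)%type n f
  end q.

Definition box N : set (Rd R d) :=
  match d as d0 return set (Rd R d0) with
  | Dim1 => `[- N, N]%classic
  | Dim2 => `[- N, N]%classic `*` `[- N, N]%classic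
  end.

(** The substitution that turns the Poisson kernel of width [c] around [xi] into
   the kernel of unit width around the origin. *)
Definition affine (xi : Rd R d) c (z : Rd R d) : Rd R d :=
  match d as d0 return Rd R d0 -> Rd R d0 -> Rd R d0 with
  | Dim1 => fun xi z => xi - c * z
  | Dim2 => fun xi z => (xi.1 - c * z.1, xi.2 - c * z.2)
  end xi z.

End Tests.

Section TestsTheory.
Context {R : realType} {d : space_dim}.
Implicit Types (a b q : Rd R d -> R) (N c : R).

Lemma smooth_x1 : smooth (@x1 R d).
Proof.
case: d => n /=; last exact: Cn_fst.
by apply: Cn_lin => [h v x //|x]; exact: cvg_id.
Qed.

Lemma smoothM a b : smooth a -> smooth b -> smooth (fun x => a x * b x).
Proof. by case: d a b => a b /= sa sb n; exact: CnM. Qed.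

Lemma smooth_cst c : smooth (fun _ : Rd R d => c).
Proof. by case: d => /= n; exact: Cn_cst. Qed.

Lemma rt_smooth a : real_test a -> smooth a.
Proof. by case: d a => a []. Qed.

Lemma rtD a b : real_test a -> real_test b -> real_test (fun x => a x + b x).
Proof. by case: d a b => a b; exact: CcD. Qed.

Lemma rtM a b : smooth a -> real_test b -> real_test (fun x => a x * b x).
Proof. by case: d a b => a b; exact: CcM. Qed.

Lemma rtZ c a : real_test a -> real_test (fun x => c * a x).
Proof. by apply: rtM; exact: smooth_cst. Qed.

Lemma rt_comp (F : R -> R) q a c : (forall n, Sn Rgt0 n F) ->
  smooth q -> real_test a -> 0 < c -> (forall x, a x != 0 -> c <= q x) ->
  real_test (fun x => F (q x) * a x).
Proof. by case: d q a => q a; exact: Cc_comp. Qed.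

Lemma rt_bound a : real_test a -> exists2 M, 0 <= M & forall x, `|a x| <= M.
Proof. by case: d a => a; exact: Cc_bound. Qed.

Lemma rt_box a : real_test a -> exists2 N, 0 < N & forall x, a x != 0 -> box N x.
Proof.
case: d a => a /Cc_box [N N0 H]; exists N => // x /H /=.
  by rewrite in_itv/= -ler_norml.
by rewrite /Num.norm/= ge_max => /andP[h1 h2]; split; rewrite /= in_itv/= -ler_norml.
Qed.

Lemma rt_meas a : real_test a -> measurable_fun setT a.
Proof.
case: d a => a /= [/(_ 0)/Cn_cont ca _]; first exact: continuous_measurable_fun.
exact: continuous_measurable2.
Qed.

Lemma rt_affine a xi z : real_test a ->
  a (affine xi n.+1%:R^-1 z) @[n --> \oo] --> a xi.
Proof.
have H (u v : R) : u - n.+1%:R^-1 * v @[n --> \oo] --> u.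
  rewrite -[X in _ --> X]subr0 -[X in _ - X](mul0r v).
  by apply: cvgB; [exact: cvg_cst|apply: cvgM; [exact: cvg_harmonic|exact: cvg_cst]].
case: d a xi z => a xi z /= [/(_ 0)/Cn_cont ca _].
  exact: (cvg_comp _ _ (H xi z) (ca xi)).
have hh : ((xi.1 - n.+1%:R^-1 * z.1, xi.2 - n.+1%:R^-1 * z.2) : R * R) @[n --> \oo]
    --> (xi : R * R).
  by case: xi => u v; exact: (cvg_pair (H u z.1) (H v z.2)).
exact: (cvg_comp _ _ hh (ca xi)).
Qed.

Lemma box_measurable N : measurable (@box R d N).
Proof.
case: d => /=; first exact: measurable_itv.
by apply: measurableX; exact: measurable_itv.
Qed.

Lemma leb_box N : (leb (@box R d N) < +oo)%E.
Proof.
have H : (@lebesgue_measure R [set` `[- N, N]%R] < +oo)%E.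
  by rewrite lebesgue_measure_itv/=; case: ifP => _; rewrite ?ltry.
case: d => //=; rewrite product_measure1E; [|exact: measurable_itv..].
by apply: lte_mul_pinfty => //; rewrite ge0_fin_numE.
Qed.

End TestsTheory.

(** * Density of test functions *)

Section Indicators.
Context {d} {X : measurableType d} {R : realType} (mu : {measure set X -> \bar R}).
Implicit Types (f g : X -> R) (S B : set X).

Lemma integr_indic S : measurable S -> (mu S < +oo)%E -> integr mu (\1_S : X -> R).
Proof.
move=> mS S_fin; apply/integrableP; split; first exact/measurable_EFinP.
under eq_integral do rewrite gee0_abs ?lee_fin//.
by rewrite integral_indic// setIT.
Qed.

Lemma L2_bounded f B M : measurable_fun setT f -> measurable B -> (mu B < +oo)%E ->
  (forall x, `|f x| <= M) -> (forall x, f x != 0 -> B x) -> integr mu f /\ L2 mu f.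
Proof.
move=> mf mB B_fin fM fB.
have bd g N : measurable_fun setT g -> (forall x, `|g x| <= N) ->
    (forall x, g x != 0 -> B x) -> integr mu g.
  move=> mg gN gB; apply: (integr_le mg (integrZ N (integr_indic mB B_fin))) => x.
  have [->|gx] := eqVneq (g x) 0; first by rewrite normr0.
  rewrite indicE mem_set ?mulr1//; last exact: gB.
  exact: le_trans (gN x) (ler_norm _).
split; first exact: bd fM fB.
split => //; apply: (bd _ (M ^+ 2)); first exact: measurable_funX.
  by move=> x; rewrite normrX lerXn2r// nnegrE (le_trans _ (fM x)).
by move=> x; rewrite sqrf_eq0; exact: fB.
Qed.

Lemma L2_indic S : measurable S -> (mu S < +oo)%E -> L2 mu (\1_S : X -> R).
Proof.
move=> mS S_fin; apply: (@L2_bounded _ S 1 _ mS S_fin _ _).2 => //.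
  by move=> x; rewrite indicE; case: (_ \in _); rewrite ?normr1 ?normr0.
by move=> x; rewrite indicE; have [/set_mem//|_ /eqP] := boolP (x \in S).
Qed.

Lemma cvg_integr (u : nat -> X -> R) f g : (forall n, measurable_fun setT (u n)) ->
  measurable_fun setT f -> integr mu g -> (forall n x, `|u n x| <= g x) ->
  {ae mu, forall x, u n x @[n --> \oo] --> f x} ->
  integr mu f /\ \int[mu]_x u n x @[n --> \oo] --> \int[mu]_x f x.
Proof.
move=> mu_ mf Ig ug uf.
have [||||If _ H] := @dominated_convergence _ X R mu setT measurableT
  (fun n => EFin \o u n) (EFin \o f) (EFin \o g) _ _ _ Ig _.
- by move=> n; exact/measurable_EFinP.
- exact/measurable_EFinP.
- apply: filterS uf => x ufx _; apply: cvg_EFin => //; exact: nearW.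
- by apply: aeW => x n _ /=; rewrite lee_fin.
split => //; apply: fine_cvg; rewrite /= fineK//; exact: integrable_fin_num.
Qed.

Lemma L2_dom (u : nat -> X -> R) f g : (forall n, measurable_fun setT (u n)) ->
  measurable_fun setT f -> L2 mu g -> (forall n x, `|u n x| <= g x) ->
  (forall x, `|f x| <= g x) ->
  {ae mu, forall x, u n x @[n --> \oo] --> f x} ->
  nrm mu (fun x => f x - u n x) @[n --> \oo] --> (0 : R).
Proof.
move=> mu_ mf Lg ug fg uf.
have [|||||_ H] := @cvg_integr (fun n x => (f x - u n x) * (f x - u n x)) (fun=> 0)
  (fun x => 4 * (g x ^+ 2)).
- by move=> n; apply: measurable_funM; apply: measurable_funB.
- exact: measurable_cst.
- by apply: integrZ; case: Lg.
- move=> n x; rewrite normrM -expr2 (_ : 4 * g x ^+ 2 = (g x + g x) ^+ 2); last by ring.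
  have g0 : 0 <= g x by apply: le_trans (fg x).
  rewrite lerXn2r// ?nnegrE ?addr_ge0// (le_trans (ler_normB _ _))//.
  by rewrite lerD.
- apply: filterS uf => x ufx; rewrite -[X in _ --> X](mul0r 0) -(subrr (f x)).
  by apply: cvgM; apply: cvgB => //; exact: cvg_cst.
have := cvg_comp _ _ H (@sqrt_continuous R _).
by rewrite Rintegral_cst// mul0r sqrtr0.
Qed.

End Indicators.

Import HBNNSimple.

Section Approximation.
Context {d} {X : measurableType d} {R : realType} (mu : {measure set X -> \bar R}).
Implicit Types (f g : X -> R) (S : set X).
Variable A : (X -> R) -> Prop.
Hypothesis A_L2 : forall a, A a -> L2 mu a.
Hypothesis A0 : A (fun=> 0).
Hypothesis AD : forall a b, A a -> A b -> A (fun x => a x + b x).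
Hypothesis AZ : forall c a, A a -> A (fun x => c * a x).

Definition approx f := forall e, 0 < e ->
  exists2 a, A a & nrm mu (fun x => f x - a x) <= e.

Lemma approx_lim f : L2 mu f ->
  (forall e, 0 < e -> exists2 g, L2 mu g /\ approx g & nrm mu (fun x => f x - g x) <= e) ->
  approx f.
Proof.
move=> Lf H e e0; have e2 : 0 < e / 2 by rewrite divr_gt0.
have [g [Lg /(_ _ e2)[a Aa ga]] fg] := H _ e2; exists a => //.
rewrite (_ : (fun x => _) = fun x => (f x - g x) + (g x - a x)).
  have La := A_L2 Aa; apply: (le_trans (nrmD (L2B Lf Lg) (L2B Lg La))).
  by rewrite [leRHS]splitr lerD.
by apply/funext => x; rewrite addrA subrK.
Qed.

Lemma approx_cvg (u : nat -> X -> R) f g : (forall n, measurable_fun setT (u n)) ->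
  measurable_fun setT f -> L2 mu g -> (forall n x, `|u n x| <= g x) ->
  (forall x, `|f x| <= g x) ->
  {ae mu, forall x, u n x @[n --> \oo] --> f x} ->
  (forall n, approx (u n)) -> approx f.
Proof.
move=> mu_ mf Lg ug fg uf Au; have := L2_dom mu_ mf Lg ug fg uf.
have gg x (y : R) : `|y| <= g x -> `|y| <= `|g x|.
  by move=> yg; apply: le_trans yg (ler_norm _).
move=> /cvgr0Pnorm_lt H; apply: approx_lim.
  by apply: (L2_le mf Lg) => x; exact: gg.
move=> e /H [n _ Hn]; exists (u n).
  by split; [apply: (L2_le (mu_ n) Lg) => x; exact: gg|exact: Au].
by have /ltW := Hn n (leqnn n); apply: le_trans; exact: ler_norm.
Qed.

Lemma approx_A a : A a -> approx a.
Proof.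
move=> Aa e e0; exists a => //; apply: le_trans (ltW e0).
rewrite /nrm /ip (_ : (fun x => _) = fun=> 0); last first.
  by apply/funext => x; rewrite subrr mul0r.
by rewrite Rintegral_cst// mul0r sqrtr0.
Qed.

Lemma approxD f g : L2 mu f -> L2 mu g -> approx f -> approx g ->
  approx (fun x => f x + g x).
Proof.
move=> Lf Lg Hf Hg e e0; have e2 : 0 < e / 2 by rewrite divr_gt0.
have [a Aa fa] := Hf _ e2; have [b Ab gb] := Hg _ e2.
exists (fun x => a x + b x); first exact: AD.
rewrite (_ : (fun x => _) = fun x => (f x - a x) + (g x - b x)).
  apply: (le_trans (nrmD (L2B Lf (A_L2 Aa)) (L2B Lg (A_L2 Ab)))).
  by rewrite [leRHS]splitr lerD.
by apply/funext => x; rewrite opprD addrACA.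
Qed.

Lemma approxZ c f : L2 mu f -> approx f -> approx (fun x => c * f x).
Proof.
move=> Lf Hf e e0; have c0 : 0 < `|c| + 1 by rewrite ltr_wpDl.
have [a Aa fa] := Hf _ (divr_gt0 e0 c0); exists (fun x => c * a x); first exact: AZ.
rewrite (_ : (fun x => _) = fun x => c * (f x - a x)); last first.
  by apply/funext => x; rewrite mulrBr.
rewrite nrmZ; last exact: L2B Lf (A_L2 Aa).
move: fa; rewrite ler_pdivlMr// mulrC; apply: le_trans.
by rewrite ler_wpM2r ?nrm_ge0// lerDl.
Qed.

Variables (G : set (set X)) (B : nat -> set X).
Hypothesis G_gen : @measurable _ X = <<s G >>.
Hypothesis G_I : setI_closed G.
Hypothesis B_meas : forall n, measurable (B n).
Hypothesis B_fin : forall n, (mu (B n) < +oo)%E.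
Hypothesis B_cover : forall x, exists n0, forall n, (n0 <= n)%N -> B n x.
Hypothesis approx_box : forall n, approx (\1_(B n) : X -> R).
Hypothesis approx_G : forall n S, G S -> approx (\1_(S `&` B n) : X -> R).

Let fin S n : measurable S -> (mu (S `&` B n) < +oo)%E.
Proof.
move=> mS; apply: le_lt_trans (B_fin n).
by apply: le_measure; rewrite ?inE//; exact: measurableI.
Qed.

Let LI S n : measurable S -> L2 mu (\1_(S `&` B n) : X -> R).
Proof. by move=> mS; apply: L2_indic; [exact: measurableI|exact: fin]. Qed.

(** The sets whose indicator can be approximated inside a fixed box form a
   lambda-system. *)
Lemma approx_set n S : measurable S -> approx (\1_(S `&` B n) : X -> R).
Proof.
rewrite G_gen => mS.
apply: (@dynkin_induction _ X G (fun S => approx (\1_(S `&` B n) : X -> R)) _ _ _ _ _ _ S mS) => // {S mS}.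
- by rewrite setTI.
- by move=> S'; exact: approx_G.
- move=> {}S mS HS; have := approxD (LI n measurableT) (L2Z (-1) (LI n mS)).
  rewrite setTI => /(_ (approx_box n) (approxZ (-1) (LI n mS) HS)).
  congr approx; apply/funext => x; rewrite !indicE !in_setI in_setC.
  by case: (x \in S); case: (x \in B n); rewrite /=; ring.
- move=> F mF tF HF; pose U k := \big[setU/set0]_(i < k) F i.
  have mU k : measurable (U k) by apply: bigsetU_measurable.
  apply: (@approx_cvg (fun k => \1_(U k `&` B n) : X -> R) _ (\1_(B n) : X -> R)).
  + by move=> k; apply: measurable_indic; exact: measurableI.
  + by apply: measurable_indic; apply: measurableI => //; exact: bigcupT_measurable.
  + by rewrite -(setTI (B n)); exact: LI.
  + move=> k x; rewrite !indicE in_setI.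
    by case: (x \in U k); case: (x \in B n); rewrite ?normr1 ?normr0.
  + move=> x; rewrite !indicE in_setI.
    by case: (x \in \bigcup_k F k); case: (x \in B n); rewrite ?normr1 ?normr0.
  + apply: aeW => x; have [[k _ Fkx]|nF] := pselect ((\bigcup_k F k) x).
      apply: cvg_near_cst; exists k.+1 => // m /= km.
      rewrite !indicE !in_setI [x \in U m]mem_set ?[x \in \bigcup_k _]mem_set//.
        by exists k.
      by rewrite /U -bigcup_mkord; exists k.
    apply: cvg_near_cst; apply: nearW => m; rewrite !indicE !in_setI.
    rewrite [x \in U m]memNset ?[x \in \bigcup_k _]memNset//.
    by rewrite /U -bigcup_mkord => -[k _ Fkx]; apply: nF; exists k.
  + elim=> [|k IH].
      by rewrite /U big_ord0 set0I indic0; exact: approx_A.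
    have := approxD (LI n (mU k)) (LI n (mF k)) IH (HF k).
    congr approx; apply/funext => x; rewrite /U big_ord_recr /= !indicE !in_setI.
    rewrite in_setU; have [xk|_] := boolP (x \in F k); last by rewrite addr0 orbF.
    rewrite [x \in \big[_/_]_(_ < _) _]memNset ?add0r//.
    rewrite -bigcup_mkord => -[i /= ik Fix].
    have := tF i k I I (ex_intro _ x (conj Fix (set_mem xk))).
    by move=> ik'; rewrite ik' ltnn in ik.
Qed.

(** Simple functions increase to [f]; restricted to the sets [B n], they are combinations
   of indicators of sets of finite measure. *)
Lemma approx_ge0 f : L2 mu f -> (forall x, 0 <= f x) -> approx f.
Proof.
move=> Lf f0; have mf : measurable_fun setT (EFin \o f).
  by apply/measurable_EFinP; case: Lf.
pose g n : X -> R := nnsfun_approx measurableT mf n.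
have g_f x : g n x @[n --> \oo] --> f x.
  have f0' (t : X) : [set: X] t -> (0 <= (EFin \o f) t)%E by rewrite /= lee_fin.
  exact: (fine_cvg (cvg_nnsfun_approx measurableT mf f0' (I : [set: X] x))).
have gle n x : g n x <= f x.
  rewrite -lee_fin /g nnsfun_approxE; apply: (@le_approx _ _ _ setT (EFin \o f)) => //.
  by move=> t _; rewrite /= lee_fin.
have mI n : measurable_fun setT (\1_(B n) : X -> R) by exact: measurable_indic.
apply: (@approx_cvg (fun n x => g n x * \1_(B n) x) f f).
- by move=> n; exact: measurable_funM.
- by case: Lf.
- exact: Lf.
- move=> n x; rewrite ger0_norm ?mulr_ge0//; apply: le_trans (gle n x).
  by rewrite indicE; case: (_ \in _); rewrite ?mulr1 ?mulr0.
- by move=> x; rewrite ger0_norm.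
- apply: aeW => x; have [n0 Bx] := B_cover x; apply: cvg_trans (g_f x).
  apply: near_eq_cvg; exists n0 => // n /= n0n.
  by rewrite indicE mem_set ?mulr1//; exact: Bx.
- move=> n.
  have mY (y : R) : measurable (g n @^-1` [set y]) by exact: measurable_sfunP.
  rewrite (_ : (fun x => _) = fun x => \sum_(y <- finmap.enum_fset (fset_set (range (g n))))
      (y * \1_(g n @^-1` [set y] `&` B n) x)); last first.
    apply/funext => x; have -> := fimfunE (nnsfun_approx measurableT mf n) x : g n x = _.
    rewrite fsbig_finite//= mulr_suml.
    by apply: eq_bigr => y _; rewrite indicI /= mulrA.
  move: (finmap.enum_fset _) => s; suff : L2 mu (fun x => \sum_(y <- s)
      (y * \1_(g n @^-1` [set y] `&` B n) x)) /\
      approx (fun x => \sum_(y <- s) (y * \1_(g n @^-1` [set y] `&` B n) x)) by case.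
  elim: s => [|y s [IH1 IH2]].
    under eq_fun do rewrite big_nil.
    by split; [exact: L20|exact: approx_A].
  under eq_fun do rewrite big_cons.
  by split; [apply: L2D|apply: approxD] => //;
    [exact/L2Z/LI|exact/L2Z/LI|apply: approxZ; [exact: LI|exact: approx_set]].
Qed.

(** A linear space of functions is dense as soon as it approximates the indicators of
   a generating pi-system, cut off by an exhaustion [B] of finite measure. *)
Theorem approx_L2 f : L2 mu f -> approx f.
Proof.
move=> Lf; have mf : measurable_fun setT f by case: Lf.
have Lp (h : X -> R) : L2 mu h -> L2 mu (fun x => Num.max (h x) 0).
  move=> Lh; apply: (L2_le _ Lh).
    by apply: measurable_maxr => //; case: Lh.
  by move=> x; have [h0|h0] := leP (h x) 0; rewrite ?normr0.
have L1 := Lp _ Lf; have L3 := Lp _ (L2N Lf).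
have := approxD L1 (L2Z (-1) L3) (approx_ge0 L1 _) (approxZ (-1) L3 (approx_ge0 L3 _)).
have e : (fun x => Num.max (f x) 0 + -1 * Num.max (- f x) 0) = f.
  apply/funext => x; rewrite mulN1r; have [f0|f0] := leP (f x) 0.
    by rewrite max_l ?opprK ?add0r// oppr_ge0.
  by rewrite max_r ?subr0// oppr_le0 ltW.
by rewrite e; apply => x; rewrite le_max lexx orbT.
Qed.

End Approximation.

Section Away.
Context {R : realType} {d : space_dim}.
Implicit Types (a b : Rd R d -> R).

(** Tests that avoid the hyperplane where the first coordinate vanishes.
   The symbols of the system are singular at the origin, and the derivative of the
   phase in the first coordinate vanishes on that hyperplane. *)
Definition away a : Prop :=
  real_test a /\ exists2 c : R, 0 < c & forall x, a x != 0 -> c <= `|x1 x|.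

Lemma rt_L2 a : real_test a -> integr leb a /\ L2 leb a.
Proof.
move=> Ta; have [M _ aM] := rt_bound Ta; have [N _ aN] := rt_box Ta.
exact: (L2_bounded (rt_meas Ta) (box_measurable N) (leb_box N) aM aN).
Qed.

Lemma away_rt a : away a -> real_test a. Proof. by case. Qed.

Lemma away_L2 a : away a -> L2 leb a.
Proof. by move=> [/rt_L2[]]. Qed.

Lemma awayD a b : away a -> away b -> away (fun x => a x + b x).
Proof.
move=> [Ta [c c0 ac]] [Tb [e e0 be]]; split; first exact: rtD.
exists (Num.min c e) => [|x ab]; first by rewrite lt_min c0.
rewrite ge_min; have [a0|/ac ->//] := eqVneq (a x) 0.
by rewrite be ?orbT//; move: ab; rewrite a0 add0r.
Qed.

Lemma awayM a b : smooth a -> away b -> away (fun x => a x * b x).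
Proof.
move=> sa [Tb [c c0 bc]]; split; first exact: rtM.
by exists c => // x; rewrite mulf_eq0 => /norP[_]; exact: bc.
Qed.

Lemma awayZ (k : R) a : away a -> away (fun x => k * a x).
Proof. by apply: awayM; exact: smooth_cst. Qed.

Lemma away0 : away (fun _ : Rd R d => 0 : R).
Proof.
split; last by exists 1 => // x; rewrite eqxx.
have e (V : normedModType R) : supp (fun _ : V => 0 : R) = set0.
  rewrite /supp (_ : [set x | _] = set0) ?closure0//.
  by apply/seteqP; split => // x /=; rewrite eqxx.
by case: d => /=; (split; [move=> n; exact: Cn_cst|]);
  rewrite -/(supp _) e; exact: compact0.
Qed.

End Away.

Section LineDensity.
Context {R : realType}.

Lemma cvgy_ge_nat (u : nat -> R) : (\forall n \near \oo, n.+1%:R <= u n) ->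
  u n @[n --> \oo] --> +oo.
Proof.
move=> H; apply/cvgryPge => A; near=> n; apply: (@le_trans _ _ n.+1%:R).
  by rewrite (@le_trans _ _ n%:R) ?ler_nat//; near: n; exact: nbhs_infty_ger.
by near: n.
Unshelve. all: by end_near. Qed.

(** A smooth approximation of the indicator of the interval from [al] (excluded) to [be]
   (included); the last factor removes a shrinking neighbourhood of the origin. *)
Definition cutoff (al be : R) (n : nat) (x : R) : R :=
  ebump 0 (n.+1%:R * (x - al)) * (ebump 0 (n.+1%:R * (n.+1%:R * (be - x) + 1)) *
  ebump 0 (n.+1%:R * (n.+1%:R * (x * x) - 1))).

Lemma cutoff_neq0 al be n x : cutoff al be n x != 0 ->
  [/\ al < x, x <= be + 1 & 1 <= n.+1%:R * (x * x)].
Proof.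
rewrite /cutoff !mulf_eq0 => /norP[h1 /norP[h2 h3]].
have pos (k : nat) (y : R) : ebump k y != 0 -> 0 < y.
  by move=> h; rewrite ltNge; apply/negP => /(ebump_le0 k) e; rewrite e eqxx in h.
have n0 : 0 < n.+1%:R :> R by rewrite ltr0n.
have n1 : 1 <= n.+1%:R :> R by rewrite ler1n.
move: h1 h2 h3 => /pos + /pos + /pos; rewrite !(pmulr_rgt0 _ n0) => h1 h2 h3.
by split; [lra| |lra]; move: n1 h2; set t := n.+1%:R; nra.
Qed.

Lemma away_cutoff al be n : @away R Dim1 (cutoff al be n).
Proof.
have Ci m : @Cn R R m (fun x => x) by apply: Cn_lin => [h v x //|x]; exact: cvg_id.
split.
  split=> [m|].
    apply: CnM; last apply: CnM; apply: (@Cn_comp0 R R m (ebump 0)); try exact: Sn_ebump.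
    - by apply: CnM; [exact: Cn_cst|apply: CnD => //; exact: Cn_cst].
    - apply: CnM; [exact: Cn_cst|apply: CnD; last exact: Cn_cst].
      apply: CnM; [exact: Cn_cst|apply: CnD; first exact: Cn_cst].
      by apply: Cn_lin => [h v x|x]; [rewrite opprD -mulrN|exact: opp_continuous].
    - apply: CnM; [exact: Cn_cst|apply: CnD; last exact: Cn_cst].
      by apply: CnM; [exact: Cn_cst|exact: CnM].
  apply: (subclosed_compact _ (@segment_compact R al (be + 1))); first exact: closed_closure.
  move=> x Sx; apply: (compact_closed (@Rhausdorff R) (@segment_compact R al (be + 1))).
  apply: closureS Sx => y /cutoff_neq0[h1 h2 _] /=.
  by rewrite in_itv/= ltW.
exists (Num.sqrt n.+1%:R^-1) => [|x /cutoff_neq0[_ _ h]].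
  by rewrite sqrtr_gt0 invr_gt0.
by rewrite -(sqrtr_sqr x) ler_wsqrtr// expr2 -[leLHS]mulr1 ler_pdivrMl.
Qed.

Lemma cutoff_le1 al be n x : `|cutoff al be n x| <= (\1_(`[al, be + 1]) x : R).
Proof.
have [->|h] := eqVneq (cutoff al be n x) 0; first by rewrite normr0.
have [h1 h2 _] := cutoff_neq0 h; rewrite indicE mem_set /=; last by rewrite in_itv/= ltW.
rewrite ger0_norm ?mulr_ge0 ?ebump_ge0//.
by rewrite mulr_ile1 ?mulr_ge0 ?mulr_ile1 ?ebump_ge0 ?ebump0_le1.
Qed.

Lemma cutoff_cvg al be x : x != 0 ->
  cutoff al be n x @[n --> \oo] --> (\1_(`]al, be]) x : R).
Proof.
move=> x0; rewrite indicE; have [/set_mem /=|/negP xI] := boolP (x \in `]al, be]%classic).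
  rewrite in_itv/= => /andP[ax xb].
  rewrite (_ : true%:R = 1 * (1 * 1) :> R); last by rewrite !mulr1.
  have big (c k : R) : 0 < c -> \forall n \near \oo, k <= n.+1%:R * c.
    move=> c0; near=> n; rewrite -ler_pdivrMr// (@le_trans _ _ n%:R) ?ler_nat//.
    by near: n; exact: nbhs_infty_ger.
  apply: cvgM; last apply: cvgM; apply: ebump_cvg.
  - apply/cvgryPge => A; apply: big; lra.
  - apply: cvgy_ge_nat; apply: nearW => n; rewrite ler_peMr// lerDr mulr_ge0//; lra.
  - apply: cvgy_ge_nat; have : 0 < x * x by rewrite -expr2 exprn_even_gt0.
    move=> /(big _ 2); apply: filterS => n nx; rewrite ler_peMr//; lra.
have [xa|ax] := leP x al.
  apply: cvg_near_cst; apply: nearW => n.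
  by rewrite /cutoff ebump_le0 ?mul0r// mulr_ge0_le0//; lra.
have bx : be < x.
  rewrite ltNge; apply/negP => xb; apply: xI; apply/mem_set.
  by rewrite /= in_itv/= ax xb.
apply: cvg_near_cst; near=> n.
rewrite /cutoff [X in _ * (X * _)]ebump_le0 ?mul0r ?mulr0// mulr_ge0_le0//.
have : 1 <= n.+1%:R * (x - be).
  rewrite -ler_pdivrMr ?subr_gt0// (@le_trans _ _ n%:R) ?ler_nat//.
  by near: n; exact: nbhs_infty_ger.
lra.
Unshelve. all: by end_near. Qed.

Let mu := @lebesgue_measure R.

(** The cutoffs converge off the origin, which is a null set, and are dominated by the
   indicator of a bounded interval. *)
Lemma approx_ocitv (S : set R) : ocitv S ->
  approx (@leb R Dim1) (@away R Dim1) (\1_S : R -> R).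
Proof.
move=> [[al be] _ <-] /=.
have mI (b0 b1 : bool) (u v : R) : measurable [set` Interval (BSide b0 u) (BSide b1 v)].
  exact: measurable_itv.
have fI (b0 b1 : bool) (u v : R) : (mu [set` Interval (BSide b0 u) (BSide b1 v)] < +oo)%E.
  by rewrite /mu lebesgue_measure_itv/=; case: ifP => _; rewrite ?ltry.
apply: (@approx_cvg _ _ _ (@leb R Dim1) (@away R Dim1) (@away_L2 R Dim1)
  (cutoff al be) _ (\1_(`[al, be + 1]) : R -> R)).
- by move=> n; apply: (@rt_meas R Dim1); apply: away_rt; exact: away_cutoff.
- exact: measurable_indic.
- exact: L2_indic.
- by move=> n x; exact: cutoff_le1.
- move=> x; rewrite !indicE; have [/set_mem /=|_] := boolP (x \in `]al, be]%classic).
    rewrite in_itv/= => /andP[ax xb]; rewrite mem_set ?normr1//= in_itv/= ltW//=.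
    by apply: le_trans xb _; rewrite lerDl.
  by rewrite normr0.
- exists [set 0]; split; [exact: measurable_set1|exact: lebesgue_measure_set1|].
  by move=> x /= h; apply: contrapT => /eqP x0; apply: h; exact: cutoff_cvg.
- by move=> n; apply: approx_A; exact: away_cutoff.
Qed.

Lemma dense1 (f : R -> R) : L2 (@leb R Dim1) f ->
  approx (@leb R Dim1) (@away R Dim1) f.
Proof.
have fB n : (mu [set` `](- n%:R)%R, (n%:R : R)%R]%R] < +oo)%E.
  by rewrite /mu lebesgue_measure_itv/=; case: ifP => _; rewrite ?ltry.
have oB n : ocitv `](- n%:R : R), n%:R]%classic by exact: is_ocitv.
move=> Lf; refine (@approx_L2 _ _ _ (@leb R Dim1) (@away R Dim1) (@away_L2 R Dim1)
  (@away0 R Dim1) (@awayD R Dim1) (@awayZ R Dim1) (@ocitv R)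
  (fun n => `](- n%:R : R), n%:R]%classic) _ _ _ _ _ _ _ _ Lf) => //.
- exact: ocitvI.
- move=> x; exists (Num.truncn `|x|).+1 => n hn; rewrite /= in_itv/=.
  have : `|x| < n%:R by rewrite (lt_le_trans (truncnS_gt _))// ler_nat.
  by rewrite ltr_norml => /andP[-> /ltW].
- by move=> n; exact: approx_ocitv.
- by move=> n S oS; apply: approx_ocitv; exact: ocitvI.
Qed.

End LineDensity.

(** * Product measures *)

Section Fubini.
Context {d1 d2} {X : measurableType d1} {Y : measurableType d2} {R : realType}.
Variables (m1 : {sigma_finite_measure set X -> \bar R}).
Variables (m2 : {sigma_finite_measure set Y -> \bar R}).
Implicit Types (f : X -> R) (g : Y -> R) (k : X * Y -> R).

Lemma measurable_tensor f g : measurable_fun setT f -> measurable_fun setT g ->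
  measurable_fun setT (fun z : X * Y => f z.1 * g z.2).
Proof. by move=> mf mg; apply: measurable_funM; exact: measurableT_comp. Qed.

Lemma measurable_sect1 k (x : X) : measurable_fun setT k ->
  measurable_fun setT (fun y => k (x, y)).
Proof. by move=> mk; apply: measurableT_comp => //; exact: measurable_pair1. Qed.

Lemma measurable_sect2 k (y : Y) : measurable_fun setT k ->
  measurable_fun setT (fun x => k (x, y)).
Proof. by move=> mk; apply: measurableT_comp => //; exact: measurable_pair2. Qed.

Lemma integr_tensor f g : integr m1 f -> integr m2 g ->
  integr (m1 \x m2)%E (fun z => f z.1 * g z.2).
Proof.
move=> If Ig; have mf := integr_meas If; have mg := integr_meas Ig.
apply/integrable12ltyP; first by apply/measurable_EFinP; exact: measurable_tensor.
rewrite (eq_integral (fun x => (\int[m2]_y `|(g y)%:E|) * `|(f x)%:E|)%E); last first.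
  move=> x _ /=; rewrite muleC -ge0_integralZl//=; last first.
    by apply/measurable_EFinP; exact: measurableT_comp.
  by apply: eq_integral => y _; rewrite -EFinM normrM.
rewrite ge0_integralZl//=; last 2 first.
- by apply/measurable_EFinP; exact: measurableT_comp.
- by apply: integral_ge0.
move: If Ig => /integrableP[_ If] /integrableP[_ Ig].
by apply: lte_mul_pinfty => //; [apply: integral_ge0|rewrite ge0_fin_numE//; apply: integral_ge0].
Qed.

Lemma int_tensor f g : integr m1 f -> integr m2 g ->
  \int[(m1 \x m2)%E]_z (f z.1 * g z.2) = \int[m1]_x f x * \int[m2]_y g y.
Proof.
move=> If Ig; have Ifg := integr_tensor If Ig.
rewrite {1}/Rintegral -integral12_prod_meas1//.
rewrite (eq_integral (fun x => (\int[m2]_y g y)%:E * (f x)%:E)%E); last first.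
  move=> x _; rewrite /fubini_F /= muleC int_EFin// -integralZl//=.
by rewrite integralZl//= -int_EFin//= mulrC.
Qed.

Lemma L2_tensor f g : L2 m1 f -> L2 m2 g -> L2 (m1 \x m2)%E (fun z => f z.1 * g z.2) /\
  nrm (m1 \x m2)%E (fun z => f z.1 * g z.2) = nrm m1 f * nrm m2 g.
Proof.
move=> [mf If] [mg Ig]; split.
  split; first exact: measurable_tensor.
  by under eq_fun do rewrite exprMn; exact: (integr_tensor If Ig).
rewrite /nrm -sqrtrM ?ipff_ge0//; congr Num.sqrt; rewrite /ip -int_tensor //.
by apply: eq_Rintegral => z _; rewrite mulrACA.
Qed.

Lemma int21 k : integr (m1 \x m2)%E k ->
  \int[(m1 \x m2)%E]_z k z = \int[m2]_y \int[m1]_x k (x, y).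
Proof.
move=> Ik; rewrite {1}/Rintegral -integral21_prod_meas1// /fubini_G /=.
rewrite /Rintegral; congr fine; apply: ae_eq_integral => //.
- exact: (measurable_fubini_G Ik).
- apply/measurable_EFinP.
  have := measurableT_comp (@fine_measurable R setT measurableT) (measurable_fubini_G Ik).
  exact.
- have := ae_integrable2 Ik; apply: filterS => x Ix _ /=; rewrite fineK//.
  exact: integrable_fin_num.
Qed.

Lemma integr_kernel f g k (M : R) : integr m1 f -> integr m2 g ->
  measurable_fun setT k -> (forall z, `|k z| <= M) ->
  integr (m1 \x m2)%E (fun z => (f z.1 * g z.2) * k z) /\
  integr m1 (fun x => f x * \int[m2]_y (k (x, y) * g y)).
Proof.
move=> If Ig mk kM.
have Ik : integr (m1 \x m2)%E (fun z => (f z.1 * g z.2) * k z).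
  exact: integr_bound (integr_tensor If Ig) mk kM.
split=> //.
rewrite /integr (_ : _ \o _ = fubini_F m2 (EFin \o (fun z => (f z.1 * g z.2) * k z))).
  exact: integrable_fubini_F.
apply/funext => x; rewrite /= EFinM.
have Ix : integr m2 (fun y => k (x, y) * g y).
  under eq_fun do rewrite mulrC.
  by apply: (integr_bound Ig (M := M)) => //; exact: measurable_sect1.
rewrite int_EFin// -integralZl//.
by apply: eq_integral => v _; rewrite -EFinM; congr EFin; ring.
Qed.

End Fubini.

Section FubiniKernel.
Context {d1 d2} {X : measurableType d1} {Y : measurableType d2} {R : realType}.
Variables (m1 : {sigma_finite_measure set X -> \bar R}).
Variables (m2 : {sigma_finite_measure set Y -> \bar R}).
Implicit Types (f : X -> R) (g : Y -> R) (k : X * Y -> R).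

(** The product [f x * g y] is integrable for the product measure, so that a kernel only
   has to be measurable and bounded. *)
Lemma fubini_kernel f g k (M : R) : integr m1 f -> integr m2 g ->
  measurable_fun setT k -> (forall z, `|k z| <= M) ->
  [/\ integr m1 (fun x => f x * \int[m2]_y (k (x, y) * g y)),
      integr m2 (fun y => g y * \int[m1]_x (k (x, y) * f x)) &
      \int[m1]_x (f x * \int[m2]_y (k (x, y) * g y)) =
      \int[m2]_y (g y * \int[m1]_x (k (x, y) * f x))].
Proof.
move=> If Ig mk kM; have [Ik I1] := integr_kernel If Ig mk kM.
have [_ I2] := @integr_kernel _ _ _ _ _ m2 m1 g f (fun z => k (z.2, z.1)) M Ig If
  (measurableT_comp mk (@measurable_swap _ _ Y X)) (fun z => kM _).
split=> //.
have Ix x : integr m2 (fun y => k (x, y) * g y).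
  under eq_fun do rewrite mulrC.
  by apply: (integr_bound Ig (M := M)) => //; exact: measurable_sect1.
have Iy y : integr m1 (fun x => k (x, y) * f x).
  under eq_fun do rewrite mulrC.
  by apply: (integr_bound If (M := M)) => //; exact: measurable_sect2.
have E1 x : (f x * \int[m2]_y (k (x, y) * g y))%:E =
    (\int[m2]_y ((f x * g y) * k (x, y))%:E)%E.
  rewrite EFinM int_EFin// -integralZl//; last exact: Ix.
  by apply: eq_integral => v _; rewrite -EFinM; congr EFin; ring.
have E2 y : (g y * \int[m1]_x (k (x, y) * f x))%:E =
    (\int[m1]_x ((f x * g y) * k (x, y))%:E)%E.
  rewrite EFinM int_EFin// -integralZl//; last exact: Iy.
  by apply: eq_integral => u _; rewrite -EFinM; congr EFin; ring.
rewrite /Rintegral; congr fine.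
rewrite (eq_integral _ _ (fun x _ => E1 x)) (eq_integral _ _ (fun y _ => E2 y)).
exact: (Fubini Ik).
Qed.

End FubiniKernel.

Section AsSigmaFinite.
Context {d'} {X : measurableType d'} {R : realType}.
Variables (m : {measure set X -> \bar R}) (H : sigma_finite setT m).

Let m' : set X -> \bar R := m.

HB.instance Definition _ := Measure.on m'.
HB.instance Definition _ := Measure_isSigmaFinite.Build _ _ _ m' H.

(** [leb] has the structure of a measure only, and Fubini's theorem asks for that of a
   sigma-finite measure. *)
Definition as_sigma_finite : {sigma_finite_measure set X -> \bar R} := m'.

End AsSigmaFinite.

Section LebesgueSpace.
Context {R : realType} {d : space_dim}.

Lemma box_cover (x : Rd R d) : exists n0, forall n, (n0 <= n)%N -> box n%:R x.
Proof.
have H (u : R) : exists n0, forall n, (n0 <= n)%N -> u \in `[- n%:R, n%:R].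
  exists (Num.truncn `|u|).+1 => n hn; rewrite in_itv/= -ler_norml ltW//.
  by rewrite (lt_le_trans (truncnS_gt _))// ler_nat.
case: d x => [x|[x y]] /=; first exact: H.
have [n0 Hx] := H x; have [n1 Hy] := H y; exists (maxn n0 n1) => n.
by rewrite geq_max => /andP[/Hx hx /Hy hy]; split.
Qed.

Lemma leb_sigma_finite : sigma_finite setT (@leb R d).
Proof.
exists (fun n => box n%:R) => [|n]; last by split; [exact: box_measurable|exact: leb_box].
apply/seteqP; split => // x _; have [n0 Hx] := box_cover x.
by exists n0 => //; exact: Hx.
Qed.

Definition lebs : {sigma_finite_measure set (Rd R d) -> \bar R} :=
  as_sigma_finite leb_sigma_finite.

Lemma lebsE : (lebs : {measure set (Rd R d) -> \bar R}) = leb.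
Proof. by rewrite /lebs; case: leb leb_sigma_finite => ? [? ?] ?. Qed.

End LebesgueSpace.

Section PlaneDensity.
Context {R : realType}.

Lemma away_tensor (p q : R -> R) : @away R Dim1 p -> @away R Dim1 q ->
  @away R Dim2 (fun z => p z.1 * q z.2).
Proof.
move=> [Tp [c c0 pc]] [Tq _]; split; first exact: Cc_tensor.
by exists c => // x; rewrite mulf_eq0 => /norP[/pc].
Qed.

(** [f g - p q = (f - p) g + p (g - q)], and the norm of a tensor product is the product
   of the norms. *)
Lemma approx_tensor (f g : R -> R) : L2 (@leb R Dim1) f -> L2 (@leb R Dim1) g ->
  approx (@leb R Dim2) (@away R Dim2) (fun z => f z.1 * g z.2).
Proof.
move=> Lf Lg e e0; set N := nrm (@leb R Dim1).
have c1 : 0 < N f + N g + 1 by rewrite ltr_wpDl// addr_ge0 ?nrm_ge0.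
pose e1 := Num.min (e / (N f + N g + 1)) 1.
have e10 : 0 < e1 by rewrite lt_min ltr01 divr_gt0.
have [p Ap fp] := dense1 Lf e10; have [q Aq gq] := dense1 Lg e10.
have Lp := away_L2 Ap; have Lq := away_L2 Aq.
exists (fun z => p z.1 * q z.2); first exact: away_tensor.
have [T1 N1] := @L2_tensor _ _ _ _ R (@lebesgue_measure R) (@lebesgue_measure R) _ _
  (L2B Lf Lp) Lg.
have [T2 N2] := @L2_tensor _ _ _ _ R (@lebesgue_measure R) (@lebesgue_measure R) _ _
  Lp (L2B Lg Lq).
rewrite (_ : (fun x => _) = (fun z : R * R => (f z.1 - p z.1) * g z.2 + p z.1 * (g z.2 - q z.2))).
  apply: (le_trans (nrmD T1 T2)); rewrite N1 N2.
  have Np : N p <= N f + 1.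
    have := nrmB Lf (L2B Lf Lp).
    rewrite (_ : (fun x => f x - (f x - p x)) = p); last first.
      by apply/funext => x; rewrite opprB addrC subrK.
    move/le_trans; apply; rewrite lerD2l (le_trans fp)//.
    by rewrite ge_min lexx orbT.
  have Ee : e1 * (N f + N g + 1) <= e.
    by rewrite -ler_pdivlMr// ge_min lexx.
  have h1 : nrm lebesgue_measure (fun x => f x - p x) * N g <= e1 * N g.
    by rewrite ler_wpM2r ?nrm_ge0.
  have h2 : N p * nrm lebesgue_measure (fun x => g x - q x) <= (N f + 1) * e1.
    by apply: ler_pM; rewrite ?nrm_ge0.
  rewrite -/(N g) -/(N p); apply: le_trans Ee; apply: le_trans (lerD h1 h2) _; lra.
by apply/funext => z; ring.
Qed.

Lemma approx_rectangle (A B : set R) (n : nat) :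
  measurable (A : set (measurableTypeR R)) -> measurable (B : set (measurableTypeR R)) ->
  approx (@leb R Dim2) (@away R Dim2) (\1_((A `*` B) `&` @box R Dim2 n%:R) : R * R -> R).
Proof.
move=> mA mB; have LI (S : set R) : measurable (S : set (measurableTypeR R)) ->
    L2 (@leb R Dim1) (\1_(S `&` @box R Dim1 n%:R) : R -> R).
  move=> mS; apply: L2_indic; first by apply: measurableI => //; exact: (@box_measurable R Dim1).
  apply: le_lt_trans (@leb_box R Dim1 n%:R).
  apply: le_measure; rewrite ?inE.
  - by apply: measurableI => //; exact: (@box_measurable R Dim1).
  - exact: (@box_measurable R Dim1).
  - by move=> x [].
have := approx_tensor (LI A mA) (LI B mB); congr approx; apply/funext => -[x y] /=.
rewrite !indicE -natrM mulnb; congr (nat_of_bool _)%:R.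
by apply/idP/idP => [/andP[/set_mem[/= ? ?] /set_mem[/= ? ?]]|/set_mem[[/= ? ?] [/= ? ?]]];
  [apply/mem_set|apply/andP; split; apply/mem_set].
Qed.

Lemma dense2 (f : R * R -> R) : L2 (@leb R Dim2) f ->
  approx (@leb R Dim2) (@away R Dim2) f.
Proof.
move=> Lf; pose G := [set A `*` B | A in @measurable _ (measurableTypeR R)
  & B in @measurable _ (measurableTypeR R)].
apply: (@approx_L2 _ (Rd R Dim2) _ (@leb R Dim2) (@away R Dim2) (@away_L2 R Dim2)
  (@away0 R Dim2) (@awayD R Dim2) (@awayZ R Dim2) G (fun n => @box R Dim2 n%:R)
  _ _ _ _ _ _ _ _ Lf).
- exact: measurable_prod_measurableType.
- move=> _ _ [A mA [B mB <-]] [C mC [D mD <-]]; exists (A `&` C); first exact: measurableI.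
  by exists (B `&` D); [exact: measurableI|rewrite setXI].
- by move=> n; exact: (@box_measurable R Dim2).
- by move=> n; exact: (@leb_box R Dim2).
- exact: (@box_cover R Dim2).
- move=> n; have := @approx_rectangle setT setT n measurableT measurableT.
  by rewrite setXTT setTI.
- by move=> n _ [A mA [B mB <-]]; exact: approx_rectangle.
Qed.

End PlaneDensity.

Theorem dense_away (R : realType) (d : space_dim) (f : Rd R d -> R) : L2 leb f ->
  forall e, 0 < e -> exists2 a, away a & nrm leb (fun x => f x - a x) <= e.
Proof. by case: d f => f; [exact: dense1|exact: dense2]. Qed.

(** * The Poisson kernel *)

Section Calculus.
Context {R : realType}.
Notation mu := (@lebesgue_measure R).
Implicit Types (f g G : R -> R).

Lemma FTC G g (a b : R) : a < b -> (forall x : R, is_derive x 1 G (g x)) -> continuous g ->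
  \int[mu]_(x in `[a, b]) g x = G b - G a.
Proof.
move=> ab DG cg; have cG : continuous G.
  by move=> x; apply/differentiable_continuous/derivable1_diffP; have [] := DG x.
rewrite /Rintegral (@continuous_FTC2 _ _ G)//.
- exact: continuous_subspaceT.
- split.
  + by move=> x _; have [] := DG x.
  + by apply: cvg_at_right_filter; exact: cG.
  + by apply: cvg_at_left_filter; exact: cG.
- by move=> x _; rewrite derive1E; have [_ ->] := DG x.
Qed.

(** Lebesgue measure is determined by its values on half-open intervals. *)
Lemma int_scaled_measure (m : {measure set (measurableTypeR R) -> \bar R})
    (c : {nonneg R}) (f : measurableTypeR R -> \bar R) :
  measurable_fun setT f -> (forall x, (0 <= f x)%E) ->
  (forall A, ocitv A -> mu A = (c%:num%:E * m A)%E) ->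
  (\int[mu]_x f x = c%:num%:E * \int[m]_x f x)%E.
Proof.
move=> mf f0 H; rewrite -ge0_integral_mscale//.
apply: eq_measure_integral => A mA _.
exact: (@lebesgue_measure_unique R (mscale c m)).
Qed.

Lemma int_affine1 (f : R -> \bar R) (xi c : R) : 0 < c -> measurable_fun setT f ->
  (forall x, (0 <= f x)%E) ->
  (\int[mu]_x f x = c%:E * \int[mu]_z f (xi - c * z)%R)%E.
Proof.
move=> c0 mf f0; pose phi (z : measurableTypeR R) : measurableTypeR R := xi - c * (z : R).
have mphi : measurable_fun setT phi.
  apply: measurable_funB; first exact: measurable_cst.
  by apply: measurable_funM => //; exact: measurable_cst.
have cN : 0 <= c by exact: ltW.
pose m0 : {measure set (measurableTypeR R) -> \bar R} := pushforward mu phi.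
set m : {measure set (measurableTypeR R) -> \bar R} := m0 mphi.
have H1 : (\int[m]_x f x = \int[mu]_z (f \o phi) z)%E.
  exact: (@ge0_integral_pushforward _ _ _ _ _ _ mphi mu setT f measurableT mf (fun y _ => f0 y)).
transitivity (c%:E * \int[m]_x f x)%E; last by rewrite H1.
apply: (@int_scaled_measure m (NngNum cN)) => // _ [[a b] _ <-] /=.
rewrite /pushforward.
have -> : phi @^-1` `]a, b]%classic = `[((xi - b) / c), ((xi - a) / c)[%classic.
  apply/seteqP; split => z /=; rewrite !in_itv/= ler_pdivrMr// ltr_pdivlMr// /phi => /andP[h1 h2];
    apply/andP; split; lra.
rewrite !lebesgue_measure_itv/= !lte_fin ltr_pM2r ?invr_gt0// ltrD2l ltrN2.
case: ifP => _; last by rewrite mule0.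
by rewrite -!EFinB -EFinM; congr EFin; field; rewrite gt_eqF.
Qed.

Lemma int_oneDsqr : (\int[mu]_x ((1 + x ^+ 2)^-1)%:E = (pi : R)%:E)%E.
Proof.
rewrite (@ge0_symfun_integralT R (fun x => (1 + x ^+ 2)^-1)).
- rewrite -set_itvcy; have := @integral0y_oneDsqr R; rewrite /oneDsqr => ->.
  by rewrite -EFinM; congr EFin; field.
- by move=> x; rewrite invr_ge0 addr_ge0 ?sqr_ge0.
- exact: continuous_oneDsqrV.
- by move=> x; rewrite /= sqrrN.
Qed.

Lemma integr_oneDsqr : integr mu (fun x : R => (1 + x ^+ 2)^-1).
Proof.
apply/integrableP; split.
  by apply/measurable_EFinP; apply: continuous_measurable_fun; exact: continuous_oneDsqrV.
under eq_integral do rewrite gee0_abs ?lee_fin ?invr_ge0 ?addr_ge0 ?sqr_ge0//.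
by rewrite int_oneDsqr ltry.
Qed.

Definition expabs (de x : R) : R := expR (- (de * `|x|)).

Lemma expabs_meas de : measurable_fun setT (expabs de).
Proof.
apply: continuous_measurable_fun => x; apply: continuous_comp; last exact: continuous_expR.
apply: cvgN; apply: cvgM; [exact: cvg_cst|exact: norm_continuous].
Qed.

Lemma expabs_ge0 de x : 0 <= expabs de x. Proof. exact: expR_ge0. Qed.

Lemma expabs_le1 de x : 0 < de -> expabs de x <= 1.
Proof. by move=> d0; rewrite -[leRHS]expR0 ler_expR oppr_le0 mulr_ge0// ltW. Qed.

(** Comparison with [(1 + x ^+ 2)^-1], since [1 + y ^+ 2 / 2 <= expR y] for [0 <= y]. *)
Lemma integr_expabs de : 0 < de -> integr mu (expabs de).
Proof.
move=> d0; have := integrZ (1 + 2 / de ^+ 2) integr_oneDsqr => /integr_le; apply.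
  exact: expabs_meas.
move=> x; have d2 : 0 < de ^+ 2 by rewrite exprn_gt0.
have x2 : 0 < 1 + x ^+ 2 by rewrite ltr_pwDl ?sqr_ge0.
have c0 : 0 < 1 + 2 / de ^+ 2 by rewrite ltr_wpDr ?divr_ge0// ltW.
rewrite !ger0_norm ?expabs_ge0 ?mulr_ge0 ?invr_ge0// ?(ltW c0) ?(ltW x2)//.
rewrite ler_pdivlMr// /expabs expRN ler_pdivrMl ?expR_gt0//.
have y0 : 0 <= de * `|x| by rewrite mulr_ge0// ltW.
have := expR_ge1Dxn 1 y0; rewrite exprMn real_normK ?num_real// (_ : 2`!%:R = 2%:R)//.
move: (expR _) => E H; apply: (@le_trans _ _ ((1 + de ^+ 2 * x ^+ 2 / 2) * (1 + 2 / de ^+ 2))).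
  have -> : (1 + de ^+ 2 * x ^+ 2 / 2) * (1 + 2 / de ^+ 2) =
     1 + x ^+ 2 + (2 / de ^+ 2 + de ^+ 2 * x ^+ 2 / 2).
    by field; rewrite gt_eqF.
  rewrite lerDl; apply: addr_ge0; apply: divr_ge0; rewrite ?ler0n ?sqr_ge0//.
  by apply: mulr_ge0; exact: sqr_ge0.
by rewrite ler_wpM2r// ltW.
Qed.

Lemma is_derive_trig (c : R) (x : R) :
  is_derive x 1 (fun y => cos (c * y)) (- (c * sin (c * x))) /\
  is_derive x 1 (fun y => sin (c * y)) (c * cos (c * x)) /\
  is_derive x 1 (fun y => expR (c * y)) (c * expR (c * x)).
Proof.
have L : is_derive x 1 (fun y => c * y) c.
  have := isDM (@isD_cst R R c x 1) (is_derive_id x 1).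
  by apply: isD_ext => //; rewrite mulr1 mulr0 addr0.
split; [|split].
- by have := isD_comp L (is_derive_cos (c * x)); apply: isD_ext => //; ring.
- by have := isD_comp L (is_derive_sin (c * x)); apply: isD_ext => //; ring.
- by have := isD_comp L (is_derive_expR (c * x)); apply: isD_ext => //; ring.
Qed.

(** The integrand has an explicit primitive on each half-line, whose value at [N] is
   at most a multiple of [expR (- (de * N))]. *)
Lemma poisson_cos de eta : 0 < de ->
  \int[mu]_x (cos (x * eta) * expabs de x) = 2 * de / (de ^+ 2 + eta ^+ 2).
Proof.
move=> d0; set f := fun x => _; set D := de ^+ 2 + eta ^+ 2.
have D0 : D != 0 by rewrite gt_eqF// ltr_pwDl ?exprn_gt0 ?sqr_ge0.
(* a primitive on the half-line where [`|x|] is [- s * x] *)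
pose F s x := expR (s * de * x) * (eta * sin (eta * x) + s * de * cos (eta * x)) / D.
have DF s (x : R) : s ^+ 2 = 1 -> is_derive x 1 (F s) (expR (s * de * x) * cos (eta * x)).
  move=> s2; have [dc [ds _]] := is_derive_trig eta x; have [_ [_ dx]] := is_derive_trig (s * de) x.
  have := isDM (isDM dx (isDD (isDM (@isD_cst R R eta x 1) ds)
    (isDM (@isD_cst R R (s * de) x 1) dc))) (@isD_cst R R D^-1 x 1).
  apply: isD_ext => //.
  have -> : expR (s * de * x) * cos (eta * x) = D^-1 * (D * (expR (s * de * x) * cos (eta * x))).
    by rewrite mulKf.
  rewrite /D; move: (expR _) (cos _) (sin _) D^-1 => E C S V.
  rewrite (_ : de ^+ 2 = s ^+ 2 * de ^+ 2); last by rewrite s2 mul1r.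
  by ring.
have cF s : continuous (fun x => expR (s * de * x) * cos (eta * x)).
  move=> x; have [dc _] := is_derive_trig eta x; have [_ [_ dx]] := is_derive_trig (s * de) x.
  apply/differentiable_continuous/derivable1_diffP.
  by have [] := isDM dx dc.
have mf : measurable_fun setT f.
  apply: measurable_funM; last exact: expabs_meas.
  apply: continuous_measurable_fun => x; apply: continuous_comp; last exact: continuous_cos.
  by apply: cvgM; [exact: cvg_id|exact: cvg_cst].
have If : integr mu f.
  apply: (integr_le mf (integr_expabs d0)) => x; rewrite normrM ler_piMl// ler_norml.
  by rewrite cos_geN1 cos_le1.
have half (N : nat) : \int[mu]_(x in `[- N.+1%:R, N.+1%:R]) f x =
    2 * de / D + 2 * F (-1) N.+1%:R.
  have N0 : 0 < N.+1%:R :> R by rewrite ltr0n.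
  have mI (a b : R) (b0 b1 : bool) : measurable [set` Interval (BSide b0 a) (BSide b1 b)].
    exact: measurable_itv.
  have sub (a b : R) (b0 b1 : bool) : integr mu f ->
      mu.-integrable [set` Interval (BSide b0 a) (BSide b1 b)] (EFin \o f).
    by move=> H; apply: integrableS H.
  have -> : `[- N.+1%:R, N.+1%:R : R]%classic = `[- N.+1%:R, 0]%classic `|` `]0, N.+1%:R]%classic.
    apply/seteqP; split => x /=; rewrite !in_itv/=.
      move=> /andP[h1 h2]; have [x0|x0] := leP x 0; [left|right]; rewrite ?h1 ?h2//.
    move=> [|] /andP[h1 h2]; apply/andP; split; lra.
  rewrite Rintegral_setU//; last 2 first.
  - by apply: integrableS If => //; exact: measurableU.
  - apply/disj_setPS => x [] /=; rewrite !in_itv/= => /andP[_ x0] /andP[x1 _].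
    by have := le_lt_trans x0 x1; rewrite ltxx.
  rewrite Rintegral_itv_obnd_cbnd; last first.
    exact: sub.
  rewrite (@eq_Rintegral _ _ _ mu _ (fun x => expR (1 * de * x) * cos (eta * x)) f); last first.
    move=> x /set_mem /=; rewrite in_itv/= => /andP[_ x0].
    by rewrite /f /expabs ler0_norm// mulrN opprK mul1r mulrC [x * _]mulrC.
  rewrite (@eq_Rintegral _ _ _ mu `[0, N.+1%:R]%classic (fun x => expR (-1 * de * x) * cos (eta * x)) f); last first.
    move=> x /set_mem /=; rewrite in_itv/= => /andP[x0 _].
    by rewrite /f /expabs ger0_norm// mulN1r mulNr mulrC [x * _]mulrC.
  have N1 : - N.+1%:R < 0 :> R by rewrite oppr_lt0.
  have s1 : 1 ^+ 2 = 1 :> R by rewrite expr1n.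
  have s2 : (-1) ^+ 2 = 1 :> R by rewrite sqrrN expr1n.
  rewrite (FTC N1 (fun x => DF 1 x s1) (cF 1)) (FTC N0 (fun x => DF (-1) x s2) (cF (-1))).
  rewrite /F !mulr0 sin0 cos0 expR0 !mulr0 !add0r !mul1r !mulr1 !mulN1r !mulrN sinN cosN.
  by rewrite !mulNr; field.
have E0 : expR (- (de * N.+1%:R)) @[N --> \oo] --> (0 : R).
  have h : de * N.+1%:R @[N --> \oo] --> +oo.
    apply/cvgryPge => A; near=> N; rewrite mulrC -ler_pdivrMr// (@le_trans _ _ N%:R) ?ler_nat//.
    by near: N; exact: nbhs_infty_ger.
  exact: (cvg_comp _ _ h (@cvgr_expR R)).
have L1 : 2 * de / D + 2 * F (-1) N.+1%:R @[N --> \oo] --> 2 * de / D.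
  rewrite -[X in _ --> X]addr0 -[X in _ --> _ + X](mulr0 2).
  apply: cvgD; first exact: cvg_cst.
  apply: cvgM; first exact: cvg_cst.
  have E1 : expR (- (de * N.+1%:R)) * ((`|eta| + de) / D) @[N --> \oo] --> (0 : R).
    by rewrite -[X in _ --> X](mul0r ((`|eta| + de) / D)); apply: cvgM => //; exact: cvg_cst.
  apply: norm_cvg0; apply: (squeeze_cvgr _ (@cvg_cst _ _ _ _ _) E1).
  apply: nearW => N; rewrite normr_ge0 /= /F mulN1r mulNr !normrM (ger0_norm (expR_ge0 _)).
  have D1 : 0 <= D^-1 by rewrite invr_ge0 addr_ge0 ?sqr_ge0.
  rewrite (ger0_norm D1) -mulrA ler_wpM2l ?expR_ge0// ler_wpM2r//.
  apply: (le_trans (ler_normD _ _)); rewrite !normrM normrN (ger0_norm (ltW d0)).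
  have := sin_max (eta * N.+1%:R); have := cos_max (eta * N.+1%:R) => h1 h2.
  by apply: lerD; rewrite ler_piMr// ltW.
have mI (N : nat) : measurable_fun setT (\1_(`[- N.+1%:R, N.+1%:R]) : R -> R).
  by apply: measurable_indic; exact: measurable_itv.
have [||||_ H] := @cvg_integr _ (measurableTypeR R) R mu (fun N x => f x * \1_(`[- N.+1%:R, N.+1%:R]) x) f
   (fun x => `|f x|) _ _ (integrable_norm If).
- by move=> N; exact: measurable_funM.
- exact: mf.
- move=> N x; rewrite normrM indicE; case: (_ \in _); rewrite ?normr1 ?normr0 ?mulr1 ?mulr0//.
- apply: aeW => x; apply: cvg_near_cst; near=> N.
  rewrite indicE mem_set ?mulr1//= in_itv/= -ler_norml (@le_trans _ _ N%:R) ?ler_nat//.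
  by near: N; exact: nbhs_infty_ger.
suff E : (fun N => \int[mu]_x (f x * \1_(`[- N.+1%:R, N.+1%:R]) x)) =
    fun N => 2 * de / D + 2 * F (-1) N.+1%:R.
  by rewrite E in H; exact: (cvg_unique _ H L1).
apply/funext => N; rewrite -half [RHS]Rintegral_mkcond; apply: eq_Rintegral => x _.
by rewrite indicE /patch; case: ifP => _; rewrite ?mulr1 ?mulr0.
Unshelve. all: by end_near. Qed.

(** The integrand is odd. *)
Lemma poisson_sin de eta : 0 < de ->
  \int[mu]_x (sin (x * eta) * expabs de x) = 0.
Proof.
move=> d0; set f := fun x => _.
have fN x : f (- x) = - f x by rewrite /f /expabs normrN mulNr sinN mulNr.
have mf : measurable_fun setT f.
  apply: measurable_funM; last exact: expabs_meas.
  apply: continuous_measurable_fun => x; apply: continuous_comp; last exact: continuous_sin.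
  by apply: cvgM; [exact: cvg_id|exact: cvg_cst].
pose p x := Num.max (f x) 0; have mp : measurable_fun setT (EFin \o p).
  by apply/measurable_EFinP; exact: measurable_maxr.
have If : integr mu f.
  apply: (integr_le mf (integr_expabs d0)) => x; rewrite normrM ler_piMl// ler_norml.
  by rewrite sin_geN1 sin_le1.
have Ip : integr mu p.
  apply: (integr_le _ If); first exact: measurable_maxr.
  by move=> x; rewrite /p; have [h|h] := leP (f x) 0; rewrite ?normr0.
have Iq : integr mu (fun x => p (- x)).
  apply: (integr_le _ If).
    apply: measurable_maxr => //; rewrite (_ : (fun x => f (- x)) = fun x => - f x).
      exact: measurableT_comp.
    by apply/funext => x.
  by move=> x; rewrite /p fN; have [h|h] := leP (- f x) 0; rewrite ?normr0 ?normrN.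
have -> : \int[mu]_x f x = \int[mu]_x p x - \int[mu]_x p (- x).
  rewrite -intB//; apply: eq_Rintegral => x _; rewrite /p fN.
  have [h|h] := leP (f x) 0; first by rewrite max_l ?oppr_ge0// sub0r opprK.
  by rewrite max_r ?subr0// oppr_le0 ltW.
apply/eqP; rewrite subr_eq0; apply/eqP; rewrite /Rintegral; congr fine.
have := @int_affine1 (EFin \o p) 0 1 ltr01 mp _; rewrite mul1e => -> /=.
  by apply: eq_integral => x _; rewrite mul1r sub0r.
by move=> x; rewrite lee_fin le_max lexx orbT.
Qed.

End Calculus.

(** * The Hartley transform *)

Section Hartley.
Context {R : realType} {d : space_dim}.
Notation X := (Rd R d).
Implicit Types (a b f g : X -> R) (xi eta : X).

Definition cas (r : R) : R := cos r + sin r.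

(** The Hartley transform, a real and symmetric form of the Fourier transform: see
   [Re_fourier] for the relation between the two. *)
Definition hartley b (x : X) : R := \int[leb]_xi (cas (dotp x xi) * b xi).

Lemma cas_le2 r : `|cas r| <= 2.
Proof.
rewrite /cas (le_trans (ler_normD _ _))// (_ : 2 = 1 + 1 :> R)//.
by rewrite lerD ?cos_max ?sin_max.
Qed.

Lemma measurable_comp_cont (phi : R -> R) d' (Y : measurableType d') (f : Y -> R) :
  continuous phi -> measurable_fun setT f -> measurable_fun setT (fun y => phi (f y)).
Proof. by move=> /continuous_measurable_fun cphi mf; exact: measurableT_comp cphi mf. Qed.

Lemma continuous_cas : continuous cas.
Proof. by move=> r; apply: cvgD; [exact: continuous_cos|exact: continuous_sin]. Qed.

Lemma dotp_meas : measurable_fun setT (fun w : X * X => dotp w.1 w.2).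
Proof.
case: d => /=; first exact: measurable_funM.
by apply: measurable_funD; apply: measurable_funM; exact: measurableT_comp.
Qed.

Lemma cas_meas : measurable_fun setT (fun w : X * X => cas (dotp w.1 w.2)).
Proof. exact: (measurable_comp_cont continuous_cas dotp_meas). Qed.

Lemma cas_meas1 (x : X) : measurable_fun setT (fun xi => cas (dotp x xi)).
Proof. exact: (measurable_sect1 x cas_meas). Qed.

Lemma dotpC (x : X) xi : dotp x xi = dotp xi x.
Proof.
by case: d x xi => x xi /=; [exact: mulrC|congr (_ + _); exact: mulrC].
Qed.

(** An integrable weight that increases to [1] as [de] decreases to [0], and whose
   transform is explicit. *)
Definition gate (de : R) (x : X) : R :=
  match d as d0 return Rd R d0 -> R with
  | Dim1 => fun u => expabs de u
  | Dim2 => fun u => expabs de u.1 * expabs de u.2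
  end x.

Lemma gate_meas de : measurable_fun setT (gate de).
Proof.
rewrite /gate; case: d => /=; first exact: expabs_meas.
by apply: measurable_tensor; exact: expabs_meas.
Qed.

Lemma integr_gate de : 0 < de -> integr leb (gate de).
Proof.
move=> d0; rewrite /gate; case: d => /=; first exact: integr_expabs.
exact: (integr_tensor (integr_expabs d0) (integr_expabs d0)).
Qed.

Lemma gate_bound de (x : X) : 0 < de -> 0 <= gate de x <= 1.
Proof.
move=> d0; rewrite /gate; case: d x => x /=; first by rewrite expabs_ge0 expabs_le1.
by rewrite mulr_ge0 ?mulr_ile1 ?expabs_ge0 ?expabs_le1.
Qed.

Lemma gate_inv de (x : X) : gate de x * gate (- de) x = 1.
Proof.
have H (u : R) : expabs de u * expabs (- de) u = 1.
  by rewrite /expabs -expRD mulNr opprK addNr expR0.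
rewrite /gate; case: d x => x /=; first exact: H.
by rewrite mulrACA !H mulr1.
Qed.

Lemma fubini_leb f g (k : X * X -> R) (M : R) : integr leb f -> integr leb g ->
  measurable_fun setT k -> (forall w, `|k w| <= M) ->
  [/\ integr leb (fun x => f x * \int[leb]_y (k (x, y) * g y)),
      integr leb (fun y => g y * \int[leb]_x (k (x, y) * f x)) &
      \int[leb]_x (f x * \int[leb]_y (k (x, y) * g y)) =
      \int[leb]_y (g y * \int[leb]_x (k (x, y) * f x))].
Proof. by rewrite -lebsE; exact: fubini_kernel. Qed.

Lemma hartley_meas b : integr leb b -> measurable_fun setT (hartley b).
Proof.
move=> Ib.
(* Fubini's theorem applies after multiplication by an integrable weight,
   and the weight is then divided out *)
have [H _ _] := fubini_leb (integr_gate ltr01) Ib cas_meas (fun w => cas_le2 _).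
rewrite (_ : hartley b = fun x => (gate 1 x * hartley b x) * gate (-1) x).
  by apply: measurable_funM; [exact: integr_meas H|exact: gate_meas].
by apply/funext => x; rewrite mulrAC gate_inv mul1r.
Qed.

Lemma hartley_bound b (x : X) : integr leb b ->
  `|hartley b x| <= 2 * \int[leb]_xi `|b xi|.
Proof.
move=> Ib; have Ik : integr leb (fun xi => cas (dotp x xi) * b xi).
  by under eq_fun do rewrite mulrC; apply: (integr_bound Ib (cas_meas1 x)) => xi; exact: cas_le2.
apply: (le_trans (le_normr_Rintegral measurableT Ik)).
have Ia : integr leb (fun x => `|b x|) by exact: integrable_norm.
rewrite -intZ//; apply: int_le.
- exact: integrable_norm.
- exact: integrZ.
- by move=> xi; rewrite normrM ler_wpM2r// cas_le2.
Qed.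

Lemma hartley_sym a b : integr leb a -> integr leb b ->
  \int[leb]_x (hartley a x * b x) = \int[leb]_x (a x * hartley b x).
Proof.
move=> Ia Ib.
have [_ _ H] := fubini_leb Ib Ia cas_meas (fun w => cas_le2 _).
under eq_Rintegral do rewrite mulrC.
rewrite H; apply: eq_Rintegral => x _; congr (_ * _).
by apply: eq_Rintegral => y _ /=; rewrite dotpC.
Qed.

Definition poisson (de : R) xi eta : R :=
  match d as d0 return Rd R d0 -> Rd R d0 -> R with
  | Dim1 => fun u v => 2 * de / (de ^+ 2 + (u - v) ^+ 2)
  | Dim2 => fun u v => 2 * de / (de ^+ 2 + (u.1 - v.1) ^+ 2) *
                       (2 * de / (de ^+ 2 + (u.2 - v.2) ^+ 2))
  end xi eta.

(** The Poisson kernel of unit width around the origin. *)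
Definition cauchy (z : X) : R :=
  match d as d0 return Rd R d0 -> R with
  | Dim1 => fun u => 2 * (1 + u ^+ 2)^-1
  | Dim2 => fun u => (2 * (1 + u.1 ^+ 2)^-1) * (2 * (1 + u.2 ^+ 2)^-1)
  end z.

Definition jac (c : R) : R := c ^+ (if d is Dim1 then 1 else 2).

(** [cas u * cas v = cos (u - v) + sin (u + v)], and the sine integrates to
   zero against an even function. *)
Lemma gate_transform de xi eta : 0 < de ->
  \int[leb]_x (cas (dotp x eta) * (cas (dotp x xi) * gate de x)) = poisson de xi eta.
Proof.
move=> d0; have cc (u v : R) : cas u * cas v = cos (u - v) + sin (u + v).
  by rewrite /cas cosB sinD; ring.
have bc (c : R) : integr (@lebesgue_measure R) (fun x => cos (x * c) * expabs de x).
  under eq_fun do rewrite mulrC.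
  apply: (integr_bound (integr_expabs d0) (M := 1)).
    by apply: (measurable_comp_cont (@continuous_cos R)); exact: measurable_funM.
  by move=> x; exact: cos_max.
have bs (c : R) : integr (@lebesgue_measure R) (fun x => sin (x * c) * expabs de x).
  under eq_fun do rewrite mulrC.
  apply: (integr_bound (integr_expabs d0) (M := 1)).
    by apply: (measurable_comp_cont (@continuous_sin R)); exact: measurable_funM.
  by move=> x; exact: sin_max.
rewrite /gate /poisson; case: d xi eta => xi eta /=.
  rewrite -poisson_cos// -[RHS]addr0 -(poisson_sin (xi + eta) d0) -intD//.
  apply: eq_Rintegral => x _; have := cc (x * xi) (x * eta).
  by rewrite -mulrBr -mulrDr -mulrDl => <-; ring.
pose C (c u : R) := cos (u * c) * expabs de u; pose S (c u : R) := sin (u * c) * expabs de u.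
have IT (f g : R -> R) : integr lebesgue_measure f -> integr lebesgue_measure g ->
    integr (@leb R Dim2) (fun z => f z.1 * g z.2) by exact: integr_tensor.
have ET (f g : R -> R) : integr lebesgue_measure f -> integr lebesgue_measure g ->
    \int[@leb R Dim2]_z (f z.1 * g z.2) =
    \int[lebesgue_measure]_u f u * \int[lebesgue_measure]_u g u by exact: int_tensor.
set A1 := xi.1 - eta.1; set A2 := xi.2 - eta.2.
pose B1 := xi.1 + eta.1; pose B2 := xi.2 + eta.2.
transitivity (\int[@leb R Dim2]_z ((C A1 z.1 * C A2 z.2 - S A1 z.1 * S A2 z.2) +
    (S B1 z.1 * C B2 z.2 + C B1 z.1 * S B2 z.2))).
  apply: eq_Rintegral => -[u v] _; rewrite /= /C /S mulrA mulrC [X in _ * X]mulrC cc.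
  have -> : u * xi.1 + v * xi.2 - (u * eta.1 + v * eta.2) = u * A1 + v * A2 by rewrite /A1 /A2; ring.
  have -> : u * xi.1 + v * xi.2 + (u * eta.1 + v * eta.2) = u * B1 + v * B2 by rewrite /B1 /B2; ring.
  by rewrite cosD sinD; ring.
have I1 : integr (@leb R Dim2) (fun z => C A1 z.1 * C A2 z.2) := IT _ _ (bc A1) (bc A2).
have I2 : integr (@leb R Dim2) (fun z => S A1 z.1 * S A2 z.2) := IT _ _ (bs A1) (bs A2).
have I3 : integr (@leb R Dim2) (fun z => S B1 z.1 * C B2 z.2) := IT _ _ (bs B1) (bc B2).
have I4 : integr (@leb R Dim2) (fun z => C B1 z.1 * S B2 z.2) := IT _ _ (bc B1) (bs B2).
rewrite (intD (integrB I1 I2) (integrD I3 I4)) (intB I1 I2) (intD I3 I4).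
rewrite (ET _ _ (bc A1) (bc A2)) (ET _ _ (bs A1) (bs A2)) (ET _ _ (bs B1) (bc B2)).
rewrite (ET _ _ (bc B1) (bs B2)) !poisson_sin// !poisson_cos//.
by rewrite !mulr0 mul0r subr0 !addr0.
Qed.

Lemma affine_meas xi c : measurable_fun setT (affine xi c).
Proof.
rewrite /affine; case: d xi => xi /=.
  by apply: measurable_funB => //; exact: measurable_funM.
apply/measurable_fun_pairP; split => /=.
  by apply: measurable_funB => //; apply: measurable_funM => //; exact: measurable_fst.
by apply: measurable_funB => //; apply: measurable_funM => //; exact: measurable_snd.
Qed.

Lemma int_affine (f : X -> \bar R) xi c : 0 < c -> measurable_fun setT f ->
  (forall x, (0 <= f x)%E) ->
  (\int[leb]_x f x = (jac c)%:E * \int[leb]_z f (affine xi c z))%E.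
Proof.
rewrite /jac /affine; case: d f xi => f xi c0 mf f0 /=.
  by rewrite expr1; exact: int_affine1.
have mf' : measurable_fun setT (fun z : Rd R Dim2 => f (xi.1 - c * z.1, xi.2 - c * z.2)).
  apply: (measurableT_comp mf); apply/measurable_fun_pairP; split => /=.
    by apply: measurable_funB => //; apply: measurable_funM => //; exact: measurable_fst.
  by apply: measurable_funB => //; apply: measurable_funM => //; exact: measurable_snd.
rewrite fubini_tonelli1// fubini_tonelli1//.
rewrite (@int_affine1 _ _ xi.1 c c0); last 2 first.
- have := @measurable_fun_fubini_tonelli_F _ _ _ _ R (@lebesgue_measure R) f mf f0; exact.
- by move=> x; apply: integral_ge0.
rewrite expr2 EFinM -muleA; congr (_ * _)%E.
rewrite -ge0_integralZl_EFin//; last 3 first.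
- by move=> x _; apply: integral_ge0.
- have := @measurable_fun_fubini_tonelli_F _ _ _ _ R (@lebesgue_measure R) _ mf' (fun z => f0 _).
  exact.
- exact: ltW.
apply: eq_integral => x _; rewrite /fubini_F /=.
have mfx : measurable_fun setT (fun y : R => f (xi.1 - c * x, y)).
  have := measurableT_comp mf (@measurable_pair1 _ _ (measurableTypeR R) (measurableTypeR R)
    (xi.1 - c * x)); exact.
exact (int_affine1 xi.2 c0 mfx (fun y => f0 _)).
Qed.

Lemma int_affine_real f xi c : 0 < c -> integr leb f ->
  integr leb (fun z => f (affine xi c z)) /\
  \int[leb]_x f x = jac c * \int[leb]_z f (affine xi c z).
Proof.
move=> c0 If; have mf := integr_meas If.
have j0 : 0 < jac c by rewrite /jac exprn_gt0.
have ma := affine_meas xi c.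
have Ic g : integr leb g -> integr leb (fun z => g (affine xi c z)).
  move=> Ig; have mg := integr_meas Ig.
  apply/integrableP; split; first by apply/measurable_EFinP; exact: measurableT_comp.
  move/integrableP : Ig => [_]; rewrite (@int_affine (fun x => `|(g x)%:E|%E) xi c)//; last first.
    by apply/measurable_EFinP; exact: measurableT_comp.
  rewrite /= => H; rewrite ltey; apply/eqP => E.
  by move: H; rewrite E gt0_muley ?lte_fin// ltxx.
split; first exact: Ic.
have E g : integr leb g -> (forall x, 0 <= g x) ->
    \int[leb]_x g x = jac c * \int[leb]_z g (affine xi c z).
  move=> Ig g0; apply: EFin_inj; rewrite EFinM !int_EFin//; last exact: Ic.
  apply: (@int_affine (EFin \o g)) => //.
  by apply/measurable_EFinP; exact: (integr_meas Ig).
pose p x := Num.max (f x) 0; pose q x := Num.max (- f x) 0.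
have Ip : integr leb p.
  apply: (integr_le _ If); first exact: measurable_maxr.
  by move=> x; rewrite /p; have [h|h] := leP (f x) 0; rewrite ?normr0.
have Iq : integr leb q.
  apply: (integr_le _ If).
    by apply: measurable_maxr => //; exact: measurableT_comp.
  by move=> x; rewrite /q; have [h|h] := leP (- f x) 0; rewrite ?normr0 ?normrN.
have fE x : f x = p x - q x.
  rewrite /p /q; have [h|h] := leP (f x) 0.
    by rewrite max_l ?oppr_ge0// sub0r opprK.
  by rewrite max_r ?subr0// oppr_le0 ltW.
under eq_Rintegral do rewrite fE.
under [in RHS]eq_Rintegral do rewrite fE.
rewrite intB// intB; try exact: Ic.
by rewrite mulrBr (E p)// ?(E q)// => x; rewrite le_max lexx orbT.
Qed.

Lemma poisson_affine de xi (z : X) : 0 < de ->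
  jac de * poisson de xi (affine xi de z) = cauchy z.
Proof.
move=> d0; have H (u v : R) : de * (2 * de / (de ^+ 2 + (u - (u - de * v)) ^+ 2)) =
    2 * (1 + v ^+ 2)^-1.
  have v0 : 1 + v ^+ 2 != 0 by rewrite gt_eqF// ltr_pwDl ?sqr_ge0.
  rewrite (_ : de ^+ 2 + _ = de ^+ 2 * (1 + v ^+ 2)); last by ring.
  by field; rewrite v0 gt_eqF.
rewrite /jac /poisson /affine /cauchy; case: d xi z => xi z /=.
  by rewrite expr1.
by rewrite expr2 mulrACA !H.
Qed.

Lemma integr_cauchy : integr leb cauchy.
Proof.
rewrite /cauchy; case: d; first exact: (integrZ _ integr_oneDsqr).
exact: (integr_tensor (integrZ _ integr_oneDsqr) (integrZ _ integr_oneDsqr)).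
Qed.

Lemma cauchy_gt0 (z : X) : 0 < cauchy z.
Proof.
have H (u : R) : 0 < 2 * (1 + u ^+ 2)^-1 by rewrite mulr_gt0 ?invr_gt0 ?ltr_pwDl ?sqr_ge0.
by rewrite /cauchy; case: d z => z /=; [exact: H|apply: mulr_gt0; exact: H].
Qed.

(** The constant [(2 * pi) ^ d] in the Plancherel formula. *)
Definition kappa : R := \int[leb]_z cauchy z.

Lemma poisson_bounded de xi : 0 < de ->
  exists M, measurable_fun setT (poisson de xi) /\ forall eta, `|poisson de xi eta| <= M.
Proof.
move=> d0; have P (u v : R) : 0 < de ^+ 2 + (u - v) ^+ 2.
  by rewrite ltr_pwDl ?exprn_gt0 ?sqr_ge0.
have B (u v : R) : `|2 * de / (de ^+ 2 + (u - v) ^+ 2)| <= 2 / de.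
  have q0 : 0 <= 2 * de / (de ^+ 2 + (u - v) ^+ 2).
    by apply: divr_ge0; [apply: mulr_ge0 => //; exact: ltW|exact: ltW].
  rewrite (ger0_norm q0) ler_pdivrMr// mulrAC ler_pdivlMr//.
  by rewrite -mulrA ler_wpM2l// -expr2 lerDl sqr_ge0.
have C (u : R) : measurable_fun setT (fun v : R => 2 * de / (de ^+ 2 + (u - v) ^+ 2)).
  apply: continuous_measurable_fun => v; apply: cvgM; first exact: cvg_cst.
  apply: cvgV; first by rewrite gt_eqF.
  apply: cvgD; first exact: cvg_cst.
  apply: (@cvg_comp _ _ _ (fun v => u - v) (fun w => w ^+ 2) _ (nbhs (u - v))).
    by apply: cvgB; [exact: cvg_cst|exact: cvg_id].
  exact: exprn_continuous.
rewrite /poisson; case: d xi => xi /=; first by exists (2 / de); split; [exact: C|exact: B].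
exists (2 / de * (2 / de)); split; first exact: (measurable_tensor (C xi.1) (C xi.2)).
by move=> eta; rewrite normrM ler_pM.
Qed.

Lemma poisson_average a xi de : real_test a -> 0 < de ->
  \int[leb]_eta (a eta * poisson de xi eta) = \int[leb]_z (cauchy z * a (affine xi de z)).
Proof.
move=> Ta d0; have [Ia _] := rt_L2 Ta; have [M [mM bM]] := poisson_bounded xi d0.
have Iap := integr_bound Ia mM bM.
have [Iap' ->] := int_affine_real xi d0 Iap; rewrite -intZ//.
by apply: eq_Rintegral => z _; rewrite mulrCA poisson_affine// mulrC.
Qed.

(** After rescaling the kernel is fixed, and the test is evaluated closer and closer
   to [xi]. *)
Lemma poisson_limit a xi : real_test a ->
  \int[leb]_eta (a eta * poisson n.+1%:R^-1 xi eta) @[n --> \oo] --> kappa * a xi.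
Proof.
move=> Ta; have [M M0 aM] := rt_bound Ta; have ma := rt_meas Ta.
have n0 (n : nat) : 0 < n.+1%:R^-1 :> R by rewrite invr_gt0.
under eq_cvg do rewrite poisson_average//.
have -> : kappa * a xi = \int[leb]_z (cauchy z * a xi).
  under [RHS]eq_Rintegral do rewrite mulrC.
  by rewrite intZ 1?mulrC//; exact: integr_cauchy.
have mc := integr_meas integr_cauchy.
apply: (@cvg_integr _ _ _ leb (fun n z => cauchy z * a (affine xi n.+1%:R^-1 z)) _
  (fun z => M * cauchy z) _ _ _ _ _).2.
- by move=> n; apply: measurable_funM => //; apply: measurableT_comp => //; exact: affine_meas.
- exact: measurable_funM.
- by apply: integrZ; exact: integr_cauchy.
- move=> n z; rewrite normrM (gtr0_norm (cauchy_gt0 z)) mulrC.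
  by rewrite ler_wpM2r ?aM// ltW// cauchy_gt0.
- by apply: aeW => z; apply: cvgM; [exact: cvg_cst|exact: rt_affine].
Qed.

Lemma gate_mono (x : X) : {homo (fun n : nat => gate n.+1%:R^-1 x) : m n / (m <= n)%N >-> m <= n}.
Proof.
have H (u : R) : {homo (fun n : nat => expabs n.+1%:R^-1 u) : m n / (m <= n)%N >-> m <= n}.
  move=> m n mn; rewrite ler_expR lerN2 ler_wpM2r//.
  by rewrite lef_pV2 ?posrE ?ltr0n// ler_nat.
rewrite /gate; case: d x => x m n mn /=; first exact: H.
by apply: ler_pM; rewrite ?expabs_ge0//; exact: H.
Qed.

Lemma gate_cvg (x : X) : gate n.+1%:R^-1 x @[n --> \oo] --> (1 : R).
Proof.
have H (u : R) : expabs n.+1%:R^-1 u @[n --> \oo] --> (1 : R).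
  have h : - (n.+1%:R^-1 * `|u|) @[n --> \oo] --> (0 : R).
    rewrite -oppr0 -[X in - X](mul0r `|u|); apply: cvgN.
    by apply: cvgM; [exact: cvg_harmonic|exact: cvg_cst].
  by rewrite -[X in _ --> X]expR0; exact: (cvg_comp _ _ h (@continuous_expR R 0)).
rewrite /gate; case: d x => x; first exact: H.
by rewrite -[X in _ --> X](mulr1 1); apply: cvgM; exact: H.
Qed.

(** Weighted by [gate], the integral of the square of [hartley a] is the pairing of [a]
   with its own Poisson average, by symmetry of the transform. When the weight increases
   to [1], the first integral converges by monotonicity, and the second one by domination. *)
Theorem plancherel a : real_test a ->
  L2 leb (hartley a) /\ ip leb (hartley a) (hartley a) = kappa * ip leb a a.
Proof.
move=> Ta; have [Ia La] := rt_L2 Ta; have [M M0 aM] := rt_bound Ta.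
have mH := hartley_meas Ia.
pose de (n : nat) : R := n.+1%:R^-1.
have d0 n : 0 < de n by rewrite invr_gt0.
have IE n : integr leb (fun x => gate (de n) x * hartley a x).
  apply: (integr_bound (integr_gate (d0 n)) mH) => x; exact: hartley_bound.
have Q n xi : hartley (fun x => gate (de n) x * hartley a x) xi =
    \int[leb]_eta (a eta * poisson (de n) xi eta).
  have Ig : integr leb (fun x => gate (de n) x * cas (dotp x xi)).
    apply: (integr_bound (integr_gate (d0 n))); last by move=> x; exact: cas_le2.
    exact: (measurable_sect2 xi cas_meas).
  transitivity (\int[leb]_x (hartley a x * (gate (de n) x * cas (dotp x xi)))).
    by apply: eq_Rintegral => x _; rewrite dotpC; ring.
  rewrite (hartley_sym Ia Ig); apply: eq_Rintegral => eta _; congr (_ * _).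
  rewrite -gate_transform//; apply: eq_Rintegral => x _.
  by rewrite [dotp eta x]dotpC; ring.
have step n : \int[leb]_x (hartley a x ^+ 2 * gate (de n) x) =
    \int[leb]_xi (a xi * \int[leb]_eta (a eta * poisson (de n) xi eta)).
  under [RHS]eq_Rintegral do rewrite -Q.
  by rewrite -(hartley_sym Ia (IE n)); apply: eq_Rintegral => x _; ring.
have L1 : \int[leb]_x (hartley a x ^+ 2 * gate (de n) x) @[n --> \oo] --> kappa * ip leb a a.
  under eq_cvg do rewrite step.
  have -> : kappa * ip leb a a = \int[leb]_xi (a xi * (kappa * a xi)).
    by rewrite /ip -intZ; [apply: eq_Rintegral => x _; ring|exact: L2M].
  apply: (@cvg_integr _ _ _ leb
    (fun n xi => a xi * \int[leb]_eta (a eta * poisson (de n) xi eta)) _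
    (fun xi => (M * kappa) * `|a xi|) _ _ _ _ _).2.
  - move=> n; under eq_fun do rewrite -Q.
    by apply: measurable_funM; [exact: rt_meas|exact: hartley_meas].
  - by apply: measurable_funM; [exact: rt_meas|apply: measurable_funM => //; exact: rt_meas].
  - by apply: integrZ; exact: integrable_norm.
  - move=> n xi; rewrite normrM mulrC ler_wpM2r// poisson_average//.
    have mc := integr_meas integr_cauchy.
    have Ic : integr leb (fun z => cauchy z * a (affine xi (de n) z)).
      apply: (integr_bound integr_cauchy (M := M)); last by move=> z; exact: aM.
      by apply: measurableT_comp (affine_meas _ _); exact: rt_meas.
    apply: (le_trans (le_normr_Rintegral measurableT Ic)).
    rewrite /kappa -intZ; last exact: integr_cauchy.
    apply: int_le; [exact: integrable_norm|apply: integrZ; exact: integr_cauchy|] => z.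
    by rewrite normrM (gtr0_norm (cauchy_gt0 z)) mulrC ler_wpM2r// ltW// cauchy_gt0.
  - by apply: aeW => xi; apply: cvgM; [exact: cvg_cst|exact: poisson_limit].
have mg n : measurable_fun setT (fun x => hartley a x ^+ 2 * gate (de n) x).
  by apply: measurable_funM; [exact: measurable_funX|exact: gate_meas].
have Ign n : integr leb (fun x => hartley a x ^+ 2 * gate (de n) x).
  rewrite (_ : (fun x => _) = fun x => (gate (de n) x * hartley a x) * hartley a x).
    apply: (integr_bound (IE n) mH) => x; exact: hartley_bound.
  by apply/funext => x; ring.
have g0 n x : 0 <= hartley a x ^+ 2 * gate (de n) x.
  by rewrite mulr_ge0 ?sqr_ge0//; have /andP[] := gate_bound x (d0 n).
have L2' : (\int[leb]_x (hartley a x ^+ 2 * gate (de n) x)%:E @[n --> \oo] -->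
    \int[leb]_x limn (fun n => (hartley a x ^+ 2 * gate (de n) x)%:E))%E.
  apply: cvg_monotone_convergence => //.
  - by move=> n; apply/measurable_EFinP.
  - by move=> n x _; rewrite lee_fin.
  - by move=> x _ m n mn; rewrite lee_fin ler_wpM2l ?sqr_ge0//; exact: gate_mono.
have lE x : limn (fun n => (hartley a x ^+ 2 * gate (de n) x)%:E) = (hartley a x ^+ 2)%:E.
  apply/cvg_lim => //; apply: cvg_EFin; first exact: nearW.
  rewrite -[X in _ --> X]mulr1; apply: cvgM; first exact: cvg_cst.
  exact: gate_cvg.
have L3 : (\int[leb]_x (hartley a x ^+ 2 * gate (de n) x)%:E @[n --> \oo] -->
    \int[leb]_x (hartley a x ^+ 2)%:E)%E.
  by rewrite -(eq_integral _ _ (fun x _ => lE x)).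
have E : (\int[leb]_x (hartley a x ^+ 2)%:E = (kappa * ip leb a a)%:E)%E.
  have L4 : (\int[leb]_x (hartley a x ^+ 2 * gate (de n) x)%:E @[n --> \oo] -->
      (kappa * ip leb a a)%:E)%E.
    rewrite (_ : (fun n => _) = fun n => (\int[leb]_x (hartley a x ^+ 2 * gate (de n) x))%:E).
      by apply: cvg_EFin; [exact: nearW|exact: L1].
    by apply/funext => n; rewrite int_EFin.
  exact: (cvg_unique _ L3 L4).
have IH : integr leb (fun x => hartley a x ^+ 2).
  apply/integrableP; split; first by apply/measurable_EFinP; exact: measurable_funX.
  by under eq_integral do rewrite gee0_abs ?lee_fin ?sqr_ge0//; rewrite E ltry.
split => //; rewrite /ip /Rintegral.
by under eq_integral do rewrite -expr2; rewrite E.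
Qed.

Lemma kappa_gt0 : 0 < kappa.
Proof.
have p0 : 0 < 2 * (pi : R) by rewrite pmulr_rgt0 ?pi_gt0 ?ltr0n.
have I0 := @integr_oneDsqr R; have I1 := integrZ 2 I0.
have K1 : \int[@lebesgue_measure R]_u (2 * (1 + u ^+ 2)^-1) = 2 * pi.
  by rewrite (intZ 2 I0); congr (_ * _); rewrite /Rintegral int_oneDsqr.
rewrite /kappa /cauchy; case: d => /=; first by rewrite K1.
by rewrite (int_tensor I1 I1) K1 mulr_gt0.
Qed.

Lemma nrm_hartley a : real_test a -> nrm leb (hartley a) = Num.sqrt kappa * nrm leb a.
Proof. by move=> /plancherel[_]; rewrite /nrm => ->; rewrite sqrtrM// ltW// kappa_gt0. Qed.

(** The transform is symmetric, and isometric up to [kappa]: hence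
   [|H a - c|^2 = kappa * |a - H c / kappa|^2], and [H a] is close to [c] as soon as [a] is
   close to [H c / kappa]. *)
Theorem hartley_dense f : L2 leb f -> forall e, 0 < e ->
  exists2 a, away a & nrm leb (fun x => f x - hartley a x) <= e.
Proof.
move=> Lf e e0; have e2 : 0 < e / 2 by rewrite divr_gt0.
have k0 := kappa_gt0; have sk0 : 0 < Num.sqrt kappa by rewrite sqrtr_gt0.
have [c /away_rt Tc fc] := dense_away Lf e2.
have [Ic Lc] := rt_L2 Tc; have [LHc Hc] := plancherel Tc.
have Lb : L2 leb (fun x => kappa^-1 * hartley c x) by exact: L2Z.
have [a Aa ba] := dense_away Lb (divr_gt0 e2 sk0).
have Ta := away_rt Aa; have [Ia La] := rt_L2 Ta; have [LHa Ha] := plancherel Ta.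
exists a => //.
rewrite (_ : (fun x => _) = fun x => (f x - c x) + (c x - hartley a x)); last first.
  by apply/funext => x; rewrite addrA subrK.
apply: (le_trans (nrmD (L2B Lf Lc) (L2B Lc LHa))); rewrite [leRHS]splitr lerD//.
move: ba; rewrite ler_pdivlMr// mulrC; apply: le_trans.
rewrite /nrm -(sqrtrM _ (ltW k0)); apply: ler_wsqrtr.
have sym : ip leb (hartley c) a = ip leb (hartley a) c.
  by rewrite ipC /ip hartley_sym.
rewrite (ipBB Lc LHa) (ipBB Lb La) (ipZl _ LHc Lb) (ipZr _ LHc LHc) (ipZl _ LHc La).
rewrite Hc Ha sym [ip leb c (hartley a)]ipC.
rewrite le_eqVlt; apply/orP; left; apply/eqP; field.
by rewrite gt_eqF.
Qed.

End Hartley.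

(** * The symbols of the system *)

Section Symbols.
Context {R : realType}.
Variable mu : R.
Hypothesis mu_gt0 : 0 < mu.

Let k := Num.sqrt mu.

Let k_gt0 : 0 < k. Proof. by rewrite sqrtr_gt0. Qed.

(** The symbols are functions of [q], the square of the length of the frequency. *)
Definition symP (q : R) : R := Num.sqrt q / Num.sqrt (1 + k * Num.sqrt q).

Definition symG (q : R) : R := k * Num.sqrt q * tanh (k * Num.sqrt q).

(** The pulsation: its square is the symbol of the operator that governs [zeta]. *)
Definition symO (q : R) : R := Num.sqrt (symG q / mu).

Lemma tanhE (r : R) : tanh r = (expR r - expR (- r)) / (expR r + expR (- r)).
Proof. by []. Qed.

Lemma tanh_den (r : R) : 0 < expR r + expR (- r).
Proof. by rewrite addr_gt0 ?expR_gt0. Qed.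

Lemma tanh_gt0 (r : R) : 0 < r -> 0 < tanh r.
Proof.
by move=> r0; rewrite tanhE divr_gt0 ?tanh_den// subr_gt0 ltr_expR; lra.
Qed.

Lemma Sn_tanh n : Sn setT n (tanh : R -> R).
Proof.
have Se : Sn setT n (@expR R) by exact: Sn_expR.
have SN : Sn setT n (fun r : R => expR (-1 * r)).
  apply: (Sn_comp Se) => //; apply: SnM; [exact: Sn_cst|exact: Sn_id].
rewrite (_ : tanh = fun r : R => (expR r + -1 * expR (-1 * r)) * (expR r + expR (-1 * r))^-1).
  apply: SnM; first by apply: SnD => //; apply: SnM => //; exact: Sn_cst.
  apply: (Sn_comp (Sn_invp n)); first exact: SnD.
  by move=> r _; rewrite mulN1r; exact: tanh_den.
by apply/funext => r; rewrite tanhE !mulN1r.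
Qed.

Lemma is_derive_tanh (r : R) : is_derive r 1 (tanh : R -> R) (4 / (expR r + expR (- r)) ^+ 2).
Proof.
have D0 : expR r + expR (- r) != 0 by rewrite gt_eqF ?tanh_den.
have dN : is_derive r 1 (fun r : R => expR (- r)) (- expR (- r)).
  have := isD_comp (is_deriveNid r 1) (is_derive_expR (- r)).
  by apply: isD_ext => //; rewrite mulrN1.
have d1 := isDD (is_derive_expR r) (isDM (@isD_cst R R (-1) r 1) dN).
have d2 := isD_comp (isDD (is_derive_expR r) dN) (isD_inv D0).
have := isDM d1 d2; apply: isD_ext => [y|]; first by rewrite /= mulN1r.
have := expRxMexpNx_1 r; move: (expR r) (expR (- r)) D0 => E F D0 EF.
have -> : 4 = 4 * (E * F) by rewrite EF mulr1.
by field.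
Qed.

Lemma symG_gt0 q : 0 < q -> 0 < symG q.
Proof.
by move=> q0; rewrite /symG mulr_gt0 ?tanh_gt0 ?mulr_gt0 ?sqrtr_gt0.
Qed.

Lemma symP_gt0 q : 0 < q -> 0 < symP q.
Proof.
move=> q0; rewrite /symP divr_gt0 ?sqrtr_gt0// ltr_wpDr// mulr_ge0 ?sqrtr_ge0//.
Qed.

Lemma symO_gt0 q : 0 < q -> 0 < symO q.
Proof. by move=> q0; rewrite sqrtr_gt0 divr_gt0 ?symG_gt0. Qed.

Lemma symO_sqr q : 0 < q -> symO q ^+ 2 = symG q / mu.
Proof. by move=> q0; rewrite sqr_sqrtr// ltW// divr_gt0 ?symG_gt0. Qed.

Lemma Sn_div n F G : Sn Rgt0 n F -> Sn Rgt0 n G -> (forall q, 0 < q -> 0 < G q) ->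
  Sn Rgt0 n (fun q : R => F q / G q).
Proof.
by move=> SF SG G0; apply: SnM => //; apply: (Sn_comp (Sn_invp n) SG) => q; exact: G0.
Qed.

Let Sn_kr n : Sn Rgt0 n (fun q : R => k * Num.sqrt q).
Proof. by apply: SnM; [exact: Sn_cst|exact: Sn_sqrt]. Qed.

Lemma Sn_symP n : Sn Rgt0 n symP.
Proof.
apply: Sn_div; first exact: Sn_sqrt.
  apply: (Sn_comp (Sn_sqrt n)); first by apply: SnD => //; exact: Sn_cst.
  by move=> q q0; rewrite /Rgt0/= ltr_wpDr// mulr_ge0 ?sqrtr_ge0.
by move=> q q0; rewrite sqrtr_gt0 ltr_wpDr// mulr_ge0 ?sqrtr_ge0.
Qed.

Lemma Sn_symG n : Sn Rgt0 n symG.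
Proof. by apply: SnM => //; apply: (Sn_comp (Sn_tanh n)). Qed.

Lemma Sn_symO n : Sn Rgt0 n symO.
Proof.
apply: (Sn_comp (Sn_sqrt n)).
  by apply: SnM; [exact: Sn_symG|exact: Sn_cst].
by move=> q q0; rewrite /Rgt0/= divr_gt0 ?symG_gt0.
Qed.

(** The square of the pulsation is [r * tanh r / mu] at [r = k * sqrt q], a product of
   increasing functions: the phase is stationary nowhere on the half-line. *)
Lemma symO_derive : exists O' : R -> R, (forall q : R, 0 < q -> is_derive q 1 symO (O' q)) /\
  (forall q, 0 < q -> 0 < O' q).
Proof.
pose h' (r : R) := r * (4 / (expR r + expR (- r)) ^+ 2) + tanh r * 1.
have h'_gt0 r : 0 < r -> 0 < h' r.
  move=> r0; rewrite /h' mulr1; apply: addr_gt0; last exact: tanh_gt0.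
  by apply: mulr_gt0 => //; apply: divr_gt0 => //; rewrite exprn_gt0 ?tanh_den.
have dh (r : R) : is_derive r 1 (fun r => r * tanh r) (h' r).
  exact: (isDM (is_derive_id r 1) (is_derive_tanh r)).
have dk (q : R) : 0 < q -> is_derive q 1 (fun q => k * Num.sqrt q)
    (k * (2 * Num.sqrt q)^-1 + Num.sqrt q * 0).
  by move=> q0; apply: (isDM (@isD_cst R R k q 1)); exact: is_derive1_sqrt.
exists (fun q => (2 * Num.sqrt (symG q / mu))^-1 * (symG q * 0 + mu^-1 *
  (h' (k * Num.sqrt q) * (k * (2 * Num.sqrt q)^-1 + Num.sqrt q * 0)))); split => q q0.
  have d1 := isDM (isD_comp (dk q q0) (dh (k * Num.sqrt q))) (@isD_cst R R mu^-1 q 1).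
  have Gq : 0 < symG q / mu by rewrite divr_gt0 ?symG_gt0.
  exact: (isD_comp d1 (is_derive1_sqrt Gq)).
have s0 : 0 < Num.sqrt q by rewrite sqrtr_gt0.
rewrite !mulr0 add0r addr0 mulr_gt0// ?invr_gt0 ?mulr_gt0 ?sqrtr_gt0 ?divr_gt0 ?symG_gt0//.
- by rewrite invr_gt0.
- by rewrite h'_gt0// mulr_gt0.
- by rewrite invr_gt0 mulr_gt0.
Qed.

(** The quotient of [symO] by [symP] lies between two positive constants. With
   [r = k * sqrt q], this says [r <= (1 + r) * tanh r <= 3 * r], and follows from
   [r / (1 + r) <= tanh r], [tanh r <= 1] and [tanh r <= 2 * r]. *)
Lemma symO_symP q : 0 < q ->
  symO q ^+ 2 <= 3 * symP q ^+ 2 /\ symP q ^+ 2 <= symO q ^+ 2.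
Proof.
move=> q0; rewrite symO_sqr// /symG /symP exprMn exprVn.
have s0 : 0 < Num.sqrt q by rewrite sqrtr_gt0.
have r0 : 0 < k * Num.sqrt q by rewrite mulr_gt0.
have p0 : 0 <= 1 + k * Num.sqrt q by rewrite addr_ge0// ltW.
rewrite (sqr_sqrtr (ltW q0)) (sqr_sqrtr p0).
have qE : q = (k * Num.sqrt q) ^+ 2 / mu.
  by rewrite exprMn (sqr_sqrtr (ltW q0)) (sqr_sqrtr (ltW mu_gt0)) mulrAC mulfV ?gt_eqF// mul1r.
move: (k * Num.sqrt q) r0 p0 qE => r r0 p0 qE; rewrite qE {s0 q0 qE q}.
have T1 : tanh r <= 1.
  by rewrite tanhE ler_pdivrMr ?tanh_den// mul1r; have := expR_gt0 (- r); lra.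
have Er : 1 + 2 * r <= expR r ^+ 2 by rewrite -expRM_natl; exact: expR_ge1Dx.
have Er2 : 1 + 2 * - r <= (expR r ^+ 2)^-1.
  by rewrite -exprVn -expRN -expRM_natl; exact: expR_ge1Dx.
have E0 : 0 < expR r ^+ 2 by rewrite exprn_gt0 ?expR_gt0.
have TE : tanh r = (expR r ^+ 2 - 1) / (expR r ^+ 2 + 1).
  rewrite tanhE expRN; have := expR_gt0 r; move: (expR r) => E Ep; field.
  by rewrite !gt_eqF// ?addr_gt0 ?exprn_gt0.
have T2 : tanh r <= 2 * r.
  rewrite TE ler_pdivrMr ?addr_gt0//; move: E0 Er2; move: (expR r ^+ 2) => E E0.
  rewrite -[leRHS]mul1r ler_pdivlMr//; nra.
have T3 : r <= tanh r * (1 + r).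
  rewrite TE mulrAC ler_pdivlMr ?addr_gt0//; nra.
have r1 : 0 < 1 + r by rewrite addr_gt0.
have mi : 0 <= mu^-1 by rewrite invr_ge0 ltW.
move: (tanh r) T1 T2 T3 => t T1 T2 T3; split.
  rewrite [X in 3 * X]mulrAC [leRHS]mulrA ler_wpM2r// mulrA ler_pdivlMr//.
  have : t * (1 + r) <= 3 * r by nra.
  nra.
rewrite mulrAC ler_wpM2r// ler_pdivrMr//; nra.
Qed.

End Symbols.

(** * Multipliers and derivatives of test functions *)

Section Multipliers.
Context {R : realType} {d : space_dim}.
Variable gamma : R.
Notation X := (Rd R d).
Implicit Types (a b g : X -> R) (F : R -> R).

Definition qform (xi : X) : R := dotp (aniso gamma xi) (aniso gamma xi).

Lemma smooth_qform : smooth qform.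
Proof.
rewrite /qform; case: d => n /=.
  by apply: CnM; apply: Cn_lin => [h v x //|x]; exact: cvg_id.
by apply: CnD; apply: CnM; try exact: Cn_fst; apply: CnM; try exact: Cn_cst; exact: Cn_snd.
Qed.

Lemma qform_ge xi : x1 xi ^+ 2 <= qform xi.
Proof.
rewrite /qform; case: d xi => xi /=; first by rewrite expr2.
by rewrite expr2 lerDl -expr2 sqr_ge0.
Qed.

Lemma away_qform a : away a -> exists2 c, 0 < c & forall xi, a xi != 0 -> c <= qform xi.
Proof.
move=> [_ [c c0 ac]]; exists (c ^+ 2) => [|xi /ac H]; first by rewrite exprn_gt0.
apply: le_trans (qform_ge xi); rewrite -[leRHS]real_normK ?num_real//.
by rewrite lerXn2r// nnegrE ltW.
Qed.

Lemma away_mult F a : (forall n, Sn Rgt0 n F) -> away a ->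
  away (fun xi => F (qform xi) * a xi).
Proof.
move=> SF Aa; have [c c0 qc] := away_qform Aa; have [Ta [e e0 ae]] := Aa.
split; first exact: (rt_comp SF smooth_qform Ta c0 qc).
by exists e => // xi; rewrite mulf_eq0 => /norP[_]; exact: ae.
Qed.

Lemma away_x1 a : away a -> exists2 b, away b & forall xi, b xi * x1 xi = a xi.
Proof.
move=> Aa; have [Ta [c c0 ac]] := Aa.
have sx : smooth (fun xi : X => x1 xi * x1 xi) by apply: smoothM; exact: smooth_x1.
have Tb : real_test (fun xi => (x1 xi * x1 xi)^-1 * (x1 xi * a xi)).
  have c2 : 0 < c ^+ 2 by rewrite exprn_gt0.
  apply: (@rt_comp R d (fun x => x^-1) (fun xi => x1 xi * x1 xi)
    (fun xi => x1 xi * a xi) _ (@Sn_invp R) sx (rtM smooth_x1 Ta) c2).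
  move=> xi; rewrite mulf_eq0 => /norP[_ /ac H].
  by rewrite -expr2 -[leRHS]real_normK ?num_real// lerXn2r// nnegrE ltW.
exists (fun xi => (x1 xi * x1 xi)^-1 * (x1 xi * a xi)).
  by split => //; exists c => // xi; rewrite !mulf_eq0 => /norP[_ /norP[_]]; exact: ac.
move=> xi; have [->|a0] := eqVneq (a xi) 0; first by rewrite !mulr0 mul0r.
have x0 : x1 xi != 0 by rewrite -normr_gt0; apply: lt_le_trans (ac _ a0).
by field.
Qed.

Definition d1 g (x : X) : R :=
  match d as d0 return (Rd R d0 -> R) -> Rd R d0 -> R with
  | Dim1 => fun f u => @derive R R R f u 1
  | Dim2 => fun f u => @derive R (R * R)%type R f u (1, 0)
  end g x.

Lemma rt_d1 g : real_test g -> real_test (d1 g).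
Proof. by rewrite /d1; case: d g => g; exact: Cc_derive. Qed.

Lemma d1_mult F F' a x : (forall y : R, 0 < y -> is_derive y 1 F (F' y)) -> away a ->
  d1 (fun xi => F (qform xi) * a xi) x =
  F' (qform x) * (2 * x1 x * a x) + F (qform x) * d1 a x.
Proof.
move=> DF Aa; have [c c0 qc] := away_qform Aa; have [Ta _] := Aa.
move: Ta qc (smooth_qform); rewrite /d1 /qform; case: d a x {Aa} => a x [Ca _] qc Cq.
- have sa : supp a `<=` (fun x : R => x * x) @^-1` Rgt0.
    move=> y Sy; apply: (lt_le_trans c0).
    have cl : closed [set x : R | c <= x * x].
      apply: (@preimage_closed _ _ (fun x : R => x * x) [set y | c <= y]) => [z _|]; last exact: closed_ge.
      exact: (Cn_cont (Cq 0)).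
    exact: (cl _ (closureS qc Sy)).
  have da : is_derive (x : R) 1 a ('D_1 a x) by apply/derivableP; have [_ /(_ 1)[]] := Ca 1.
  have dq : is_derive (x : R) 1 (fun x : R => x * x) (x * 1 + x * 1).
    exact: (isDM (is_derive_id x 1) (is_derive_id x 1)).
  have [_ ->] := isD_mult DF sa dq da; rewrite /=; congr (_ * _ + _); ring.
- have sa : supp a `<=` (fun x : R * R => x.1 * x.1 + gamma * x.2 * (gamma * x.2)) @^-1` Rgt0.
    move=> y Sy; apply: (lt_le_trans c0).
    have cl : closed [set x : R * R | c <= x.1 * x.1 + gamma * x.2 * (gamma * x.2)].
      apply: (@preimage_closed _ _ (fun x : R * R => x.1 * x.1 + gamma * x.2 * (gamma * x.2))
        [set y | c <= y]) => [z _|]; last exact: closed_ge.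
      exact: (Cn_cont (Cq 0)).
    exact: (cl _ (closureS qc Sy)).
  have da : is_derive (x : R * R) (1, 0) a ('D_(1, 0) a x).
    by apply/derivableP; have [_ /(_ (1, 0))[]] := Ca 1.
  have df : is_derive (x : R * R) ((1, 0) : R * R) (fun x : R * R => x.1) 1.
    by have := @isD_lin R (R * R)%type (fun x => x.1) x (1, 0) (fun h v x => erefl).
  have ds : is_derive (x : R * R) ((1, 0) : R * R) (fun x : R * R => gamma * x.2) (gamma * 0).
    apply: (@isD_lin R (R * R)%type (fun x => gamma * x.2) x (1, 0)) => h v y /=.
    by rewrite mulrDr mulrCA.
  have dq := isDD (isDM df df) (isDM ds ds).
  have [_ ->] := isD_mult DF sa dq da; rewrite /=; congr (_ * _ + _); ring.
Qed.

Lemma cvg_near_supp (g : R -> R) (N : R) : (forall x, g x != 0 -> `|x| <= N) ->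
  g (N + 1) = 0 /\ g (- (N + 1)) = 0.
Proof.
move=> gN; split; apply: contrapT => /eqP /gN; rewrite ?normrN => H;
  have := ler_norm (N + 1); lra.
Qed.

Lemma int_derive1 (g g' : R -> R) (N : R) : (forall x : R, is_derive x 1 g (g' x)) ->
  continuous g' -> (forall x, g x != 0 -> `|x| <= N) -> (forall x, g' x != 0 -> `|x| <= N) ->
  \int[@lebesgue_measure R]_x g' x = 0.
Proof.
move=> Dg cg gN g'N; have [g1 g2] := cvg_near_supp gN.
have [N0|N0] := ltP N 0.
  have -> : g' = fun=> 0.
    apply/funext => x; apply: contrapT => /eqP /g'N H; have := normr_ge0 x; lra.
  by rewrite Rintegral_cst// mul0r.
have N1 : - (N + 1) < N + 1 by lra.
have := FTC N1 Dg cg; rewrite g1 g2 subrr => <-.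
rewrite [RHS]Rintegral_mkcond; apply: eq_Rintegral => x _; rewrite /patch.
case: ifPn => // /negP xN; apply: contrapT => /eqP /g'N H; apply: xN.
by apply/mem_set; rewrite /= in_itv/= -ler_norml; lra.
Qed.

(** The fundamental theorem of calculus in the first variable, after Fubini if [d] is [2]. *)
Lemma int_d1 g : real_test g -> \int[leb]_x d1 g x = 0.
Proof.
move=> Tg; have Td := rt_d1 Tg; have [I1 _] := rt_L2 Td.
have [N N0 gN] := rt_box Tg; have [N' N0' dN] := rt_box Td.
move: Tg Td I1 gN dN; rewrite /d1; case: d g => g [Cg _] [Cd _] I1 gN dN /=.
- have bd x : x \in `[- N, N] -> `|x| <= Num.max N N'.
    by rewrite in_itv/= -ler_norml => h; rewrite le_max h.
  have bd' x : x \in `[- N', N'] -> `|x| <= Num.max N N'.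
    by rewrite in_itv/= -ler_norml => h; rewrite le_max h orbT.
  apply: (@int_derive1 g _ (Num.max N N')).
  + by move=> x; apply/derivableP; have [_ /(_ 1)[]] := Cg 1.
  + exact: (Cn_cont (Cd 0)).
  + by move=> x /gN; exact: bd.
  + by move=> x /dN; exact: bd'.
- have -> := @int21 _ _ _ _ R (@lebesgue_measure R) (@lebesgue_measure R) _ I1.
  have H y : \int[@lebesgue_measure R]_x 'D_(1, 0) g (x, y) = 0.
    apply: (@int_derive1 (fun x => g (x, y)) _ (Num.max N N')).
    + move=> x; apply/isDline.
      have /isDline : is_derive ((x, y) : R * R) ((1, 0) : R * R) g ('D_(1, 0) g (x, y)).
        by apply/derivableP; have [_ /(_ (1, 0))[]] := Cg 1.
      apply: isD_ext => // h; congr (g (_, _)) => /=.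
      by rewrite scaler0 add0r.
    + move=> x; have hh : ((u, y) : R * R) @[u --> x] --> ((x, y) : R * R).
        have hx : (u : R) @[u --> x] --> x by exact: cvg_id.
        have hy : (y : R) @[u --> x] --> y by exact: cvg_cst.
        exact: (cvg_pair hx hy).
      have cd0 : continuous ('D_(1, 0) g : R * R -> R) by exact: Cn_cont (Cd 0).
      have cd : {for (x, y) : R * R, continuous ('D_(1, 0) g)} by exact: cd0.
      exact: (@continuous_comp _ _ _ (fun u : R => (u, y) : R * R) ('D_(1, 0) g) x hh cd).
    + by move=> x /gN [/= + _]; rewrite in_itv/= -ler_norml => h; rewrite le_max h.
    + by move=> x /dN [/= + _]; rewrite in_itv/= -ler_norml => h; rewrite le_max h orbT.
  under eq_Rintegral do rewrite H.
  by rewrite Rintegral_cst// mul0r.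
Qed.

End Multipliers.

(** * A Riemann-Lebesgue lemma *)

Section RiemannLebesgue.
Context {R : realType} {d : space_dim}.
Variable gamma : R.
Notation X := (Rd R d).
Notation q := (@qform R d gamma).
Implicit Types (a b Z : X -> R).

Variables O O' : R -> R.
Hypothesis O_smooth : forall n, Sn Rgt0 n O.
Hypothesis O_derive : forall y : R, 0 < y -> is_derive y 1 O (O' y).
Hypothesis O'_gt0 : forall y : R, 0 < y -> 0 < O' y.

(** The derivative of [O \o q] in the first coordinate is [(O' \o q) * (2 * x1)], which does
   not vanish on the support of [a]: dividing by it yields a test. *)
Lemma away_stationary a : away a ->
  exists2 b, away b & forall xi, O' (q xi) * (2 * x1 xi * b xi) = a xi.
Proof.
move=> Aa; have SO' n : Sn Rgt0 n O' by exact: (Sn_derive (@open_Rgt0 R) (O_smooth n.+1)).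
have SF n : Sn Rgt0 n (fun y => (2 * O' y)^-1).
  apply: (Sn_comp (Sn_invp n)); first by apply: SnM => //; exact: Sn_cst.
  by move=> y y0; rewrite /Rgt0/= mulr_gt0// O'_gt0.
have [b Ab bE] := away_x1 (away_mult gamma SF Aa).
exists b => // xi.
have -> : O' (q xi) * (2 * x1 xi * b xi) = O' (q xi) * (2 * (b xi * x1 xi)) by ring.
rewrite bE; have [->|a0] := eqVneq (a xi) 0; first by rewrite !mulr0.
have [c c0 qc] := away_qform gamma Aa.
have q0 : 0 < q xi := lt_le_trans c0 (qc _ a0).
by field; rewrite gt_eqF// O'_gt0.
Qed.

Let phase (la th : R) n : Sn Rgt0 n (fun y => la * O y + th).
Proof. by apply: SnD; [apply: SnM => //; exact: Sn_cst|exact: Sn_cst]. Qed.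

Lemma away_cos la th a : away a -> away (fun xi => cos (la * O (q xi) + th) * a xi).
Proof.
by move=> Aa; apply: (@away_mult _ _ _ (fun y => cos (la * O y + th))) => // n;
  apply: (Sn_comp (Sn_cos_sin setT n).1).
Qed.

Lemma away_sin la th a : away a -> away (fun xi => sin (la * O (q xi) + th) * a xi).
Proof.
by move=> Aa; apply: (@away_mult _ _ _ (fun y => sin (la * O y + th))) => // n;
  apply: (Sn_comp (Sn_cos_sin setT n).2).
Qed.

(** The derivative of [sin (la * O + th) * b] is the integrand on the left, plus a term
   without the factor [la]. *)
Lemma osc_by_parts la th a b : away a -> away b ->
  (forall xi, O' (q xi) * (2 * x1 xi * b xi) = a xi) ->
  `|la * \int[leb]_xi (cos (la * O (q xi) + th) * a xi)| <= \int[leb]_xi `|d1 b xi|.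
Proof.
move=> Aa Ab bE.
pose F y := sin (la * O y + th); pose F' y := cos (la * O y + th) * (la * O' y + O y * 0 + 0).
have DF (y : R) : 0 < y -> is_derive y 1 F (F' y).
  move=> y0; apply: isD_comp (is_derive_sin _).
  by apply: (isDD (isDM (@isD_cst R R la y 1) (O_derive y0))); exact: isD_cst.
have Ag := away_sin la th Ab.
have [I0 _] := rt_L2 (rt_d1 (away_rt Ab)).
have [Ig _] := rt_L2 (rt_d1 (away_rt Ag)).
have [Ic _] := rt_L2 (away_rt (away_cos la th Aa)).
have dE xi : sin (la * O (q xi) + th) * d1 b xi =
    d1 (fun xi : X => sin (la * O (q xi) + th) * b xi) xi
    - la * (cos (la * O (q xi) + th) * a xi).
  by rewrite (@d1_mult R d gamma F F' b xi DF Ab) -bE /F' /F; ring.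
have Is : integr leb (fun xi => sin (la * O (q xi) + th) * d1 b xi).
  have := integrB Ig (integrZ la Ic); congr integr.
  by apply/funext => xi; rewrite dE.
have -> : la * \int[leb]_xi (cos (la * O (q xi) + th) * a xi) =
   - \int[leb]_xi (sin (la * O (q xi) + th) * d1 b xi).
  under [in RHS]eq_Rintegral do rewrite dE.
  rewrite intB//; last exact: integrZ.
  by rewrite (int_d1 (away_rt Ag)) sub0r opprK intZ.
rewrite normrN; apply: (le_trans (le_normr_Rintegral measurableT Is)).
apply: int_le; [exact: integrable_norm|exact: integrable_norm|] => xi.
by rewrite normrM ler_piMl// sin_max.
Qed.

(** Integration by parts settles the case where [Z] is a test. Tests are dense, and the
   oscillating factor is bounded. *)
Theorem riemann_lebesgue Z a th : L2 leb Z -> away a -> forall e : R, 0 < e ->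
  exists L, forall la, L <= `|la| ->
    `|\int[leb]_xi (Z xi * (cos (la * O (q xi) + th) * a xi))| <= e.
Proof.
move=> LZ Aa e e0; have La := away_L2 Aa.
have na : 0 < 2 * (nrm leb a + 1) by rewrite mulr_gt0// ltr_wpDl ?nrm_ge0.
have [k Ak Zk] := dense_away LZ (divr_gt0 e0 na); have Lk := away_L2 Ak.
have [b Ab bE] := away_stationary Aa.
have Akb : away (fun xi => k xi * b xi) by apply: awayM => //; apply/rt_smooth/away_rt.
pose C := \int[leb]_xi `|d1 (fun xi => k xi * b xi) xi|.
have C0 : 0 <= C by apply: Rintegral_ge0 => xi _.
exists (2 * C / e + 1) => la laL.
have la0 : 0 < `|la| by apply: lt_le_trans laL; rewrite ltr_wpDl// divr_ge0 ?mulr_ge0// ltW.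
have Lc := away_L2 (away_cos la th Aa).
have -> : \int[leb]_xi (Z xi * (cos (la * O (q xi) + th) * a xi)) =
    ip leb (fun xi => Z xi - k xi) (fun xi => cos (la * O (q xi) + th) * a xi) +
    \int[leb]_xi (cos (la * O (q xi) + th) * (k xi * a xi)).
  rewrite /ip -intD.
  - by apply: eq_Rintegral => xi _; ring.
  - by apply: L2M => //; exact: L2B.
  - by have := L2M Lk Lc; congr integr; apply/funext => xi; ring.
apply: (le_trans (ler_normD _ _)); rewrite [leRHS]splitr lerD//.
  apply: (le_trans (CauchySchwarz (L2B LZ Lk) Lc)).
  have N : nrm leb (fun xi => cos (la * O (q xi) + th) * a xi) <= nrm leb a + 1.
    apply: (@le_trans _ _ (nrm leb a)); last by rewrite lerDl.
    apply: nrm_le => //; first by case: Lc.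
    by move=> xi; rewrite normrM ler_piMl// cos_max.
  apply: (le_trans (ler_pM (nrm_ge0 _ _) (nrm_ge0 _ _) Zk N)).
  rewrite le_eqVlt; apply/orP; left; apply/eqP; field.
  by rewrite gt_eqF// ltr_wpDl ?nrm_ge0.
have Aka : away (fun xi => k xi * a xi) by apply: awayM => //; apply/rt_smooth/away_rt.
have := @osc_by_parts la th (fun xi => k xi * a xi) _ Aka Akb.
rewrite normrM -/C => H.
have {}H : `|la| * `|\int[leb]_xi (cos (la * O (q xi) + th) * (k xi * a xi))| <= C.
  by apply: H => xi; rewrite -bE; ring.
rewrite -(ler_pM2l la0) (le_trans H)// mulrA ler_pdivlMr// -ler_pdivrMr//.
have -> : C * 2 / e = 2 * C / e by ring.
apply: le_trans laL; rewrite lerDl.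
exact: ler01.
Qed.

End RiemannLebesgue.

(** * From complex Fourier transforms to real Hartley pairings *)

Section Exhaustion.
Context {R : realType}.

Definition plateau (n : nat) (x : R) : R :=
  ebump 0 (n.+1%:R + x) * ebump 0 (n.+1%:R - x).

Lemma Cc_plateau n : @Cc_infty R R (plateau n).
Proof.
have Ci m : @Cn R R m (fun x => x) by apply: Cn_lin => [h v x //|x]; exact: cvg_id.
have pos (k : nat) (y : R) : ebump k y != 0 -> 0 < y.
  by move=> h; rewrite ltNge; apply/negP => /(ebump_le0 k) e; rewrite e eqxx in h.
split=> [m|].
  apply: CnM; apply: (@Cn_comp0 R R m (ebump 0)); try exact: Sn_ebump.
    by apply: CnD => //; exact: Cn_cst.
  apply: CnD; first exact: Cn_cst.
  by apply: Cn_lin => [h v x|x]; [rewrite opprD -mulrN|exact: opp_continuous].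
apply: (subclosed_compact _ (@segment_compact R (- n.+1%:R) n.+1%:R)); first exact: closed_closure.
move=> x Sx; apply: (compact_closed (@Rhausdorff R) (@segment_compact R _ _)).
apply: closureS Sx => y /=; rewrite mulf_eq0 => /norP[/pos h1 /pos h2].
by rewrite in_itv/=; apply/andP; split; lra.
Qed.

Lemma plateau_cvg x : plateau n x @[n --> \oo] --> (1 : R).
Proof.
have H (y : R) : ebump 0 (n.+1%:R + y) @[n --> \oo] --> (1 : R).
  apply/ebump_cvg/cvgryPge => A; near=> n.
  rewrite -lerBlDr (@le_trans _ _ n%:R) ?ler_nat//.
  by near: n; exact: nbhs_infty_ger.
by rewrite -[X in _ --> X]mulr1; apply: cvgM; [exact: H|exact: (H (- x))].
Unshelve. all: by end_near. Qed.

Lemma exhaustion d : exists c : nat -> Rd R d -> R,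
  (forall n, real_test (c n)) /\ (forall x, c n x @[n --> \oo] --> (1 : R)).
Proof.
case: d; first by exists plateau; split=> [n|x]; [exact: Cc_plateau|exact: plateau_cvg].
exists (fun n x => plateau n x.1 * plateau n x.2); split=> [n|x].
  exact: (Cc_tensor (Cc_plateau n) (Cc_plateau n)).
by rewrite -[X in _ --> X]mulr1; apply: cvgM; exact: plateau_cvg.
Qed.

End Exhaustion.

Section HartleyPairing.
Context {R : realType} {d : space_dim}.
Notation X := (Rd R d).
Local Notation re := (@complex.Re R).
Local Notation im := (@complex.Im R).
Local Open Scope complex_scope.
Implicit Types (u v g m b : X -> R) (U V a : X -> R[i]).

(** Some tests converge to [1] everywhere. *)
Lemma local_measurable g : (forall b, real_test b -> measurable_fun setT (fun x => g x * b x)) ->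
  measurable_fun setT g.
Proof.
move=> H; have [c [Tc c1]] := @exhaustion R d.
apply: (@measurable_fun_cvg _ _ R setT (fun n x => g x * c n x)) => [n|x _].
  exact: H.
by rewrite -[X in _ --> X]mulr1; apply: cvgM; [exact: cvg_cst|exact: c1].
Qed.

(** The complex test [(1 + i) b] is chosen because the real part of [expi (- r) * (1 + i)]
   is [cas r]. *)
Lemma Re_fourier b x : re (fourier (fun xi => b xi +i* b xi) x) = hartley b x.
Proof.
apply: eq_Rintegral => xi _ /=; rewrite cosN sinN /cas; ring.
Qed.

Lemma test_diag b : real_test b -> test_fun (fun xi => b xi +i* b xi).
Proof. by move=> Tb; split. Qed.

Lemma pairing_hartley u b : re (pairing_hat u (fun xi => b xi +i* b xi)) =
  \int[leb]_x (u x * hartley b x).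
Proof.
by apply: eq_Rintegral => x _; rewrite -Re_fourier /= mul0r subr0.
Qed.

Lemma pairing_hartley_def u b : pairing_hat_def u (fun xi => b xi +i* b xi) ->
  integr leb (fun x => u x * hartley b x).
Proof.
case=> + _; congr integr; apply/funext => x.
by rewrite -Re_fourier /= mul0r subr0.
Qed.

Lemma fourier_hartley u U b : is_fourier u U -> real_test b ->
  [/\ integr leb (fun x => u x * hartley b x),
      integr leb (fun xi => (re (U xi) - im (U xi)) * b xi) &
      \int[leb]_x (u x * hartley b x) = \int[leb]_xi ((re (U xi) - im (U xi)) * b xi)].
Proof.
move=> uU /test_diag Tb; have [/pairing_hartley_def I1 [I2 _] E] := uU _ Tb.
have UE xi : re (U xi * (b xi +i* b xi)) = (re (U xi) - im (U xi)) * b xi.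
  by case: (U xi) => r i /=; rewrite mulrBl.
split => //; first by move: I2; congr integr; apply/funext => xi; rewrite UE.
by rewrite -pairing_hartley E /=; apply: eq_Rintegral => xi _; rewrite UE.
Qed.

(** The definition of [is_fourier] only gives the measurability of products of [U] with
   tests. For a function [U] that is not measurable, the integral in the Sobolev norm would
   be a lower integral, which controls nothing. *)
Lemma fourier_measurable u U : is_fourier u U ->
  measurable_fun setT (fun xi => re (U xi)) /\ measurable_fun setT (fun xi => im (U xi)).
Proof.
move=> uU; have T0 : real_test (fun _ : X => 0 : R) by exact: away_rt away0.
suff H b : real_test b -> measurable_fun setT (fun xi => re (U xi) * b xi) /\
    measurable_fun setT (fun xi => im (U xi) * b xi).
  by split; apply: local_measurable => b /H[].
move=> Tb; have Ta : test_fun (fun xi => b xi +i* 0) by [].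
have [_ [/integr_meas m1 /integr_meas m2] _] := uU _ Ta.
split; [apply: (eq_measurable_fun _ _ m1)|apply: (eq_measurable_fun _ _ m2)] =>
  xi _ /=; by case: (U xi) => r i /=; rewrite !(mulr0, subr0, add0r).
Qed.

Lemma Cint_add (F G : X -> R[i]) : Cintegrable F -> Cintegrable G ->
  Cintegrable (fun x => F x + G x) /\ Cintegral (fun x => F x + G x) = Cintegral F + Cintegral G.
Proof.
move=> [F1 F2] [G1 G2]; have reD x : re (F x + G x) = re (F x) + re (G x) by case: (F x); case: (G x).
have imD x : im (F x + G x) = im (F x) + im (G x) by case: (F x); case: (G x).
split; last first.
  rewrite /Cintegral; under eq_Rintegral do rewrite reD.
  under [X in _ +i* X]eq_Rintegral do rewrite imD.
  by rewrite (intD F1 G1) (intD F2 G2).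
by split; [have := integrD F1 G1|have := integrD F2 G2]; congr integr; apply/funext => x.
Qed.

Lemma Cint_scale (k : R) (F : X -> R[i]) : Cintegrable F ->
  Cintegrable (fun x => k%:C * F x) /\ Cintegral (fun x => k%:C * F x) = k%:C * Cintegral F.
Proof.
move=> [F1 F2]; have reZ x : re (k%:C * F x) = k * re (F x).
  by case: (F x) => r i /=; rewrite mul0r subr0.
have imZ x : im (k%:C * F x) = k * im (F x).
  by case: (F x) => r i /=; rewrite mul0r addr0.
split; last first.
  rewrite /Cintegral; under eq_Rintegral do rewrite reZ.
  under [X in _ +i* X]eq_Rintegral do rewrite imZ.
  by rewrite (intZ k F1) (intZ k F2); congr (_ +i* _); rewrite mul0r ?subr0 ?addr0.
by split; [have := integrZ k F1|have := integrZ k F2]; congr integr; apply/funext => x.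
Qed.

Lemma is_fourier_comb (k l : R) u v U V : is_fourier u U -> is_fourier v V ->
  is_fourier (fun x => k * u x + l * v x) (fun xi => k%:C * U xi + l%:C * V xi).
Proof.
move=> uU vV a Ta; have [u1 u2 u3] := uU _ Ta; have [v1 v2 v3] := vV _ Ta.
have E1 : (fun x => (k * u x + l * v x)%:C * fourier a x) =
   (fun x => k%:C * ((u x)%:C * fourier a x) + l%:C * ((v x)%:C * fourier a x)).
  by apply/funext => x; rewrite rmorphD !rmorphM mulrDl !mulrA.
have E2 : (fun xi => (k%:C * U xi + l%:C * V xi) * a xi) =
   (fun xi => k%:C * (U xi * a xi) + l%:C * (V xi * a xi)).
  by apply/funext => x; rewrite mulrDl !mulrA.
have [p1 q1] := Cint_scale k u1; have [p2 q2] := Cint_scale l v1.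
have [p3 q3] := Cint_scale k u2; have [p4 q4] := Cint_scale l v2.
have [r1 s1] := Cint_add p1 p2; have [r2 s2] := Cint_add p3 p4.
rewrite /pairing_hat_def /pairing_hat E1 E2; split => //.
rewrite s1 s2 q1 q2 q3 q4; congr (_ * _ + _ * _); [exact: u3|exact: v3].
Qed.

End HartleyPairing.

Section SobolevBound.
Context {R : realType} {d : space_dim}.
Notation X := (Rd R d).
Local Notation re := (@complex.Re R).
Local Notation im := (@complex.Im R).
Implicit Types (f b : X -> R) (u du : R -> X -> R).

Lemma L2_finite_norm f : measurable_fun setT f -> ('N[leb]_2%:E[EFin \o f] < +oo)%E -> L2 leb f.
Proof.
by move=> mf Ff; apply/L2_Lfun; rewrite inE; apply/andP; split; rewrite inE.
Qed.

Lemma measurable_enorm : measurable_fun setT (@enorm R d).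
Proof.
rewrite /enorm; apply: (measurable_comp_cont (@sqrt_continuous R)).
by case: d => /=; [exact: measurable_funM|apply: measurable_funD; apply: measurable_funM].
Qed.

(** The function [Re f^ - Im f^] plays for the Hartley transform the role that [f^] plays
   for the Fourier transform. As [0 <= s], the Sobolev weight is at least [1], and the norm
   of [H^s] controls that of [L2]. *)
Lemma Hs_partner s f (e : R) : 0 <= s -> (exists U, is_fourier f U) ->
  (Hs_norm s f <= e%:E)%E -> exists F, [/\ L2 leb F, nrm leb F <= 2 * e &
    forall b, real_test b -> \int[leb]_x (f x * hartley b x) = ip leb F b].
Proof.
move=> s0 [U0 fU0] He.
have fU : is_fourier f (fhat f) by apply: (@xgetPex _ _ [set U | is_fourier f U]); exists U0.
have [mr mi] := fourier_measurable fU.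
pose G (xi : X) := (1 + enorm xi ^+ 2) `^ (s / 2) * Normc.normc (fhat f xi).
have NE xi : Normc.normc (fhat f xi) = Num.sqrt (re (fhat f xi) ^+ 2 + im (fhat f xi) ^+ 2).
  by case: (fhat f xi).
have mG : measurable_fun setT G.
  apply: measurable_funM.
    apply: (measurableT_comp (@measurable_powR R (s / 2))).
    by apply: measurable_funD => //; apply: measurable_funX; exact: measurable_enorm.
  under eq_fun do rewrite NE; apply: (measurable_comp_cont (@sqrt_continuous R)).
  by apply: measurable_funD; apply: measurable_funX.
have LG : L2 leb G.
  by apply: L2_finite_norm => //; apply: le_lt_trans He _; rewrite ltry.
have Ge : nrm leb G <= e by rewrite -lee_fin -Lnorm_nrm.
have U2 xi : `|re (fhat f xi) - im (fhat f xi)| <= `|2 * G xi|.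
  have w1 : 1 <= (1 + enorm xi ^+ 2) `^ (s / 2).
    have w0 : 1 <= 1 + enorm xi ^+ 2 by rewrite lerDl sqr_ge0.
    by apply: le_trans (ler_powR w0 (divr_ge0 s0 (ler0n R 2))); rewrite powRr0.
  have n0 : 0 <= Normc.normc (fhat f xi) by rewrite NE sqrtr_ge0.
  apply: (@le_trans _ _ (2 * Normc.normc (fhat f xi))); last first.
    rewrite ger0_norm ?mulr_ge0 ?powR_ge0// ler_wpM2l// ler_peMl//.
  have H (v w : R) : `|v| <= Num.sqrt (v ^+ 2 + w ^+ 2).
    by rewrite -sqrtr_sqr ler_wsqrtr// lerDl sqr_ge0.
  rewrite NE (le_trans (ler_normB _ _))// mulr_natl mulr2n lerD//.
  by rewrite [X in Num.sqrt X]addrC.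
have mU : measurable_fun setT (fun xi => re (fhat f xi) - im (fhat f xi)) by exact: measurable_funB.
have LG2 := L2Z 2 LG.
have LU := L2_le mU LG2 U2; have NU := nrm_le mU LG2 U2.
exists (fun xi => re (fhat f xi) - im (fhat f xi)); split => // [|b Tb].
  by rewrite (le_trans NU)// nrmZ// ger0_norm// ler_wpM2l.
by have [] := fourier_hartley fU Tb.
Qed.

Lemma Hs_pairing s f (e : R) : 0 <= s -> (exists U, is_fourier f U) ->
  (Hs_norm s f <= e%:E)%E -> forall b, real_test b ->
  `|\int[leb]_x (f x * hartley b x)| <= 2 * e * nrm leb b.
Proof.
move=> s0 fU He b Tb; have [_ Lb] := rt_L2 Tb.
have [F [LF NF ->]] := Hs_partner s0 fU He; last by [].
by apply: (le_trans (CauchySchwarz LF Lb)); rewrite ler_wpM2r ?nrm_ge0.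
Qed.

Lemma in_Hs_partner s f : 0 <= s -> in_Hs s f -> exists2 F, L2 leb F &
  forall b, real_test b -> ip leb f (hartley b) = ip leb F b.
Proof.
move=> s0 [_ fU fin]; have n0 : (0 <= Hs_norm s f)%E by exact: Lnorm_ge0.
have He : (Hs_norm s f <= (fine (Hs_norm s f))%:E)%E by rewrite fineK// ge0_fin_numE.
by have [F [LF _ FE]] := Hs_partner s0 fU He; exists F.
Qed.

(** Differentiability in [H^s] gives a weak derivative that is uniform in the test. *)
Lemma C1_Hs_pairing s u du t (e : R) : 0 <= s -> C1_Hs s u du -> 0 < e ->
  exists2 de, 0 < de & forall h, h != 0 -> `|h| < de -> forall b, real_test b ->
    `|\int[leb]_x ((u (t + h) x - u t x - h * du t x) * hartley b x)| <= e * `|h| * nrm leb b.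
Proof.
move=> s0 [cu cdu D] e0.
have FT r : exists U, is_fourier (u r) U by have [[]] := cu r.
have FTd r : exists U, is_fourier (du r) U by have [[]] := cdu r.
have e2 : 0 < e / 2 by rewrite divr_gt0.
have [de /= de0 H] : \forall h \near 0^', (Hs_norm s (fun x => ((u (t + h) x - u t x) / h - du t x)%R) < (e / 2)%:E)%E.
  have N0 : nbhs (0 : \bar R)%E [set y | (y < (e / 2)%:E)%E].
    by apply: open_nbhs_nbhs; split; [exact: open_ereal_lt_ereal|rewrite /= lte_fin].
  exact: (D t _ N0).
exists de => // h h0 hde b Tb.
have dist : ball 0 de h by rewrite /ball/= sub0r normrN.
have Hh := H h dist h0.
pose D' x := (u (t + h) x - u t x) / h - du t x.
have FD : exists U, is_fourier D' U.
  have [U1 F1] := FT (t + h); have [U2 F2] := FT t; have [U3 F3] := FTd t.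
  have F4 := is_fourier_comb h^-1 (- h^-1) F1 F2.
  have F5 := is_fourier_comb 1 (-1) F4 F3.
  eexists; move: F5; congr is_fourier; apply/funext => x; rewrite /D'; ring.
have := Hs_pairing s0 FD (ltW Hh) Tb.
have -> : 2 * (e / 2) = e by field.
have [IH _ _] := fourier_hartley (proj2_sig (cid FD)) Tb.
have -> : \int[leb]_x ((u (t + h) x - u t x - h * du t x) * hartley b x) =
   h * \int[leb]_x (D' x * hartley b x).
  rewrite -intZ//; apply: eq_Rintegral => x _; rewrite /D'; field; exact: h0.
move=> B; rewrite normrM mulrAC [leRHS]mulrC ler_wpM2l//.
Qed.
End SobolevBound.

(** * Differentiating a pairing along a moving test function *)

Section MovingTest.
Context {R : realType} {d : space_dim}.
Notation X := (Rd R d).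
Implicit Types (a b v : X -> R) (u : R -> X -> R).

Lemma integr_cas a x : real_test a -> integr leb (fun xi => cas (dotp x xi) * a xi).
Proof.
move=> /rt_L2[Ia _]; under eq_fun do rewrite mulrC.
by apply: (integr_bound Ia (@cas_meas1 R d x)) => xi; exact: cas_le2.
Qed.

Lemma hartleyZ (k : R) a x : real_test a -> hartley (fun xi => k * a xi) x = k * hartley a x.
Proof.
move=> Ta; rewrite /hartley -intZ; last exact: integr_cas.
by apply: eq_Rintegral => xi _; ring.
Qed.

Lemma hartleyD a b x : real_test a -> real_test b ->
  hartley (fun xi => a xi + b xi) x = hartley a x + hartley b x.
Proof.
move=> Ta Tb; rewrite /hartley -intD; [|exact: integr_cas..].
by apply: eq_Rintegral => xi _; rewrite mulrDr.
Qed.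

Definition pair v a : R := ip leb v (hartley a).

Lemma L2_hartley a : real_test a -> L2 leb (hartley a).
Proof. by case/plancherel. Qed.

Lemma pairZ (k : R) v a : L2 leb v -> real_test a ->
  pair v (fun xi => k * a xi) = k * pair v a.
Proof.
move=> Lv Ta; rewrite /pair -(ipZr _ Lv (L2_hartley Ta)).
by congr ip; apply/funext => x; rewrite hartleyZ.
Qed.

Lemma pairD v a b : L2 leb v -> real_test a -> real_test b ->
  pair v (fun xi => a xi + b xi) = pair v a + pair v b.
Proof.
move=> Lv Ta Tb; rewrite /pair -(ipDr (L2_hartley Ta) (L2_hartley Tb) Lv).
by congr ip; apply/funext => x; rewrite hartleyD.
Qed.

Lemma pair_bound v a : L2 leb v -> real_test a ->
  `|pair v a| <= nrm leb v * (Num.sqrt (@kappa R d) * nrm leb a).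
Proof.
by move=> Lv Ta; rewrite -nrm_hartley//; apply: CauchySchwarz => //; exact: L2_hartley.
Qed.

Lemma isD_remainder (f : R -> R) (t l : R) :
  (forall e : R, 0 < e -> exists2 de, 0 < de &
    forall h : R, h != 0 -> `|h| < de -> `|f (t + h) - f t - h * l| <= e * `|h|) ->
  is_derive t 1 f l.
Proof.
move=> H; suff cl : h^-1 *: (f (h *: 1 + t) - f t) @[h --> 0^'] --> l.
  apply: DeriveDef; first by apply/cvg_ex; exists l.
  exact: cvg_lim.
apply/cvgrPdist_le => e e0; have [de de0 Hd] := H e e0.
exists de => // h; rewrite /ball/= sub0r normrN => hde h0.
have h1 : 0 < `|h| by rewrite normr_gt0.
have -> : l - h^-1 *: (f (h *: 1 + t) - f t) = - (h^-1 * (f (t + h) - f t - h * l)).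
  have -> : h *: (1 : R) + t = t + h by rewrite addrC; congr (_ + _); exact: mulr1.
  by rewrite /GRing.scale/=; field.
by rewrite normrN normrM normfV ler_pdivrMl// [leRHS]mulrC Hd.
Qed.

Definition weak_deriv u t du := forall e : R, 0 < e -> exists2 de, 0 < de &
  forall h : R, h != 0 -> `|h| < de -> forall b, real_test b ->
    `|\int[leb]_x ((u (t + h) x - u t x - h * du x) * hartley b x)| <= e * `|h| * nrm leb b.

(** Product rule. It is enough that the test moves differentiably in [L2], because the weak
   derivative of [u] is uniform in the test. *)
Lemma pair_derive u t du (A : R -> X -> R) A' (C : R) :
  (forall r, L2 leb (u r)) -> L2 leb du -> weak_deriv u t du ->
  (forall r, real_test (A r)) -> real_test A' -> 0 <= C ->
  (forall h, nrm leb (fun x => A (t + h) x - A t x - h * A' x) <= C * h ^+ 2) ->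
  is_derive t 1 (fun r => pair (u r) (A r)) (pair du (A t) + pair (u t) A').
Proof.
move=> Lu Ldu Du TA TA' C0 DA; apply: isD_remainder => e e0.
have LA r : L2 leb (A r) by have [] := rt_L2 (TA r).
have LA' : L2 leb A' by have [] := rt_L2 TA'.
pose n0 := nrm leb (A t); pose n1 := nrm leb A'; pose K := Num.sqrt (@kappa R d).
have [n00 n10 K0] : [/\ 0 <= n0, 0 <= n1 & 0 <= K] by rewrite !nrm_ge0 sqrtr_ge0.
pose N := n0 + C + n1 + 1; have N0 : 0 < N by rewrite ltr_wpDl// !addr_ge0.
pose M := nrm leb (u t) * K * C + nrm leb du * K * (C + n1) + 1.
have M0 : 0 < M.
  by rewrite ltr_wpDl// addr_ge0// !mulr_ge0 ?nrm_ge0// addr_ge0.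
have [de1 de10 H1] := Du (e / (2 * N)) (divr_gt0 e0 (mulr_gt0 (ltr0n R 2) N0)).
exists (Num.min de1 (Num.min 1 (e / (2 * M)))) => [|h h0].
  by rewrite !lt_min de10 ltr01/= divr_gt0// mulr_gt0.
rewrite !lt_min => /andP[hde1 /andP[h1 hM]].
have ah : 0 < `|h| by rewrite normr_gt0.
have h2 : h ^+ 2 = `|h| * `|h| by rewrite -normrM -expr2 ger0_norm ?sqr_ge0.
have hh : h ^+ 2 <= `|h| by rewrite h2 ger_pMr// ltW.
pose r := fun x => A (t + h) x - A t x - h * A' x.
have Tr : real_test r.
  have := rtD (rtD (TA (t + h)) (rtZ (-1) (TA t))) (rtZ (- h) TA').
  by congr real_test; apply/funext => x; rewrite /r; ring.
have [_ Lr] := rt_L2 Tr; have rC : nrm leb r <= C * h ^+ 2 by exact: DA.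
have AE : A (t + h) = fun x => (A t x + h * A' x) + r x by apply/funext => x; rewrite /r; ring.
have P2 v : L2 leb v -> pair v (A (t + h)) = pair v (A t) + h * pair v A' + pair v r.
  move=> Lv; have Th := rtZ h TA'; rewrite AE (pairD Lv (rtD (TA t) Th) Tr).
  by rewrite (pairD Lv (TA t) Th) (pairZ h Lv TA').
have P1 : \int[leb]_x ((u (t + h) x - u t x - h * du x) * hartley (A (t + h)) x) =
    pair (u (t + h)) (A (t + h)) - pair (u t) (A (t + h)) - h * pair du (A (t + h)).
  have LH := L2_hartley (TA (t + h)).
  have := ipBl (L2B (Lu (t + h)) (Lu t)) (L2Z h Ldu) LH.
  by rewrite (ipBl (Lu (t + h)) (Lu t) LH) (ipZl _ Ldu LH).
have nA : nrm leb (A (t + h)) <= N.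
  rewrite AE (le_trans (nrmD (L2D (LA t) (L2Z h LA')) Lr))//.
  have := nrmD (LA t) (L2Z h LA'); rewrite nrmZ// => T.
  rewrite (le_trans (lerD T rC))//.
  have : `|h| * nrm leb A' <= n1 by rewrite ler_piMl// ltW.
  have : C * h ^+ 2 <= C by rewrite ler_piMr// (le_trans hh)// ltW.
  by rewrite /N -/n0; lra.
have {}H1 := H1 h h0 hde1 _ (TA (t + h)).
have -> : pair (u (t + h)) (A (t + h)) - pair (u t) (A t) - h * (pair du (A t) + pair (u t) A') =
    \int[leb]_x ((u (t + h) x - u t x - h * du x) * hartley (A (t + h)) x) +
    (pair (u t) r + h * (h * pair du A' + pair du r)).
  by rewrite P1 (P2 _ (Lu t)) (P2 _ Ldu); ring.
apply: (le_trans (ler_normD _ _)); rewrite [e in leRHS](splitr e) mulrDl lerD//.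
  apply: (le_trans H1); rewrite mulrAC ler_wpM2r//.
  have -> : e / (2 * N) * nrm leb (A (t + h)) = e / 2 * (nrm leb (A (t + h)) / N).
    by field; rewrite gt_eqF.
  by rewrite ler_piMr ?divr_ge0 ?(ltW e0)// ler_pdivrMr// mul1r.
have B1 : `|pair (u t) r| <= `|h| * `|h| * (nrm leb (u t) * K * C).
  apply: (le_trans (pair_bound (Lu t) Tr)); rewrite -/K -h2.
  have -> : h ^+ 2 * (nrm leb (u t) * K * C) = nrm leb (u t) * (K * (C * h ^+ 2)) by ring.
  by rewrite !ler_wpM2l ?nrm_ge0.
have B2 : `|pair du A'| <= nrm leb du * (K * n1) by exact: pair_bound.
have B3 : `|pair du r| <= `|h| * (nrm leb du * K * C).
  apply: (le_trans (pair_bound Ldu Tr)); rewrite -/K.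
  have -> : `|h| * (nrm leb du * K * C) = nrm leb du * (K * (C * `|h|)) by ring.
  by rewrite !ler_wpM2l ?nrm_ge0// (le_trans rC)// ler_wpM2l.
have B4 : `|h * (h * pair du A' + pair du r)| <= `|h| * `|h| * (nrm leb du * K * (C + n1)).
  rewrite normrM -mulrA ler_wpM2l// (le_trans (ler_normD _ _))//.
  rewrite normrM mulrDr mulrDr addrC lerD//.
  by rewrite ler_wpM2l// -mulrA.
have B5 : `|h| * M <= e / 2.
  by move/ltW: hM; rewrite ler_pdivlMr ?mulr_gt0//; lra.
apply: (le_trans (ler_normD _ _)); apply: (le_trans (lerD B1 B4)).
apply: (@le_trans _ _ (`|h| * (`|h| * M))); last by rewrite [leRHS]mulrC ler_wpM2l.
rewrite -mulrDr -[leLHS]mulrA !ler_wpM2l// /M lerDl; exact: ler01.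
Qed.

End MovingTest.

Section Oscillation.
Context {R : realType} {d : space_dim}.
Variable gamma : R.
Notation X := (Rd R d).
Notation q := (@qform R d gamma).
Implicit Types (a b v : X -> R) (u : R -> X -> R).

Lemma mean_value (f df : R -> R) (y : R) : (forall x : R, is_derive x 1 f (df x)) ->
  exists2 c, `|c| <= `|y| & f y - f 0 = df c * y.
Proof.
move=> Df; have Cf A : {within A, continuous f}.
  apply: continuous_subspaceT => x; apply/differentiable_continuous/derivable1_diffP.
  by have [] := Df x.
have [y0|y0] := leP 0 y.
  have [c + ->] := MVT_segment y0 (fun x _ => Df x) (Cf _).
  by rewrite in_itv/= => /andP[c0 cy]; exists c; rewrite ?subr0// !ger0_norm.
have [c + E] := MVT_segment (ltW y0) (fun x _ => Df x) (Cf _).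
rewrite in_itv/= => /andP[cy c0]; exists c; first by rewrite !ler0_norm ?(ltW y0)// lerN2.
by rewrite -opprB E; ring.
Qed.

Lemma sin_lip (x y : R) : `|sin (x + y) - sin x| <= `|y|.
Proof.
have D (z : R) : is_derive z 1 (fun z => sin (x + z)) (cos (x + z) * (0 + 1)).
  have Ds : is_derive z 1 (fun z => x + z) (0 + 1).
    exact: (isDD (@isD_cst R R x z 1) (is_derive_id z 1)).
  exact: (isD_comp Ds (is_derive_sin (x + z))).
have [c _] := mean_value y D; rewrite addr0 => ->.
by rewrite add0r mulr1 normrM ler_piMl// cos_max.
Qed.

Lemma cos_taylor (x y : R) : `|cos (x + y) - cos x - y * cos (x + pi / 2)| <= y ^+ 2.
Proof.
rewrite cosDpihalf.
have D (z : R) : is_derive z 1 (fun z => cos (x + z) + z * sin x)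
    (- sin (x + z) * (0 + 1) + (z * 0 + sin x * 1)).
  have Ds : is_derive z 1 (fun z => x + z) (0 + 1).
    exact: (isDD (@isD_cst R R x z 1) (is_derive_id z 1)).
  apply: (isDD (isD_comp Ds (is_derive_cos (x + z)))).
  exact: (isDM (is_derive_id z 1) (@isD_cst R R (sin x) z 1)).
have [c cy] := mean_value y D; rewrite !addr0 mul0r addr0.
have -> : cos (x + y) - cos x - y * - sin x = cos (x + y) + y * sin x - cos x by ring.
move=> ->; have -> : (- sin (x + c) * (0 + 1) + (c * 0 + sin x * 1)) * y =
  - (sin (x + c) - sin x) * y by ring.
rewrite normrM normrN -[leRHS]real_normK ?num_real// expr2 ler_wpM2r//.
exact: le_trans (sin_lip x c) cy.
Qed.

Variable O : R -> R.
Hypothesis O_smooth : forall n, Sn Rgt0 n O.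

(** The phases [th = 0] and [th = pi / 2] give the cosine and minus the sine, and
   differentiation in [r] shifts [th] by [pi / 2]. *)
Definition osc (th r : R) a (xi : X) : R := cos (r * O (q xi) + th) * a xi.

Lemma away_osc th r a : away a -> away (osc th r a).
Proof. by move=> Aa; exact: away_cos. Qed.

Lemma osc_mult th r (F : R -> R) a : osc th r (fun xi => F (q xi) * a xi) =
  fun xi => F (q xi) * osc th r a xi.
Proof. by apply/funext => xi; rewrite /osc mulrCA. Qed.

Lemma osc_half_turn r a : osc (pi / 2 + pi / 2) r a = fun xi => -1 * osc 0 r a xi.
Proof.
by apply/funext => xi; rewrite /osc addrA cosDpihalf sinDpihalf addr0 mulN1r mulNr.
Qed.

Lemma osc0 th a : osc th 0 a = fun xi => cos th * a xi.
Proof. by apply/funext => xi; rewrite /osc mul0r add0r. Qed.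

Lemma nrm_osc th r a : away a -> nrm leb (osc th r a) <= nrm leb a.
Proof.
move=> Aa; apply: nrm_le; [by case: (away_L2 (away_osc th r Aa))|exact: away_L2|].
by move=> xi; rewrite normrM ler_piMl// cos_max.
Qed.

Lemma pair_osc_derive u t du th tau eps a : 0 < eps ->
  (forall r, L2 leb (u r)) -> L2 leb du -> weak_deriv u t du -> away a ->
  is_derive t 1 (fun r => pair (u r) (osc th ((tau - r) / eps) a))
    (pair du (osc th ((tau - t) / eps) a) - eps^-1 *
     pair (u t) (osc (th + pi / 2) ((tau - t) / eps) (fun xi => O (q xi) * a xi))).
Proof.
move=> eps0 Lu Ldu Du Aa.
have A1 := away_mult gamma O_smooth Aa; have A2 := away_mult gamma O_smooth A1.
pose r := (tau - t) / eps.
have T' := away_rt (away_osc (th + pi / 2) r A1).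
have C0 : 0 <= eps^-1 ^+ 2 * nrm leb (fun xi => O (q xi) * (O (q xi) * a xi)).
  by rewrite mulr_ge0 ?nrm_ge0// sqr_ge0.
have DA h : nrm leb (fun x => osc th ((tau - (t + h)) / eps) a x - osc th ((tau - t) / eps) a x -
     h * (- eps^-1 * osc (th + pi / 2) r (fun xi => O (q xi) * a xi) x)) <=
     eps^-1 ^+ 2 * nrm leb (fun xi => O (q xi) * (O (q xi) * a xi)) * h ^+ 2.
  have k0 : 0 <= eps^-1 ^+ 2 * h ^+ 2 by rewrite mulr_ge0 ?sqr_ge0.
  rewrite mulrAC -(ger0_norm k0) -nrmZ; last exact: away_L2.
  have LB := L2B (L2B (away_L2 (away_osc th ((tau - (t + h)) / eps) Aa))
    (away_L2 (away_osc th r Aa))) (L2Z h (L2Z (- eps^-1) (away_L2 (away_osc (th + pi / 2) r A1)))).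
  apply: nrm_le; [by case: LB|exact: (L2Z _ (away_L2 A2))|move=> xi].
  rewrite (_ : _ - _ = (cos ((r * O (q xi) + th) + (- (h / eps) * O (q xi))) - cos (r * O (q xi) + th) -
    (- (h / eps) * O (q xi)) * cos (r * O (q xi) + th + pi / 2)) * a xi).
    rewrite normrM (le_trans (ler_wpM2r (normr_ge0 _) (cos_taylor _ _)))//.
    rewrite -[X in X * _]ger0_norm ?sqr_ge0// -normrM le_eqVlt; apply/orP; left; apply/eqP.
    by congr `|_|; ring.
  rewrite /osc -/r (_ : (tau - (t + h)) / eps * O (q xi) + th =
    (r * O (q xi) + th) + (- (h / eps) * O (q xi))); first by rewrite addrA; ring.
  by rewrite /r; ring.
have := pair_derive Lu Ldu Du (fun s => away_rt (away_osc th ((tau - s) / eps) Aa))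
  (rtZ (- eps^-1) T') C0 DA.
by rewrite pairZ// mulNr.
Qed.

End Oscillation.

(** * The evolution of the solution against a test function *)

Section Evolution.
Context {R : realType} {d : space_dim}.
Variables (mu gamma : R).
Hypothesis mu_gt0 : 0 < mu.
Notation X := (Rd R d).
Notation q := (@qform R d gamma).
Notation P := (symP mu).
Notation G := (symG mu).
Notation om := (symO mu).
Implicit Types (a b v : X -> R) (u : R -> X -> R).
Local Open Scope complex_scope.

Lemma fmult_hartley m v g b : is_fmult m v g -> real_test b ->
  [/\ integr leb (fun x => v x * hartley (fun xi => m xi * b xi) x),
      integr leb (fun x => g x * hartley b x) &
      pair v (fun xi => m xi * b xi) = pair g b].
Proof.
move=> F /test_diag Tb.
have E : (fun xi => (m xi)%:C * (b xi +i* b xi)) = fun xi => (m xi * b xi) +i* (m xi * b xi).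
  by apply/funext => xi; apply/eqP; rewrite eq_complex /= !mul0r subr0 addr0 !eqxx.
have [D1 D2 D3] := F _ Tb; move: D1 D3; rewrite E {E} => D1 D3; split.
- exact: (pairing_hartley_def D1).
- exact: (pairing_hartley_def D2).
have h1 := pairing_hartley v (fun xi => m xi * b xi); have h2 := pairing_hartley g b.
exact: (etrans (esym h1) (etrans (congr1 (@complex.Re R) D3) h2)).
Qed.

Lemma fmult_spec (m v : X -> R) : fmult_def m v -> L2 leb (fmult m v) /\ is_fmult m v (fmult m v).
Proof.
case=> g g2 gm; rewrite L2_Lfun.
by apply: (@xgetPex _ _ [set g | g \in Lfun leb 2%:E /\ is_fmult m v g]); exists g.
Qed.

Lemma frakP_hartley (v : X -> R) b : fmult_def (frakP_symbol mu gamma) v -> real_test b ->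
  pair v (fun xi => P (q xi) * b xi) = pair (frakP mu gamma v) b.
Proof. by move=> /fmult_spec[_ F] Tb; have [_ _ <-] := fmult_hartley F Tb. Qed.

Lemma sym_quotient F1 F2 a : (forall y : R, 0 < y -> F2 y != 0) -> away a ->
  (fun xi => F2 (q xi) * (F1 (q xi) / F2 (q xi) * a xi)) = fun xi => F1 (q xi) * a xi.
Proof.
move=> F20 Aa; apply/funext => xi; have [->|a0] := eqVneq (a xi) 0; first by rewrite !mulr0.
have [c c0 qc] := away_qform gamma Aa.
have := F20 (q xi) (lt_le_trans c0 (qc _ a0)); move=> h; field; exact: h.
Qed.

(** The pairing of [(v, w)] with the solution, at distance [r] in fast time from its final
   value [(a, b)], of the adjoint system
   [eps * A' = P * B], [eps * B' = - (om ^ 2 / P) * A]. *)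
Definition backward v w r a b : R :=
  pair v (osc gamma om 0 r a) +
  pair v (osc gamma om (pi / 2) r (fun xi => P (q xi) / om (q xi) * b xi)) +
  (pair w (osc gamma om 0 r b) -
   pair w (osc gamma om (pi / 2) r (fun xi => om (q xi) / P (q xi) * a xi))).

Let om0 (y : R) : 0 < y -> om y != 0.
Proof. by move=> y0; apply: lt0r_neq0; exact: symO_gt0. Qed.

Let P0 (y : R) : 0 < y -> P y != 0.
Proof. by move=> y0; apply: lt0r_neq0; exact: symP_gt0. Qed.

Let SO n : Sn Rgt0 n om.
Proof. exact: Sn_symO. Qed.

Lemma away_Pom b : away b -> away (fun xi => P (q xi) / om (q xi) * b xi).
Proof.
apply: (@away_mult _ _ _ (fun y => P y / om y)) => // n.
by apply: Sn_div => // [|y]; [exact: Sn_symP|exact: symO_gt0].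
Qed.

Lemma away_omP a : away a -> away (fun xi => om (q xi) / P (q xi) * a xi).
Proof.
apply: (@away_mult _ _ _ (fun y => om y / P y)) => // n.
by apply: Sn_div => // [|y]; [exact: Sn_symP|exact: symP_gt0].
Qed.

Lemma nrm_Pom b : away b -> nrm leb (fun xi => P (q xi) / om (q xi) * b xi) <= nrm leb b.
Proof.
move=> Ab; have [c c0 qc] := away_qform gamma Ab.
apply: nrm_le; [by case: (away_L2 (away_Pom Ab))|exact: away_L2|move=> xi].
have [->|b0] := eqVneq (b xi) 0; first by rewrite mulr0.
have q0 := lt_le_trans c0 (qc _ b0); have [_ H] := symO_symP mu_gt0 q0.
have [p0 o0] := (symP_gt0 mu q0, symO_gt0 mu_gt0 q0).
rewrite normrM ler_piMl// ger0_norm ?divr_ge0 ?(ltW p0) ?(ltW o0)//.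
by rewrite ler_pdivrMr// mul1r -(@ler_pXn2r _ 2)// nnegrE ltW.
Qed.

Lemma nrm_omP a : away a -> nrm leb (fun xi => om (q xi) / P (q xi) * a xi) <= 2 * nrm leb a.
Proof.
move=> Aa; have [c c0 qc] := away_qform gamma Aa.
rewrite -[2 in leRHS]ger0_norm// -(nrmZ _ (away_L2 Aa)).
apply: nrm_le; [by case: (away_L2 (away_omP Aa))|exact: (L2Z _ (away_L2 Aa))|move=> xi].
have [->|a0] := eqVneq (a xi) 0; first by rewrite !mulr0.
have q0 := lt_le_trans c0 (qc _ a0); have [H _] := symO_symP mu_gt0 q0.
have [p0 o0] := (symP_gt0 mu q0, symO_gt0 mu_gt0 q0).
have f0 : 0 <= om (q xi) / P (q xi) by rewrite divr_ge0// ltW.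
rewrite normrM [leRHS]normrM ler_wpM2r// !ger0_norm//.
rewrite ler_pdivrMr// -(@ler_pXn2r _ 2)// ?nnegrE ?mulr_ge0 ?(ltW p0) ?(ltW o0)//.
by rewrite exprMn (le_trans H)// ler_wpM2r ?sqr_ge0// -natrX ler_nat.
Qed.

(** A bound independent of [r], hence of the speed of the oscillations, and valid in both
   directions of time. *)
Lemma backward_bound v w r a b : L2 leb v -> L2 leb w -> away a -> away b ->
  `|backward v w r a b| <=
  Num.sqrt (@kappa R d) * ((nrm leb v + 2 * nrm leb w) * (nrm leb a + nrm leb b)).
Proof.
move=> Lv Lw Aa Ab; have K0 : 0 <= Num.sqrt (@kappa R d) by exact: sqrtr_ge0.
have H v' th c : L2 leb v' -> away c ->
    `|pair v' (osc gamma om th r c)| <= Num.sqrt (@kappa R d) * (nrm leb v' * nrm leb c).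
  move=> Lv' Ac; apply: (le_trans (pair_bound Lv' (away_rt (away_osc gamma SO th r Ac)))).
  by rewrite mulrCA ler_wpM2l// ler_wpM2l ?nrm_ge0// nrm_osc.
have H1 := H v 0 a Lv Aa; have H2 := H v (pi / 2) _ Lv (away_Pom Ab).
have H3 := H w 0 b Lw Ab; have H4 := H w (pi / 2) _ Lw (away_omP Aa).
have {}H2 := le_trans H2 (ler_wpM2l K0 (ler_wpM2l (nrm_ge0 _ v) (nrm_Pom Ab))).
have {}H4 := le_trans H4 (ler_wpM2l K0 (ler_wpM2l (nrm_ge0 _ w) (nrm_omP Aa))).
rewrite /backward; apply: (le_trans (ler_normD _ _)).
apply: (le_trans (lerD (ler_normD _ _) (ler_normB _ _))).
apply: (le_trans (lerD (lerD H1 H2) (lerD H3 H4))).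
rewrite -!mulrDr; apply: ler_wpM2l => //.
have sum (x y u' v' : R) : 0 <= y -> 0 <= v' ->
    x * (u' + v') + y * (v' + 2 * u') <= (x + 2 * y) * (u' + v').
  by move=> y0 v0; rewrite -subr_ge0 (_ : _ - _ = y * v'); [exact: mulr_ge0|ring].
by apply: sum; exact: nrm_ge0.
Qed.

Section Solution.
Variables (eps s : R) (zeta0 psi0 : X -> R) (zeta psi : R -> X -> R).
Hypotheses (eps_gt0 : 0 < eps) (s_ge1 : 1 <= s).
Hypothesis data : admissible_data mu gamma s zeta0 psi0.
Hypothesis sol : is_solution mu gamma eps s zeta0 psi0 zeta psi.
Notation W := (fun t => frakP mu gamma (psi t)).

Let s1 : 0 <= s - 1. Proof. by rewrite subr_ge0. Qed.

Lemma L2_zeta t : L2 leb (zeta t).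
Proof. by apply/L2_Lfun; have [[]] := sol_zeta_cont sol t. Qed.

Lemma L2_W t : L2 leb (W t).
Proof. by apply/L2_Lfun; have [[]] := sol_frakP_cont sol t. Qed.

Lemma C1_L2 u du t : C1_Hs (s - 1) u du -> L2 leb (du t).
Proof. by case=> _ H _; apply/L2_Lfun; have [[]] := H t. Qed.

Lemma C1_weak u du t : C1_Hs (s - 1) u du -> weak_deriv u t (du t).
Proof. by move=> H e e0; exact: (C1_Hs_pairing t s1 H e0). Qed.

(** On the support of the test, [G0 psi] is the multiplier [G / P] applied to the second
   unknown [W]: in this form the equation involves functions of [L2] only. *)
Lemma zeta_eq : exists dzeta, [/\ forall t, L2 leb (dzeta t),
  forall t, weak_deriv zeta t (dzeta t) &
  forall t b, away b ->
    pair (dzeta t) b = eps^-1 * pair (W t) (fun xi => (om (q xi) ^+ 2 / P (q xi)) * b xi)].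
Proof.
have [dz H E] := sol_zeta_eq sol; exists dz; split => [t|t|t b Ab].
- exact: C1_L2 H.
- exact: C1_weak H.
have [Gd Eq] := E t; have Tb := away_rt Ab; have [LG FG] := fmult_spec Gd.
have [_ Ib EG] := fmult_hartley FG Tb.
have {}EG : pair (psi t) (fun xi => G (q xi) * b xi) = pair (G0 mu gamma (psi t)) b := EG.
have Ac : away (fun xi => G (q xi) / P (q xi) * b xi).
  apply: (@away_mult _ _ _ (fun y => G y / P y)) => // n.
  apply: Sn_div => [||y]; [exact: Sn_symG|exact: Sn_symP|exact: symP_gt0].
have -> : (fun xi => (om (q xi) ^+ 2 / P (q xi)) * b xi) =
    (fun xi => mu^-1 * (G (q xi) / P (q xi) * b xi)).
  apply/funext => xi; have [->|b0] := eqVneq (b xi) 0; first by rewrite !mulr0.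
  have [c c0 qc] := away_qform gamma Ab.
  rewrite symO_sqr//; last exact: lt_le_trans (qc _ b0).
  by ring.
rewrite (pairZ _ (L2_W t) (away_rt Ac)) -(frakP_hartley (sol_frakP_def sol t) (away_rt Ac)).
rewrite (@sym_quotient G P) // EG mulrA /pair -ipZl //; last exact: L2_hartley.
apply: ip_ae_eq; first by apply: integr_meas; apply: L2M; [exact: C1_L2 H|exact: L2_hartley].
  by apply: integr_meas; apply: L2M; [exact: (L2Z _ LG)|exact: L2_hartley].
apply: filterS Eq => x /eqP; rewrite subr_eq0 => /eqP Ex.
apply: (mulfI (lt0r_neq0 eps_gt0)); rewrite Ex mulrA mulrA mulfV ?mul1r//.
exact: lt0r_neq0.
Qed.

(** Testing the equation of [psi] with [P b] gives an equation for [W], and identifies the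
   derivative of [W] in [H^(s - 1)]. *)
Lemma W_eq : exists dW, [/\ forall t, L2 leb (dW t),
  forall t, weak_deriv W t (dW t) &
  forall t b, away b ->
    pair (dW t) b = - eps^-1 * pair (zeta t) (fun xi => P (q xi) * b xi)].
Proof.
have [dW H] := sol_frakP_C1 sol; exists dW; split => [t|t|t b Ab].
- exact: C1_L2 H.
- exact: C1_weak H.
have Tb := away_rt Ab; have TP := away_rt (away_mult gamma (fun n => @Sn_symP R mu n) Ab).
have T0 : real_test (fun _ : X => 0 : R) by exact: away_rt away0.
have D : is_derive t 1 (fun r => pair (W r) b) (pair (dW t) b).
  have := @pair_derive R d W t (dW t) (fun=> b) (fun=> 0) 0 L2_W (C1_L2 t H)
    (C1_weak t H) (fun=> Tb) T0 (lexx 0).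
  have -> : pair (W t) (fun=> 0) = 0.
    rewrite (_ : (fun=> 0) = fun xi => 0 * b xi); first by rewrite (pairZ 0 (L2_W t) Tb) mul0r.
    by apply/funext => x; rewrite mul0r.
  rewrite addr0; apply => h; rewrite mul0r.
  rewrite (_ : (fun x => b x - b x - h * 0) = fun xi => 0 * b xi).
    by rewrite (nrmZ 0 (away_L2 Ab)) normr0 mul0r.
  by apply/funext => x; rewrite subrr mulr0 subr0 mul0r.
have [_] := sol_psi_eq sol (test_diag TP) t.
rewrite pairing_hartley -/(pair _ _).
have -> : (fun r => complex.Re (pairing_hat (psi r) (fun xi => (P (q xi) * b xi) +i* (P (q xi) * b xi)))) =
    fun r => pair (W r) b.
  apply/funext => r; rewrite pairing_hartley -/(pair _ _).
  exact: (frakP_hartley (sol_frakP_def sol r) Tb).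
rewrite derive1E derive_val => E.
have solve (w z : R) : eps * w + z = 0 -> w = - eps^-1 * z.
  by move=> /eqP; rewrite addrC addr_eq0 => /eqP ->; field; exact: lt0r_neq0.
exact: solve E.
Qed.

(** The pairing of the state with a solution of the adjoint system does not depend on time.
   At time [tau] the adjoint solution takes its final value [(a, b)]. *)
Theorem adjoint_flow tau t a b : away a -> away b ->
  pair (zeta tau) a + pair (W tau) b = backward (zeta t) (W t) ((tau - t) / eps) a b.
Proof.
move=> Aa Ab /=; have [dz [Ldz wdz Ez]] := zeta_eq; have [dW [LdW wdW EW]] := W_eq.
pose b' xi := P (q xi) / om (q xi) * b xi; pose a' xi := om (q xi) / P (q xi) * a xi.
have Ab' : away b' by exact: away_Pom.
have Aa' : away a' by exact: away_omP.
pose Phi t := pair (zeta t) (osc gamma om 0 ((tau - t) / eps) a) +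
  pair (zeta t) (osc gamma om (pi / 2) ((tau - t) / eps) b') +
  (pair (W t) (osc gamma om 0 ((tau - t) / eps) b) -
   pair (W t) (osc gamma om (pi / 2) ((tau - t) / eps) a')).
suff Phi0 (r : R) : is_derive r 1 Phi 0.
  rewrite -[RHS]/(Phi t) (is_derive_0_is_cst t tau Phi0) /Phi subrr mul0r !osc0.
  have PZ (k : R) v c : L2 leb v -> away c -> pair v (fun xi => k * c xi) = k * pair v c.
    by move=> Lv /away_rt; exact: pairZ.
  rewrite (PZ _ _ _ (L2_zeta tau) Aa) (PZ _ _ _ (L2_zeta tau) Ab').
  rewrite (PZ _ _ _ (L2_W tau) Ab) (PZ _ _ _ (L2_W tau) Aa').
  by rewrite cos0 cos_pihalf; move: (pair _ _) (pair _ _) (pair _ _) (pair _ _) => *; ring.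
have D1 := pair_osc_derive gamma SO 0 tau eps_gt0 L2_zeta (Ldz r) (wdz r) Aa.
have D2 := pair_osc_derive gamma SO (pi / 2) tau eps_gt0 L2_zeta (Ldz r) (wdz r) Ab'.
have D3 := pair_osc_derive gamma SO 0 tau eps_gt0 L2_W (LdW r) (wdW r) Ab.
have D4 := pair_osc_derive gamma SO (pi / 2) tau eps_gt0 L2_W (LdW r) (wdW r) Aa'.
have D5 := isDD (isDD D1 D2) (is_deriveB D3 D4).
apply: (isD_ext _ _ D5) => [//|].
set ro := (tau - r) / eps.
have I1 : (fun xi => om (q xi) * b' xi) = fun xi => P (q xi) * b xi by exact: sym_quotient.
have I2 : (fun xi => P (q xi) * a' xi) = fun xi => om (q xi) * a xi by exact: sym_quotient.
have I3 : (fun xi => om (q xi) ^+ 2 / P (q xi) * b' xi) = fun xi => om (q xi) * b xi.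
  apply/funext => xi; rewrite /b'; have [->|b0] := eqVneq (b xi) 0; first by rewrite !mulr0.
  have [c c0 qc] := away_qform gamma Ab; have q0 := lt_le_trans c0 (qc _ b0).
  by field; rewrite om0// P0.
have I4 : (fun xi => om (q xi) * a' xi) = fun xi => om (q xi) ^+ 2 / P (q xi) * a xi.
  by apply/funext => xi; rewrite /a'; ring.
have F0 th (c : X -> R) : away c -> away (osc gamma om th ro c) by exact: away_osc.
have wz th (c : X -> R) : away c -> pair (dz r) (osc gamma om th ro c) =
    eps^-1 * pair (W r) (osc gamma om th ro (fun xi => om (q xi) ^+ 2 / P (q xi) * c xi)).
  by move=> Ac; rewrite (Ez r _ (F0 th c Ac)) -(osc_mult gamma om th ro (fun y => om y ^+ 2 / P y)).
have wW th (c : X -> R) : away c -> pair (dW r) (osc gamma om th ro c) =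
    - eps^-1 * pair (zeta r) (osc gamma om th ro (fun xi => P (q xi) * c xi)).
  by move=> Ac; rewrite (EW r _ (F0 th c Ac)) -(osc_mult gamma om th ro P).
rewrite (wz _ _ Aa) (wz _ _ Ab') (wW _ _ Ab) (wW _ _ Aa') I1 I2 I3 I4 add0r !osc_half_turn.
have A1 : away (osc gamma om 0 ro (fun xi => P (q xi) * b xi)).
  exact: (F0 _ _ (away_mult gamma (fun n => @Sn_symP R mu n) Ab)).
have A2 : away (osc gamma om 0 ro (fun xi => om (q xi) ^+ 2 / P (q xi) * a xi)).
  by apply: F0; rewrite -I4; exact: (away_mult gamma SO Aa').
rewrite (pairZ _ (L2_zeta r) (away_rt A1)) (pairZ _ (L2_W r) (away_rt A2)).
move: (pair _ (osc gamma om 0 ro (fun xi => om (q xi) ^+ 2 / P (q xi) * a xi))) => p1.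
move: (pair _ (osc gamma om 0 ro (fun xi => P (q xi) * b xi))) => p2.
move: (pair _ (osc gamma om (pi / 2) ro (fun xi => om (q xi) * a xi))) => p3.
move: (pair _ (osc gamma om (pi / 2) ro (fun xi => om (q xi) * b xi))) => p4.
by move: (eps^-1) => k; ring.
Qed.

Lemma zeta_init a : real_test a -> pair (zeta 0) a = pair zeta0 a.
Proof.
move=> Ta; have [[z2 _ _] _ _ _] := data; have LH := L2_hartley Ta.
have Lz : L2 leb zeta0 by apply/L2_Lfun.
apply: ip_ae_eq (sol_zeta_init sol); apply: integr_meas.
- exact: (L2M (L2_zeta 0) LH).
- exact: (L2M Lz LH).
Qed.

Lemma W_init b : real_test b -> pair (W 0) b = pair (frakP mu gamma psi0) b.
Proof.
move=> Tb; have [_ _ D0 _] := data; have D1 := sol_frakP_def sol 0.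
have [_ F0] := fmult_spec D0; have [_ F1] := fmult_spec D1.
have [I0 _ <-] := fmult_hartley F0 Tb; have [I1 _ <-] := fmult_hartley F1 Tb.
apply: ip_ae_eq (sol_psi_init sol); [exact: (integr_meas I1)|exact: (integr_meas I0)].
Qed.

Lemma backward_init r a b : away a -> away b ->
  backward (zeta 0) (W 0) r a b = backward zeta0 (frakP mu gamma psi0) r a b.
Proof.
move=> Aa Ab; have T th (c : X -> R) : away c -> real_test (osc gamma om th r c).
  by move=> Ac; exact: (away_rt (away_osc gamma SO th r Ac)).
rewrite /backward (zeta_init (T 0 _ Aa)) (zeta_init (T (pi / 2) _ (away_Pom Ab))).
by rewrite (W_init (T 0 _ Ab)) (W_init (T (pi / 2) _ (away_omP Aa))).
Qed.

End Solution.
End Evolution.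

(** * Weak convergence, and failure of strong convergence *)

Section Duality.
Context {R : realType} {d : space_dim}.
Notation X := (Rd R d).
Implicit Types (a v : X -> R).

Lemma pair0 v : pair v (fun=> 0) = 0.
Proof.
rewrite /pair /ip; under eq_Rintegral => x _.
  rewrite /hartley; under eq_Rintegral do rewrite mulr0.
  by rewrite Rintegral_cst// mul0r mulr0; over.
by rewrite Rintegral_cst// mul0r.
Qed.

(** If [hartley a] is close to [v], then [pair v a] is close to [|v|^2], whereas [sqrt kappa * |a|],
   the norm of [hartley a], is close to [|v|]. *)
Lemma nrm_dual v (M : R) : L2 leb v -> 0 <= M ->
  (forall a, away a -> `|pair v a| <= Num.sqrt (@kappa R d) * (M * nrm leb a)) ->
  nrm leb v <= M.
Proof.
move=> Lv M0 H; apply/ler_addgt0Pr => e e0; rewrite leNgt; apply/negP => Mv.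
have n0 := nrm_ge0 leb v; set n := nrm leb v in n0 Mv *.
have n1 : 0 < n by apply: le_lt_trans Mv; rewrite addr_ge0// ltW.
have nM : 0 < n + M by rewrite ltr_pwDl.
(* with this accuracy the error terms add up to [n * e / 2] *)
have de0 : 0 < n * e / (n + M) / 2 by rewrite !divr_gt0// mulr_gt0.
have [a Aa va] := hartley_dense Lv de0.
have Ta := away_rt Aa; have LH := L2_hartley Ta; have LB := L2B Lv LH.
have E : n ^+ 2 = ip leb v (fun x => v x - hartley a x) + pair v a.
  by rewrite nrm2 (ipBr Lv LH Lv) subrK.
have h1 := CauchySchwarz Lv LB.
have h2 : `|pair v a| <= M * (n + n * e / (n + M) / 2).
  apply: (le_trans (H a Aa)); rewrite mulrCA ler_wpM2l// -nrm_hartley//.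
  have := nrmB Lv LB; rewrite (_ : (fun x => v x - (v x - hartley a x)) = hartley a).
    by move/le_trans; apply; rewrite lerD2l.
  by apply/funext => x; rewrite opprB addrC subrK.
have h3 : ip leb v (fun x => v x - hartley a x) <= n * (n * e / (n + M) / 2).
  apply: (le_trans (ler_norm _)); apply: (le_trans h1).
  by rewrite ler_wpM2l.
have h4 : pair v a <= M * (n + n * e / (n + M) / 2) := le_trans (ler_norm _) h2.
have : n ^+ 2 <= n * M + n * e / 2.
  rewrite E; apply: (le_trans (lerD h3 h4)); rewrite le_eqVlt; apply/orP; left; apply/eqP.
  by field; rewrite gt_eqF.
have : n * (M + e) < n * n by rewrite ltr_pM2l.
have : 0 < n * e by rewrite mulr_gt0.
by rewrite expr2; nra.
Qed.

Lemma dual_zero v : L2 leb v -> (forall a, away a -> pair v a = 0) ->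
  {ae leb, forall x, v x = 0}.
Proof.
move=> Lv H; apply: ip_ae0 => //; rewrite -nrm2.
have /le_anti : nrm leb v <= 0 <= nrm leb v.
  by rewrite nrm_ge0 andbT; apply: nrm_dual => // a /H ->; rewrite normr0 mul0r mulr0.
by move=> ->; rewrite expr0n.
Qed.

(** A bounded family need only be tested on a dense set. *)
Lemma weakly_to_zeroP (v : R -> X -> R) (B : R) : (forall eps, 0 < eps -> L2 leb (v eps)) ->
  (forall eps, 0 < eps -> nrm leb (v eps) <= B) ->
  (forall a, away a -> forall e : R, 0 < e -> exists2 de, 0 < de &
     forall eps, 0 < eps -> eps < de -> `|pair (v eps) a| <= e) ->
  weakly_to_zero v.
Proof.
move=> Lv vB H phi /L2_Lfun Lphi; apply/cvgrPdist_le => e e0.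
have B0 : 0 <= B := le_trans (nrm_ge0 _ _) (vB 1 ltr01).
have B1 : 0 < 2 * (B + 1) by rewrite mulr_gt0// ltr_wpDl.
have [a Aa pa] := hartley_dense Lphi (divr_gt0 e0 B1).
have LH := L2_hartley (away_rt Aa); have LD := L2B Lphi LH.
have e2 : 0 < e / 2 by rewrite divr_gt0.
have [de de0 Hd] := H a Aa _ e2.
exists de => //= eps; rewrite /ball/= sub0r normrN => eps_de eps0.
have {}eps_de : eps < de by rewrite (le_lt_trans _ eps_de)// ler_norm.
rewrite sub0r normrN -/(ip leb (v eps) phi).
have -> : ip leb (v eps) phi = ip leb (v eps) (fun x => phi x - hartley a x) + pair (v eps) a.
  by rewrite (ipBr Lphi LH (Lv _ eps0)) subrK.
rewrite (le_trans (ler_normD _ _))// [leRHS]splitr lerD ?Hd//.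
apply: (le_trans (CauchySchwarz (Lv _ eps0) LD)).
apply: (@le_trans _ _ (B * (e / (2 * (B + 1))))).
  by apply: ler_pM; rewrite ?nrm_ge0 ?vB.
have -> : B * (e / (2 * (B + 1))) = e / 2 * (B / (B + 1)).
  by field; rewrite gt_eqF// ltr_wpDl.
by rewrite ler_piMr ?(ltW e2)// ler_pdivrMr ?ltr_wpDl// mul1r lerDl.
Qed.

(** A strong limit is also a weak limit, so it vanishes. *)
Lemma strong_small (v : R -> X -> R) f : (forall eps, 0 < eps -> L2 leb (v eps)) ->
  L2 leb f -> weakly_to_zero v -> strongly_to v f ->
  forall e : R, 0 < e -> exists2 de, 0 < de &
    forall eps, 0 < eps -> eps < de -> nrm leb (v eps) <= e.
Proof.
move=> Lv Lf W S.
have S' (e : R) : 0 < e -> exists2 de, 0 < de &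
    forall eps, 0 < eps -> eps < de -> nrm leb (fun x => v eps x - f x) <= e.
  move=> e0; have N0 : nbhs (0 : \bar R)%E [set y | (y < e%:E)%E].
    by apply: open_nbhs_nbhs; split; [exact: open_ereal_lt_ereal|rewrite /= lte_fin].
  have [de /= de0 Hd] := S _ N0; exists de => // eps eps0 eps_de.
  have : ball 0 de eps by rewrite /ball/= sub0r normrN gtr0_norm.
  move=> /Hd /(_ eps0); rewrite /L2norm Lnorm_nrm ?lte_fin => [/ltW//|].
  exact: L2B (Lv _ eps0) Lf.
suff f0 : nrm leb f = 0.
  move=> e e0; have [de de0 Hd] := S' e e0; exists de => // eps eps0 eps_de.
  have := nrmD (L2B (Lv _ eps0) Lf) Lf; rewrite f0 addr0.
  rewrite (_ : (fun x => v eps x - f x + f x) = v eps); last by apply/funext => x; rewrite subrK.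
  by move/le_trans; apply; exact: Hd.
have n0 := nrm_ge0 leb f; apply/eqP; rewrite eq_le n0 andbT leNgt; apply/negP => n1.
set n := nrm leb f in n0 n1.
have n2 : 0 < n / 4 by rewrite divr_gt0.
have n3 : 0 < n ^+ 2 / 4 by rewrite divr_gt0// exprn_gt0.
have [de1 de10 H1] := S' _ n2.
have /cvgrPdist_le /(_ _ n3) [de2 /= de20 H2] := W f (iffLR (L2_Lfun leb f) Lf).
pose eps := Num.min de1 de2 / 2.
have m0 : 0 < Num.min de1 de2 by rewrite lt_min de10.
have eps0 : 0 < eps by rewrite divr_gt0.
have em : eps < Num.min de1 de2 by rewrite /eps; lra.
move: em; rewrite lt_min => /andP[e1 e2].
have Hf := H1 eps eps0 e1.
have : ball 0 de2 eps by rewrite /ball/= sub0r normrN gtr0_norm.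
move=> /H2 /(_ eps0); rewrite sub0r normrN -/(ip leb (v eps) f) => Hw.
have LB := L2B (Lv _ eps0) Lf.
have E : n ^+ 2 = ip leb (v eps) f - ip leb (fun x => v eps x - f x) f.
  by rewrite nrm2 (ipBl (Lv _ eps0) Lf Lf) opprB addrC subrK.
have h1 := CauchySchwarz LB Lf.
have h2 : nrm leb (fun x => v eps x - f x) * nrm leb f <= n / 4 * n by rewrite ler_wpM2r.
have h3 : `|n ^+ 2| <= n ^+ 2 / 4 + n / 4 * n.
  rewrite {1}E (le_trans (ler_normB _ _))// lerD//; exact: le_trans h1 h2.
move: h3; rewrite ger0_norm ?sqr_ge0//; have : 0 < n ^+ 2 by rewrite exprn_gt0.
by rewrite expr2; lra.
Qed.

End Duality.

Section Oscillating.
Context {R : realType} {d : space_dim}.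
Variables (mu gamma : R).
Hypothesis mu_gt0 : 0 < mu.
Notation X := (Rd R d).
Notation om := (symO mu).
Implicit Types (a b v w : X -> R).

(** The partner of [v] turns the pairing into an oscillating integral over frequencies. *)
Lemma pair_osc_small s v a th (e : R) : 0 <= s -> in_Hs s v -> away a -> 0 < e ->
  exists L, forall r, L <= `|r| -> `|pair v (osc gamma om th r a)| <= e.
Proof.
move=> s0 Hv Aa e0; have [F LF FE] := in_Hs_partner s0 Hv.
have [dom [dO pO]] := symO_derive mu_gt0.
have SO n : Sn Rgt0 n om by exact: Sn_symO.
have [L HL] := riemann_lebesgue gamma SO dO pO th LF Aa e0.
exists L => r Lr; rewrite /pair FE; first exact: HL.
exact: (away_rt (away_osc gamma SO th r Aa)).
Qed.

Lemma backward_small s v w a b (e : R) : 0 <= s -> in_Hs s v -> in_Hs s w ->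
  away a -> away b -> 0 < e ->
  exists L, forall r, L <= `|r| -> `|backward mu gamma v w r a b| <= e.
Proof.
move=> s0 Hv Hw Aa Ab e0; have e4 : 0 < e / 4 by rewrite divr_gt0.
have [L1 H1] := pair_osc_small 0 s0 Hv Aa e4.
have [L2 H2] := pair_osc_small (pi / 2) s0 Hv (away_Pom gamma mu_gt0 Ab) e4.
have [L3 H3] := pair_osc_small 0 s0 Hw Ab e4.
have [L4 H4] := pair_osc_small (pi / 2) s0 Hw (away_omP gamma mu_gt0 Aa) e4.
exists (Num.max (Num.max L1 L2) (Num.max L3 L4)) => r.
rewrite !ge_max => /andP[/andP[/H1 {}H1 /H2 {}H2] /andP[/H3 {}H3 /H4 {}H4]].
apply: (le_trans (ler_normD _ _)); apply: (le_trans (lerD (ler_normD _ _) (ler_normB _ _))).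
apply: (le_trans (lerD (lerD H1 H2) (lerD H3 H4))).
by rewrite le_eqVlt; apply/orP; left; apply/eqP; field.
Qed.

End Oscillating.

Theorem theorem2p6 (R : realType) (d : space_dim) (mu gamma s : R)
  (mu_gt0 : 0 < mu) (gamma_gt0 : 0 < gamma) (s_ge1 : 1 <= s)
  (zeta0 psi0 : Rd R d -> R)
  (data : admissible_data mu gamma s zeta0 psi0)
  (zeta psi : R -> R -> Rd R d -> R)
  (sol : forall eps : R, 0 < eps ->
    is_solution mu gamma eps s zeta0 psi0 (zeta eps) (psi eps)) :
  forall t : R, t != 0 ->
    (weakly_to_zero (fun eps => zeta eps t) /\
     weakly_to_zero (fun eps => frakP mu gamma (psi eps t)))
    /\
    (~ ({ae leb, forall x, zeta0 x = 0} /\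
        {ae leb, forall x, frakP mu gamma psi0 x = 0}) ->
     ~ (exists f g : Rd R d -> R,
          [/\ f \in Lfun leb 2%:E, g \in Lfun leb 2%:E,
              strongly_to (fun eps => zeta eps t) f &
              strongly_to (fun eps => frakP mu gamma (psi eps t)) g])).
Proof.
move=> t t0; have s0 : 0 <= s := le_trans ler01 s_ge1.
have [Hz _ _ HW] := data; pose W0 := frakP mu gamma psi0.
have Lz0 : L2 leb zeta0 by apply/L2_Lfun; case: Hz.
have LW0 : L2 leb W0 by apply/L2_Lfun; case: HW.
have Lz (eps : R) (eps0 : 0 < eps) r : L2 leb (zeta eps r) := L2_zeta (sol eps eps0) r.
have LW (eps : R) (eps0 : 0 < eps) r : L2 leb (frakP mu gamma (psi eps r)) := L2_W (sol eps eps0) r.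
have A0 : away (fun _ : Rd R d => 0 : R) := away0.
have N0 : nrm leb (fun _ : Rd R d => 0 : R) = 0.
  by rewrite /nrm /ip; under eq_Rintegral do rewrite mul0r; rewrite Rintegral_cst// mul0r sqrtr0.
have K0 : 0 <= Num.sqrt (@kappa R d) by exact: sqrtr_ge0.
(* the state at time [t], tested, is an oscillating pairing of the data *)
have now (eps : R) (eps0 : 0 < eps) a b : away a -> away b ->
    pair (zeta eps t) a + pair (frakP mu gamma (psi eps t)) b =
    backward mu gamma zeta0 W0 (t / eps) a b.
  move=> Aa Ab; rewrite (adjoint_flow mu_gt0 eps0 s_ge1 (sol eps eps0) t 0 Aa Ab) subr0.
  exact: (backward_init mu_gt0 data (sol eps eps0)).
have nowz (eps : R) (eps0 : 0 < eps) a : away a ->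
    pair (zeta eps t) a = backward mu gamma zeta0 W0 (t / eps) a (fun=> 0).
  by move=> Aa; rewrite -(now eps eps0 _ _ Aa A0) pair0 addr0.
have nowW (eps : R) (eps0 : 0 < eps) b : away b ->
    pair (frakP mu gamma (psi eps t)) b = backward mu gamma zeta0 W0 (t / eps) (fun=> 0) b.
  by move=> Ab; rewrite -(now eps eps0 _ _ A0 Ab) pair0 add0r.
pose B := nrm leb zeta0 + 2 * nrm leb W0.
have B0 : 0 <= B by rewrite addr_ge0 ?mulr_ge0 ?nrm_ge0.
have small (a b : Rd R d -> R) (e : R) : away a -> away b -> 0 < e -> exists2 de, 0 < de &
    forall eps, 0 < eps -> eps < de -> `|backward mu gamma zeta0 W0 (t / eps) a b| <= e.
  move=> Aa Ab e0; have [L HL] := backward_small gamma mu_gt0 s0 Hz HW Aa Ab e0.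
  have L1 : 0 < `|L| + 1 by rewrite ltr_wpDl.
  exists (`|t| / (`|L| + 1)) => [|eps eps0]; first by rewrite divr_gt0// normr_gt0.
  rewrite ltr_pdivlMr// mulrC -ltr_pdivlMr// => h; apply: HL.
  rewrite normrM normfV (gtr0_norm eps0) (le_trans (ler_norm L))// (le_trans _ (ltW h))//.
  by rewrite lerDl.
have wz : weakly_to_zero (fun eps => zeta eps t).
  apply: (@weakly_to_zeroP _ _ _ B) => [eps eps0|eps eps0|a Aa e e0]; first exact: Lz.
    apply: nrm_dual => // [|a Aa]; first exact: Lz.
    rewrite (nowz _ eps0 _ Aa).
    by have := backward_bound gamma mu_gt0 (t / eps) Lz0 LW0 Aa A0; rewrite N0 addr0.
  have [de de0 H] := small a _ e Aa A0 e0; exists de => // eps eps0 /(H _ eps0).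
  by rewrite (nowz _ eps0 _ Aa).
have wW : weakly_to_zero (fun eps => frakP mu gamma (psi eps t)).
  apply: (@weakly_to_zeroP _ _ _ B) => [eps eps0|eps eps0|a Aa e e0]; first exact: LW.
    apply: nrm_dual => // [|a Aa]; first exact: LW.
    rewrite (nowW _ eps0 _ Aa).
    by have := backward_bound gamma mu_gt0 (t / eps) Lz0 LW0 A0 Aa; rewrite N0 add0r.
  have [de de0 H] := small _ a e A0 Aa e0; exists de => // eps eps0 /(H _ eps0).
  by rewrite (nowW _ eps0 _ Aa).
split => // nontrivial [f [g [/L2_Lfun Lf /L2_Lfun Lg Sf Sg]]]; apply: nontrivial.
have Nz := strong_small (fun eps eps0 => Lz eps eps0 t) Lf wz Sf.
have NW := strong_small (fun eps eps0 => LW eps eps0 t) Lg wW Sg.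
(* running the flow from time [t] back to time [0] *)
have zero a b : away a -> away b -> pair zeta0 a + pair W0 b = 0.
  move=> Aa Ab; apply/eqP; rewrite -normr_le0; apply/ler_addgt0Pr => e e0; rewrite add0r.
  pose c := Num.sqrt (@kappa R d) * (nrm leb a + nrm leb b).
  have c0 : 0 <= c by rewrite mulr_ge0// addr_ge0 ?nrm_ge0.
  have c1 : 0 < c + 1 by rewrite ltr_wpDl.
  have e3 : 0 < e / (c + 1) / 3 by rewrite !divr_gt0.
  have [d1 d10 H1] := Nz _ e3; have [d2 d20 H2] := NW _ e3.
  have m0 : 0 < Num.min d1 d2 by rewrite lt_min d10.
  pose eps := Num.min d1 d2 / 2.
  have eps0 : 0 < eps by rewrite divr_gt0.
  have em : eps < Num.min d1 d2 by rewrite /eps; lra.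
  move: em; rewrite lt_min => /andP[/(H1 _ eps0) {}H1 /(H2 _ eps0) {}H2].
  have S := sol eps eps0.
  rewrite -(zeta_init data S (away_rt Aa)) -(W_init data S (away_rt Ab)).
  rewrite (adjoint_flow mu_gt0 eps0 s_ge1 S 0 t Aa Ab).
  apply: (le_trans (backward_bound gamma mu_gt0 _ (Lz _ eps0 t) (LW _ eps0 t) Aa Ab)).
  rewrite mulrCA -/c.
  have h : nrm leb (zeta eps t) + 2 * nrm leb (frakP mu gamma (psi eps t)) <= e / (c + 1).
    apply: (le_trans (lerD H1 (ler_wpM2l (ler0n R 2) H2))).
    by rewrite le_eqVlt; apply/orP; left; apply/eqP; field; exact: lt0r_neq0.
  apply: (le_trans (ler_wpM2r c0 h)).
  rewrite mulrAC ler_pdivrMr// ler_wpM2l ?(ltW e0)//.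
  by rewrite lerDl.
split; [apply: dual_zero Lz0 _ => a Aa|apply: dual_zero LW0 _ => a Aa].
  by have := zero a _ Aa A0; rewrite pair0 addr0.
by have := zero _ a A0 Aa; rewrite pair0 add0r.
Qed.
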